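(* Let $\delta\ge0$. Suppose that the following two assumptions hold. (Definiteness) The seminorm $v\mapsto\|v''\|_{L^2(0,L)}$ is a norm on the kernel of $L_{\rm bc}:H^2(0,L;\mathbb{R}^3)\to\mathbb{R}^\ell$. (Density) The set $\mathcal{A}_\delta\cap H^3(0,L;\mathbb{R}^3)$ is dense in $\mathcal{A}_\delta$ with respect to strong convergence in $H^2$. Then the problems of minimizing $I_{h,\varepsilon}$ over $\mathcal{A}_h$ approximate, as $(h,\varepsilon)\to0$, the sheet indentation problem of minimizing $I$ over $\mathcal{A}_\delta$, in the sense of $\Gamma$-convergence with respect to weak convergence in $H^2$, i.e., for $(h,\varepsilon)\to(0,0)$ with $h,\varepsilon>0$: (i) if $u_h\in\mathcal{A}_h$ are such that $I_{h,\varepsilon}[u_h]\le c$ with a constant $c$, then there exist $u\in\mathcal{A}_\delta$ and a subsequence (not relabeled) with $u_h\rightharpoonup u$ in $H^2(0,L;\mathbb{R}^3)$ and $I[u]\le\liminf_{(h,\varepsilon)\to0}I_{h,\varepsilon}[u_h]$; (ii) for every $u\in\mathcal{A}_\delta$ there exist $u_h\in\mathcal{A}_h$ with $u_h\to u$ in $H^2(0,L;\mathbb{R}^3)$ and $I[u]=\lim_{(h,\varepsilon)\to0}I_{h,\varepsilon}[u_h]$; (iii) weak accumulation points in $H^2(0,L;\mathbb{R}^3)$ of sequences of quasiminimizers of $I_{h,\varepsilon}$ over $\mathcal{A}_h$ are minimizers of $I$ over $\mathcal{A}_\delta$.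
   Context: The circle $S^1$ is identified with the interval $[0,L]$, $L=2\pi$, and the periodicity of curves on $S^1$ is imposed through boundary conditions $L_{\rm bc}[v]=\ell_{\rm bc}$, where $L_{\rm bc}:H^2(0,L;\mathbb{R}^3)\to\mathbb{R}^\ell$ is a bounded linear operator such that $L_{\rm bc}[v]$ only depends on the boundary values of $v$ and $v'$, and $\ell_{\rm bc}\in\mathbb{R}^\ell$. The surface is the unit sphere, i.e., the zero level set of $\Phi_S(s)=|s|^2-1$. Define $$\mathcal{A}=\{v\in H^2(0,L;\mathbb{R}^3):|v|^2=1,\ |v'|^2=1\text{ on }[0,L],\ L_{\rm bc}[v]=\ell_{\rm bc}\},\qquad\mathcal{A}_\delta=\{u\in\mathcal{A}:u_3\ge\delta\text{ on }[0,L]\},$$ where $u_3$ is the third component of $u$; the admissible set $\mathcal{A}_\delta$ is assumed nonempty. For partitions $0=z_0<\dots<z_J=L$ with maximal mesh size $h=\max_j|z_j-z_{j-1}|$, $V_h$ is the space of all $v_h\in C^1([0,L];\mathbb{R}^3)$ that are componentwise polynomials of degree at most $3$ on each $[z_{j-1},z_j]$, $\mathcal{I}_h$ is the continuous piecewise linear nodal interpolation operator, and $$\mathcal{A}_h=\{v_h\in V_h:|v_h'(z_j)|=1,\ |v_h(z_j)|=1,\ j=0,\dots,J,\ L_{\rm bc}[v_h]=\ell_{\rm bc}\}.$$ With $(s)_-=\min\{s,0\}$, $$I[u]=\frac12\int_0^L|u''|^2\,dx-\pi,\qquad I_{h,\varepsilon}[u_h]=\frac12\int_0^L|u_h''|^2\,dx+\frac1{2\varepsilon}\int_0^L\mathcal{I}_h(u_{h,3}-\delta)_-^2\,dx-\pi,$$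 where $u_{h,3}$ is the third component of $u_h$. Quasiminimizers are $u_h\in\mathcal{A}_h$ with $I_{h,\varepsilon}[u_h]\le\inf_{\mathcal{A}_h}I_{h,\varepsilon}+\eta_{h,\varepsilon}$, where $\eta_{h,\varepsilon}\ge0$ and $\eta_{h,\varepsilon}\to0$. *)

(* Defs.v *)
From HB Require Import structures.
From mathcomp Require Import all_boot all_order all_algebra.
From mathcomp Require Import all_classical all_reals all_analysis.
Set Implicit Arguments.
Unset Strict Implicit.
Unset Printing Implicit Defensive.
Import Order.TTheory GRing.Theory Num.Theory.
Import numFieldNormedType.Exports.
Local Open Scope classical_set_scope.
Local Open Scope ring_scope.

(* Functions on [0, L] are represented by total functions on R; every notion
   below only looks at their values on [0, L]. *)

Definition len (R : realType) : R := 2 * pi.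

Definition dom (R : realType) : set R := `[0, len R]%classic.

(* The norm carried by 'rV[R]_n in the library is the maximum norm. *)
Definition dotsq (R : realType) (n : nat) (x : 'rV[R]_n) : R :=
  \sum_(i < n) (x 0 i) ^+ 2.
Definition enorm (R : realType) (n : nat) (x : 'rV[R]_n) : R :=
  Num.sqrt (dotsq x).

Definition third (R : realType) (x : 'rV[R]_3) : R := x 0 ord_max.

(** * Sobolev spaces *)

Definition L2 (R : realType) (f : R -> R) : Prop :=
  f \_ (@dom R) \in Lfun (lebesgue_measure) 2%:E.

(* C^1_c(0, L), the class of test functions used e.g. by Brezis to define weak
   derivatives on an interval; C^oo_c(0, L) gives the same notion. *)
Definition test_function (R : realType) (phi : R -> R) : Prop :=
  [/\ forall x, derivable phi x 1, continuous (derive1 phi) &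
      exists a b, [/\ 0 < a, b < len R &
                      forall x, x \notin `[a, b] -> phi x = 0]].

Definition weak_derivative1 (R : realType) (f g : R -> R) : Prop :=
  forall phi, test_function phi ->
    \int[lebesgue_measure]_(x in @dom R) (f x * derive1 phi x) =
    - \int[lebesgue_measure]_(x in @dom R) (g x * phi x).

Definition weak_derivative (R : realType) (v g : R -> 'rV[R]_3) : Prop :=
  forall i, [/\ L2 (fun x => v x 0 i), L2 (fun x => g x 0 i) &
                weak_derivative1 (fun x => v x 0 i) (fun x => g x 0 i)].

Fixpoint weakly_differentiable (R : realType) (k : nat)
    (v : R -> 'rV[R]_3) : Prop :=
  if k is k'.+1 then
    exists g, weak_derivative v g /\ weakly_differentiable k' g
  else forall i, L2 (fun x => v x 0 i).

(* H^k(0, L; R^3) for k >= 1: an element is given by its continuous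
   representative on [0, L]. *)
Definition Hsp (R : realType) (k : nat) : set (R -> 'rV[R]_3) :=
  [set v | {within @dom R, continuous v} /\ weakly_differentiable k v].
Notation H2 := (Hsp 2).
Notation H3 := (Hsp 3).

(* For v in H^2, the representative of v' that is continuous on [0, L]; it is
   unique on [0, L], and agrees there with the classical derivative when v is
   in C^1([0, L]). *)
Definition D1 (R : realType) (v : R -> 'rV[R]_3) : R -> 'rV[R]_3 :=
  xget (fun=> 0) [set g | {within @dom R, continuous g} /\ weak_derivative v g].

(* For v in H^2, a representative of v'' (unique almost everywhere). *)
Definition D2 (R : realType) (v : R -> 'rV[R]_3) : R -> 'rV[R]_3 :=
  xget (fun=> 0) [set g | weak_derivative (D1 v) g].

Definition L2normsq (R : realType) (v : R -> 'rV[R]_3) : R :=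
  \int[lebesgue_measure]_(x in @dom R) dotsq (v x).

Definition H2norm (R : realType) (v : R -> 'rV[R]_3) : R :=
  Num.sqrt (L2normsq v + L2normsq (D1 v) + L2normsq (D2 v)).

(* N is the norm considered on the target space W. *)
Definition bounded_linear_H2 (R : realType) (W : lmodType R) (N : W -> R)
    (F : (R -> 'rV[R]_3) -> W) : Prop :=
  (forall (a : R) u v, H2 u -> H2 v -> F (a *: u + v) = a *: F u + F v) /\
  (exists C : R, forall v, H2 v -> N (F v) <= C * H2norm v).

Definition strong_cvg_H2 (R : realType) (v_ : nat -> R -> 'rV[R]_3)
    (v : R -> 'rV[R]_3) : Prop :=
  [/\ forall n, H2 (v_ n), H2 v & H2norm (v_ n - v) @[n --> \oo] --> (0 : R)].

Definition weak_cvg_H2 (R : realType) (v_ : nat -> R -> 'rV[R]_3)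
    (v : R -> 'rV[R]_3) : Prop :=
  [/\ forall n, H2 (v_ n), H2 v &
      forall F : (R -> 'rV[R]_3) -> R^o,
        bounded_linear_H2 (fun x : R^o => `|x : R|) F ->
        (F (v_ n) : R) @[n --> \oo] --> (F v : R)].

(** * The continuous problem *)

Definition boundary_operator (R : realType) (l : nat)
    (Lbc : (R -> 'rV[R]_3) -> 'rV[R]_l) : Prop :=
  bounded_linear_H2 (@enorm R l) Lbc /\
  (forall u v, H2 u -> H2 v ->
     u 0 = v 0 -> u (len R) = v (len R) ->
     D1 u 0 = D1 v 0 -> D1 u (len R) = D1 v (len R) ->
     Lbc u = Lbc v).

Definition Adm (R : realType) (l : nat)
    (Lbc : (R -> 'rV[R]_3) -> 'rV[R]_l) (lbc : 'rV[R]_l) :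
    set (R -> 'rV[R]_3) :=
  [set v | [/\ H2 v, forall x, @dom R x -> dotsq (v x) = 1,
               forall x, @dom R x -> dotsq (D1 v x) = 1 & Lbc v = lbc]].

Definition Adm_delta (R : realType) (l : nat)
    (Lbc : (R -> 'rV[R]_3) -> 'rV[R]_l) (lbc : 'rV[R]_l) (delta : R) :
    set (R -> 'rV[R]_3) :=
  [set u | Adm Lbc lbc u /\ forall x, @dom R x -> delta <= third (u x)].

Definition energy (R : realType) (u : R -> 'rV[R]_3) : R :=
  2^-1 * L2normsq (D2 u) - pi.

Definition is_minimizer (R : realType) (A : set (R -> 'rV[R]_3))
    (E : (R -> 'rV[R]_3) -> R) (u : R -> 'rV[R]_3) : Prop :=
  A u /\ forall v, A v -> E u <= E v.

Definition is_norm_on (R : realType) (K : set (R -> 'rV[R]_3))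
    (N : (R -> 'rV[R]_3) -> R) : Prop :=
  [/\ forall u v, K u -> K v -> N (u + v) <= N u + N v,
      forall (a : R) u, K u -> N (a *: u) = `|a| * N u &
      forall u, K u -> N u = 0 -> forall x, @dom R x -> u x = 0].

Definition definiteness (R : realType) (l : nat)
    (Lbc : (R -> 'rV[R]_3) -> 'rV[R]_l) : Prop :=
  is_norm_on [set v | H2 v /\ Lbc v = 0] (fun v => Num.sqrt (L2normsq (D2 v))).

Definition density (R : realType) (l : nat)
    (Lbc : (R -> 'rV[R]_3) -> 'rV[R]_l) (lbc : 'rV[R]_l) (delta : R) : Prop :=
  forall u, Adm_delta Lbc lbc delta u -> forall e : R, 0 < e ->
    exists2 w, (Adm_delta Lbc lbc delta `&` H3) w & H2norm (w - u) < e.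

(** * The discrete problems *)

(* A partition 0 = z_0 < ... < z_J = L is given by s = [:: z_1; ...; z_J] with
   itv_partition 0 L s. *)
Definition node (R : realType) (s : seq R) (j : nat) : R :=
  nth (len R) (0 :: s) j.

Definition mesh_size (R : realType) (s : seq R) : R :=
  \big[Num.max/0]_(j < size s) `|node s j.+1 - node s j|.

Definition C1 (R : realType) (v : R -> 'rV[R]_3) : Prop :=
  {within @dom R, continuous v} /\
  exists v1 : R -> 'rV[R]_3, {within @dom R, continuous v1} /\
    forall x, x \in `]0, len R[ -> is_derive x 1 v (v1 x).

Definition Vh (R : realType) (s : seq R) : set (R -> 'rV[R]_3) :=
  [set v | C1 v /\
     forall (j : 'I_(size s)) (i : 'I_3), exists2 p : {poly R},
       (size p <= 4)%N &
       forall x, x \in `[node s j, node s j.+1] -> v x 0 i = p.[x]].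

Definition Adm_h (R : realType) (l : nat)
    (Lbc : (R -> 'rV[R]_3) -> 'rV[R]_l) (lbc : 'rV[R]_l) (s : seq R) :
    set (R -> 'rV[R]_3) :=
  [set v | [/\ Vh s v,
      forall j : 'I_(size s).+1, dotsq (D1 v (node s j)) = 1,
      forall j : 'I_(size s).+1, dotsq (v (node s j)) = 1 & Lbc v = lbc]].

(* The continuous piecewise affine function with values f (z_j) at the nodes,
   written as a telescoping sum of ramps: the j-th ramp increases from 0 to 1
   across [z_j, z_(j+1)] and is constant elsewhere. *)
Definition interp (R : realType) (s : seq R) (f : R -> R) (x : R) : R :=
  f (node s 0) +
  \sum_(j < size s) (f (node s j.+1) - f (node s j)) *
    Num.max 0 (Num.min 1 ((x - node s j) / (node s j.+1 - node s j))).

(* The interpolation operator acts on the squared negative part. *)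
Definition energy_h (R : realType) (delta : R) (s : seq R) (eps : R)
    (u : R -> 'rV[R]_3) : R :=
  2^-1 * L2normsq (D2 u) +
  (2 * eps)^-1 *
    (\int[lebesgue_measure]_(x in @dom R)
       interp s (fun y => (Num.min (third (u y) - delta) 0) ^+ 2) x)
  - pi.

Definition quasiminimizer (R : realType) (A : set (R -> 'rV[R]_3))
    (E : (R -> 'rV[R]_3) -> R) (eta : R) (u : R -> 'rV[R]_3) : Prop :=
  A u /\ E u <= inf (E @` A) + eta.

(* Main.v *)
Require Import Defs.
From HB Require Import structures.
From mathcomp Require Import all_boot all_order all_algebra.
From mathcomp Require Import all_classical all_reals all_analysis.
From mathcomp Require Import measurable_realfun ring lra.
Import Order.TTheory GRing.Theory Num.Theory.
Import numFieldNormedType.Exports.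
Local Open Scope classical_set_scope.
Local Open Scope ring_scope.
Set Implicit Arguments.
Unset Strict Implicit.
Unset Printing Implicit Defensive.

(** The discrete problems converge because every bound needed is read off the
    second derivative. Two ingredients carry the proof: compactness of discrete
    functions of bounded energy, for (i), and an interpolation operator that
    respects all the nodal constraints at once, for (ii); (iii) combines them.

    Compactness. If [u_h] is admissible with energy at most c, then
    |u_h''|^2 <= 2 (c + pi) in L^2, and u_h(0), u_h'(0) are unit vectors, since 0
    is a node. These data control the H^2 norm ([H2norm_le_Qnorm]), so that a
    subsequence converges weakly to some u ([weak_compactness_H2]). Values and
    slopes at a point are bounded functionals on H^2, hence converge, and u_h and
    u_h' are Holder continuous of exponent 1/2 with a uniform constant. A
    constraint that holds at the nodes of u_h therefore holds everywhere for u
    ([unit_limit]); and if u_3 were below delta at one point, then u_h would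
    violate the obstacle by a fixed amount at every node of a fixed interval, so
    that the penalty would be of order 1 / eps ([limit_obstacle]). The bending
    energy is weakly lower semicontinuous ([bend_lsc]). In (i) a subsequence along
    which the energies approach their lower limit is extracted beforehand
    ([liminf_subsequence]).

    Recovery. Let P_h be the L^2 projection onto the functions that are affine on
    each element. On each element the residual u'' - P_h u'' is orthogonal to 1
    and to t, so its first and second primitives vanish at all the nodes. Hence
    the function obtained by integrating P_h u'' twice from u(0) and u'(0) is the
    cubic Hermite interpolant of u ([hermite]): it has the nodal values and slopes
    of u, is admissible, and has no penalty. Its distance to u and its lack of
    bending energy are both the squared norm of the residual, by Pythagoras
    ([hermite_distance], [bend_hermite]). The residual tends to 0 because u is a
    limit of H^3 functions, whose second derivatives are Holder continuous
    ([residual_small]). In particular the energy of the interpolant is at most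
    that of u, which is the comparison that (iii) needs.

    Functions in H^2 are handled as twofold primitives of L^2 functions
    ([H2_rep]). This rests on the du Bois-Reymond lemma ([weak0_constant]), on the
    fact that a primitive has the expected weak derivative
    ([prim_weak_derivative]), and on the completeness of L^2 ([sq_complete]).

    Weak compactness is derived from completeness and the parallelogram law alone
    ([weak_sequential_compactness]). For a subsequence S consider the limit, along
    the tails of S, of the least norm on their convex hulls, and choose S so that
    passing to a further subsequence does not raise it. Nearly minimal elements of
    the hulls form a Cauchy sequence, with limit g. If a bounded functional F
    stayed above F(g) + e along some subsequence T of S, then the nearly minimal
    elements of the hulls of T, which are nearly minimal for S too and thus close
    to g, would also satisfy F >= F(g) + e, which is absurd. *)

(** * Square integrable functions on [0, L] *)

(** Locked so that unification does not compare integrals by unfolding them. *)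
HB.lock Definition integ {R : realType} (f : R -> R) : R :=
  \int[lebesgue_measure]_(x in @dom R) f x.

Section SquareIntegrable.
Context {R : realType}.
Local Notation mu := (@lebesgue_measure R).
Local Notation D := (@dom R : set (measurableTypeR R)).
Local Notation L := (len R).
Implicit Types (f g h : R -> R) (a b c x y t : R).

Definition ig f := mu.-integrable D (EFin \o f).
Definition meas f := measurable_fun D f.
Definition sq f := meas f /\ ig (fun x => f x ^+ 2).
Definition nsq f : R := integ (fun x => f x ^+ 2).
Definition dotp f g : R := integ (fun x => f x * g x).

Lemma integE f : integ f = \int[mu]_(x in D) f x.
Proof. by rewrite integ.unlock. Qed.

Lemma len_gt0 : 0 < L.
Proof. by rewrite /len mulr_gt0// pi_gt0. Qed.
Hint Resolve len_gt0 : core.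

Lemma domE x : D x = (0 <= x <= L) :> Prop.
Proof. by rewrite /dom /= in_itv. Qed.

Lemma dom0 : D 0. Proof. by rewrite domE lexx ltW. Qed.
Lemma domL : D L. Proof. by rewrite domE lexx ltW. Qed.

Lemma measurable_dom : measurable D. Proof. exact: measurable_itv. Qed.
Hint Resolve measurable_dom : core.

Lemma mu_dom : mu D = L%:E.
Proof. by rewrite /dom lebesgue_measure_itv /= lte_fin len_gt0 oppr0 adde0. Qed.

Lemma ig_meas f : ig f -> meas f.
Proof. by move=> /measurable_int/measurable_EFinP. Qed.

Lemma igD f g : ig f -> ig g -> ig (fun x => f x + g x).
Proof. by move=> igf igg; exact: (integrableD measurable_dom igf igg). Qed.

Lemma igZ a f : ig f -> ig (fun x => a * f x).
Proof. by move=> igf; exact: (integrableZl measurable_dom a igf). Qed.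

Lemma ig_le f g : meas f -> ig g -> (forall x, D x -> `|f x| <= g x) -> ig f.
Proof.
move=> mf ig_g fg; apply: (le_integrable _ _ _ ig_g) => //.
  exact/measurable_EFinP.
by move=> x Dx /=; rewrite lee_fin (le_trans (fg x Dx))// ler_norm.
Qed.

Lemma ig_cst c : ig (cst c).
Proof.
apply/measurable_bounded_integrable => //.
  by apply: (@le_lt_trans _ _ L%:E); [rewrite -mu_dom|rewrite ltry].
by exists `|c|; split=> // x /ltW cx y _; exact: le_trans cx.
Qed.

Lemma ig_bnd f c : meas f -> (forall x, D x -> `|f x| <= c) -> ig f.
Proof. by move=> mf fc; apply: (ig_le mf (ig_cst c)). Qed.

Lemma eq_integ f g : (forall x, D x -> f x = g x) -> integ f = integ g.
Proof.
by move=> fg; rewrite !integE; apply: eq_Rintegral => x /set_mem; exact: fg.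
Qed.

Lemma eq_ig f g : (forall x, D x -> f x = g x) -> ig f -> ig g.
Proof.
by move=> fg; apply: eq_integrable => // x /set_mem Dx /=; rewrite fg.
Qed.

Lemma integD f g : ig f -> ig g ->
  integ (fun x => f x + g x) = integ f + integ g.
Proof. by rewrite !integE; exact: RintegralD. Qed.

Lemma integB f g : ig f -> ig g ->
  integ (fun x => f x - g x) = integ f - integ g.
Proof. by rewrite !integE; exact: RintegralB. Qed.

Lemma integZ a f : ig f -> integ (fun x => a * f x) = a * integ f.
Proof. by rewrite !integE; exact: RintegralZl. Qed.

Lemma integ_cst c : integ (cst c) = c * L.
Proof.
rewrite (_ : L = fine L%:E)// -mu_dom integE.
exact: (Rintegral_cst mu measurable_dom c).
Qed.

Lemma integ0 : integ (cst (0 : R)) = 0.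
Proof. by rewrite integ_cst mul0r. Qed.

Lemma integ_ge0 f : (forall x, D x -> 0 <= f x) -> 0 <= integ f.
Proof. by move=> f0; rewrite integE; apply: Rintegral_ge0. Qed.

Lemma integ_le f g : ig f -> ig g -> (forall x, D x -> f x <= g x) ->
  integ f <= integ g.
Proof. by rewrite !integE; exact: le_Rintegral. Qed.

Lemma integ_norm f : ig f -> `|integ f| <= integ (fun x => `|f x|).
Proof. by rewrite !integE; exact: le_normr_Rintegral. Qed.

Lemma ig_norm f : ig f -> ig (fun x => `|f x|).
Proof. by move=> igf; exact: integrable_norm. Qed.

Lemma ig_sum n (F : 'I_n -> R -> R) : (forall i, ig (F i)) ->
  ig (fun x => \sum_(i < n) F i x).
Proof.
elim: n F => [F _|n IH F igF].
  by apply: eq_ig (ig_cst 0) => x _; rewrite big_ord0.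
apply: (@eq_ig (fun x => \sum_(i < n) F (widen_ord (leqnSn n) i) x + F ord_max x)).
  by move=> x _; rewrite big_ord_recr.
by apply: igD => //; apply: IH.
Qed.

Lemma integ_sum n (F : 'I_n -> R -> R) : (forall i, ig (F i)) ->
  integ (fun x => \sum_(i < n) F i x) = \sum_(i < n) integ (F i).
Proof.
elim: n F => [F _|n IH F igF].
  by rewrite big_ord0 -[RHS]integ0; apply: eq_integ => x _; rewrite big_ord0.
rewrite big_ord_recr /= -IH// -integD//; last exact: ig_sum.
by apply: eq_integ => x _; rewrite big_ord_recr.
Qed.

(** The product is controlled by the squares. *)
Lemma sq_mul f g : sq f -> sq g -> ig (fun x => f x * g x).
Proof.
move=> [mf f2] [mg g2]; apply: (ig_le _ (igD f2 g2)).
  exact: measurable_funM.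
move=> x _; rewrite ler_norml; apply/andP; split.
- have := sqr_ge0 (f x + g x); have := sqr_ge0 (f x - g x); nra.
- have := sqr_ge0 (f x + g x); have := sqr_ge0 (f x - g x); nra.
Qed.

Lemma eq_sq f g : (forall x, D x -> f x = g x) -> sq f -> sq g.
Proof.
move=> fg [mf f2]; split; last by apply: eq_ig f2 => x /fg ->.
by apply: eq_measurable_fun mf => x /set_mem; exact: fg.
Qed.

Lemma sqD f g : sq f -> sq g -> sq (fun x => f x + g x).
Proof.
move=> sf sg; split; first by apply: measurable_funD; [case: sf|case: sg].
have := igD (igD (proj2 sf) (proj2 sg)) (igZ 2 (sq_mul sf sg)).
by apply: eq_ig => x _; ring.
Qed.

Lemma sqZ a f : sq f -> sq (fun x => a * f x).
Proof.
move=> [mf f2]; split; first exact: measurable_funM.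
by have := igZ (a ^+ 2) f2; apply: eq_ig => x _; ring.
Qed.

Lemma sqN f : sq f -> sq (fun x => - f x).
Proof. by move=> /(sqZ (-1)); apply: eq_sq => x _; rewrite mulN1r. Qed.

Lemma sqB f g : sq f -> sq g -> sq (fun x => f x - g x).
Proof. by move=> sf sg; apply: sqD => //; exact: sqN. Qed.

Lemma sq_bnd f c : meas f -> (forall x, D x -> `|f x| <= c) -> sq f.
Proof.
move=> mf fc; split => //; apply: (@ig_bnd _ (c ^+ 2)).
  exact: measurable_funX.
move=> x Dx; rewrite normrX lerXn2r ?nnegrE ?fc//.
by rewrite (le_trans (normr_ge0 (f x)))// fc.
Qed.

Lemma sq_cst c : sq (cst c).
Proof. by apply: (@sq_bnd _ `|c|) => //; exact: measurable_cst. Qed.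

Lemma sq_ig f : sq f -> ig f.
Proof.
by move=> sf; apply: eq_ig (sq_mul sf (sq_cst 1)) => x _ /=; rewrite mulr1.
Qed.

Lemma sqMb f g c : sq f -> meas g -> (forall x, D x -> `|g x| <= c) ->
  sq (fun x => f x * g x).
Proof.
move=> [mf f2] mg gc; split; first exact: measurable_funM.
apply: (ig_le _ (igZ (c ^+ 2) f2)).
  by apply: measurable_funX; exact: measurable_funM.
move=> x Dx; rewrite normrX normrM exprMn mulrC real_normK ?num_real//.
rewrite (real_normK (num_real (f x))) ler_wpM2r ?sqr_ge0// -(real_normK (num_real (g x))) lerXn2r ?nnegrE ?gc//.
by rewrite (le_trans (normr_ge0 (g x)))// gc.
Qed.

Lemma sq_sum n (F : 'I_n -> R -> R) : (forall i, sq (F i)) ->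
  sq (fun x => \sum_(i < n) F i x).
Proof.
elim: n F => [F _|n IH F sF].
  by apply: eq_sq (sq_cst 0) => x _; rewrite big_ord0.
apply: (@eq_sq (fun x => \sum_(i < n) F (widen_ord (leqnSn n) i) x + F ord_max x)).
  by move=> x _; rewrite big_ord_recr.
by apply: sqD => //; apply: IH.
Qed.

Lemma dotpC f g : dotp f g = dotp g f.
Proof. by apply: eq_integ => x _; rewrite mulrC. Qed.

Lemma eq_nsq f g : (forall x, D x -> f x = g x) -> nsq f = nsq g.
Proof. by move=> fg; apply: eq_integ => x Dx; rewrite fg. Qed.

Lemma dotpDl f g h : sq f -> sq g -> sq h ->
  dotp (fun x => f x + g x) h = dotp f h + dotp g h.
Proof.
move=> sf sg sh; rewrite /dotp -integD; [|exact: sq_mul..].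
by apply: eq_integ => x _; rewrite mulrDl.
Qed.

Lemma dotpBl f g h : sq f -> sq g -> sq h ->
  dotp (fun x => f x - g x) h = dotp f h - dotp g h.
Proof.
move=> sf sg sh; rewrite /dotp -integB; [|exact: sq_mul..].
by apply: eq_integ => x _; rewrite mulrBl.
Qed.

Lemma dotpZl a f h : sq f -> sq h ->
  dotp (fun x => a * f x) h = a * dotp f h.
Proof.
move=> sf sh; rewrite /dotp -integZ; last exact: sq_mul.
by apply: eq_integ => x _; rewrite mulrA.
Qed.

Lemma nsqE f : nsq f = dotp f f.
Proof. by apply: eq_integ => x _; rewrite expr2. Qed.

Lemma nsq_ge0 f : 0 <= nsq f.
Proof. by apply: integ_ge0 => x _; exact: sqr_ge0. Qed.

Lemma nsqZ a f : sq f -> nsq (fun x => a * f x) = a ^+ 2 * nsq f.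
Proof.
move=> [_ f2]; rewrite /nsq -integZ//.
by apply: eq_integ => x _; rewrite exprMn.
Qed.

Lemma nsqD f g : sq f -> sq g ->
  nsq (fun x => f x + g x) = nsq f + 2 * dotp f g + nsq g.
Proof.
move=> sf sg; have [_ f2] := sf; have [_ g2] := sg.
have fg := sq_mul sf sg.
rewrite /nsq /dotp -integZ// -integD//; last exact: igZ.
rewrite -integD//; last by apply: igD => //; exact: igZ.
by apply: eq_integ => x _; ring.
Qed.

Lemma nsqB f g : sq f -> sq g ->
  nsq (fun x => f x - g x) = nsq f - 2 * dotp f g + nsq g.
Proof.
move=> sf sg.
have -> : nsq (fun x => f x - g x) = nsq (fun x => f x + -1 * g x).
  by apply: eq_nsq => x _; rewrite mulN1r.
rewrite nsqD//; last exact: sqZ.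
by rewrite nsqZ// dotpC dotpZl// dotpC; ring.
Qed.

Lemma nsqBC f g : nsq (fun x => f x - g x) = nsq (fun x => g x - f x).
Proof. by apply: eq_integ => x _; ring. Qed.

Lemma nsqD_le f g : sq f -> sq g ->
  nsq (fun x => f x + g x) <= 2 * nsq f + 2 * nsq g.
Proof.
move=> sf sg; have := nsq_ge0 (fun x => f x - g x).
by rewrite nsqB// nsqD//; lra.
Qed.

(** Cauchy-Schwarz: the discriminant of t |-> |f + t g|^2 is nonpositive. *)
Lemma dotp_CS f g : sq f -> sq g -> dotp f g ^+ 2 <= nsq f * nsq g.
Proof.
move=> sf sg.
have P t : 0 <= nsq f + 2 * t * dotp f g + t ^+ 2 * nsq g.
  have := nsq_ge0 (fun x => f x + t * g x).
  rewrite nsqD//; last exact: sqZ.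
  by rewrite nsqZ// dotpC dotpZl// dotpC; rewrite !mulrA.
have := nsq_ge0 g; rewrite le_eqVlt => /orP[/eqP g0|g0].
  move: P; rewrite -g0 => P; rewrite mulr0.
  have [->|d0] := eqVneq (dotp f g) 0; first by rewrite expr0n.
  have := P (- (nsq f + 1) / (2 * dotp f g)).
  rewrite mulr0 addr0 [X in _ + X](_ : _ = - (nsq f + 1)); last by field.
  by lra.
have := P (- dotp f g / nsq g).
have -> : nsq f + 2 * (- dotp f g / nsq g) * dotp f g +
   (- dotp f g / nsq g) ^+ 2 * nsq g = (nsq f * nsq g - dotp f g ^+ 2) / nsq g.
  by field; rewrite gt_eqF.
by rewrite pmulr_lge0 ?invr_gt0// subr_ge0.
Qed.

Lemma dotp_eq0 f g : sq f -> sq g -> nsq f = 0 -> dotp f g = 0.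
Proof.
move=> sf sg f0; have := dotp_CS sf sg; rewrite f0 mul0r => h.
by apply/eqP; rewrite -sqrf_eq0 eq_le h sqr_ge0.
Qed.

Lemma integ_CS f : sq f -> integ f ^+ 2 <= nsq f * L.
Proof.
move=> sf; have := dotp_CS sf (sq_cst 1).
have -> : dotp f (cst 1) = integ f by apply: eq_integ => x _; rewrite mulr1.
by have -> : nsq (cst 1) = L
  by rewrite -[RHS]mul1r -integ_cst; apply: eq_integ => x _; rewrite expr1n.
Qed.

Lemma L2P f : L2 f <-> sq f.
Proof.
split=> [Lf|[mf f2]].
  have mf : meas f.
    move: Lf; rewrite /L2 inE => /andP[/[!inE]/= mf _].
    exact/(measurable_restrictT _ _).2.
  split => //; have := Lfun2_integrable_sqr Lf.
  rewrite /ig => h; apply/(integrable_mkcond _ measurable_dom).2.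
  rewrite (_ : _ \_ _ = EFin \o (fun x => (f \_ D) x ^+ 2))//.
  apply/funext => x; rewrite /= /patch; case: ifPn => // _.
  by rewrite expr0n.
rewrite /L2 inE; apply/andP; split; rewrite inE /=.
  exact/(measurable_restrictT _ _).1.
rewrite /finite_norm unlock poweR_lty//.
have : mu.-integrable setT (EFin \o (fun x => (f \_ D) x ^+ 2)).
  rewrite (_ : EFin \o _ = (EFin \o (fun x => f x ^+ 2)) \_ D).
    exact/(integrable_mkcond _ measurable_dom).1.
  apply/funext => x; rewrite /= /patch; case: ifPn => // _.
  by rewrite expr0n.
move/integrableP => [_]; apply: le_lt_trans.
rewrite le_eqVlt; apply/orP; left; apply/eqP; apply: eq_integral => x _ /=.
by rewrite powR_mulrn// normrX.
Qed.

End SquareIntegrable.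
#[global] Hint Resolve len_gt0 measurable_dom : core.

(** * Completeness of L^2 *)

Section Complete.
Context {R : realType}.
Local Notation mu := (@lebesgue_measure R).
Local Notation D := (@dom R : set (measurableTypeR R)).
Local Notation L := (len R).
Implicit Types (f g h : R -> R) (a b c x y t : R).

Lemma EFin_integ f : ig f -> (\int[mu]_(x in D) (f x)%:E)%E = (integ f)%:E.
Proof.
by move=> igf; rewrite integE /Rintegral fineK//; exact: integrable_fin_num.
Qed.

Lemma measurable_limn_einf (F : nat -> R -> \bar R) :
  (forall n, measurable_fun D (F n)) ->
  measurable_fun D (fun x => limn_einf (F ^~ x)).
Proof.
move=> mF; apply: measurableT_comp => //.
by apply: measurable_fun_limn_esup => n; exact: measurableT_comp.
Qed.

(** The L^1 norm of each increment is bounded by its L^2 norm, as [0, L] has finite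
    measure. *)
Lemma integ_norm_le f : sq f -> integ (fun x => `|f x|) <= Num.sqrt (L * nsq f).
Proof.
move=> sf; have sn : sq (fun x => `|f x|).
  have [mf f2] := sf; split; first exact: measurableT_comp.
  by apply: eq_ig f2 => x _; rewrite real_normK// num_real.
have i0 : 0 <= integ (fun x => `|f x|) by apply: integ_ge0.
have E : nsq (fun x => `|f x|) = nsq f.
  by apply/eq_integ => x _; rewrite real_normK// num_real.
have Ln : 0 <= L * nsq f by rewrite mulr_ge0 ?nsq_ge0 ?(ltW len_gt0).
by rewrite -(ger0_norm i0) -sqrtr_sqr (ler_sqrt _ Ln) mulrC -E integ_CS.
Qed.

(** The increments have a summable L^1 norm, so that their sum is integrable, hence
    finite almost everywhere. *)
Lemma ae_cvg_of_fast_cauchy (u : nat -> R -> R) : (forall n, sq (u n)) ->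
  (forall n, nsq (fun x => u n.+1 x - u n x) <= 4^-1 ^+ n) ->
  {ae mu, forall x, D x -> cvgn (u ^~ x)}.
Proof.
move=> su hu.
pose d n x : R := `|u n.+1 x - u n x|.
have sd n : sq (fun x => u n.+1 x - u n x) by exact: sqB.
have igd n : ig (d n) by apply: ig_norm; exact: sq_ig.
have md n : measurable_fun D (EFin \o d n).
  by apply/measurable_EFinP; exact: ig_meas.
have d0 n x : D x -> (0 <= (EFin \o d n) x)%E by move=> _; rewrite lee_fin normr_ge0.
have dle n : integ (d n) <= Num.sqrt L * 2^-1 ^+ n.
  apply: (le_trans (integ_norm_le (sd n))).
  rewrite sqrtrM ?(ltW len_gt0)// ler_wpM2l ?sqrtr_ge0//.
  rewrite -[leRHS]ger0_norm ?exprn_ge0 ?invr_ge0// -sqrtr_sqr ler_sqrt ?sqr_ge0//.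
  rewrite exprAC (le_trans (hu n))//.
  by rewrite (_ : 2^-1 ^+ 2 = 4^-1 :> R)// expr2 -invfM -natrM.
pose G x := (\sum_(n <oo) (EFin \o d n) x)%E.
have mG : measurable_fun D G.
  by apply: (@ge0_emeasurable_sum _ _ _ _ _ xpredT) => //; move=> n x Dx _; exact: d0.
have G0 x : D x -> (0 <= G x)%E by move=> Dx; apply: nneseries_ge0 => n _ _; exact: d0.
have intG : (\int[mu]_(x in D) G x <= (Num.sqrt L * 2)%:E)%E.
  rewrite /G integral_nneseries//.
  apply: lime_le; first by apply: is_cvg_nneseries => n _ _; apply: integral_ge0 => x Dx; exact: d0.
  near=> n.
  rewrite (eq_bigr (fun i => (integ (d i))%:E)); last first.
    by move=> i _; rewrite -EFin_integ.
  rewrite sumEFin lee_fin.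
  apply: (@le_trans _ _ (\sum_(0 <= i < n) Num.sqrt L * 2^-1 ^+ i)).
    by apply: ler_sum.
  rewrite -mulr_sumr ler_wpM2l ?sqrtr_ge0//.
  suff -> : \sum_(0 <= i < n) 2^-1 ^+ i = 2 - 2 * 2^-1 ^+ n :> R.
    by rewrite gerBl mulr_ge0// exprn_ge0// invr_ge0.
  elim: {+}n => [|k IH]; first by rewrite big_nil expr0; ring.
  by rewrite big_nat_recr//= IH exprS; field.
have iG : mu.-integrable D G.
  apply/integrableP; split => //.
  have -> : (\int[mu]_(x in D) `|G x| = \int[mu]_(x in D) G x)%E.
    by apply: eq_integral => x /set_mem Dx; rewrite gee0_abs// G0.
  by rewrite (le_lt_trans intG)// ltry.
have := integrable_ae measurable_dom iG.
apply: (@filterS _ _ (ae_filter_ringOfSetsType mu)).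
move=> x hx Dx; have {hx} finG := hx Dx.
have c1 : cvgn [normed series (fun n => u n.+1 x - u n x)].
  apply: nondecreasing_is_cvgn.
    by apply: nondecreasing_series => n _ _; exact: normr_ge0.
  exists (fine (G x)) => _ [n _ <-].
  rewrite -lee_fin fineK// /series /= -sumEFin.
  by apply: (@nneseries_lim_ge R (fun n => (d n x)%:E) xpredT 0 n) => i _ _; exact: d0.
have := normed_cvg c1.
have -> : (fun n => u n.+1 x - u n x) = telescope (u ^~ x) by [].
rewrite telescopeK => /cvg_ex[l cl]; apply/cvg_ex; exists (l + u 0%N x).
have -> : u ^~ x = (fun n => [sequence u n x - u 0%N x]_n n + u 0%N x).
  by apply/funext => n /=; rewrite subrK.
by apply: cvgD => //; exact: cvg_cst.
Unshelve. all: by end_near. Qed.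

(** The limit is built pointwise along a fast subsequence; Fatou's lemma applied to
    [u m - u (k n)], with m fixed, bounds the distance from u m to it. *)
Lemma sq_complete (u : nat -> R -> R) : (forall n, sq (u n)) ->
  (forall e, 0 < e -> exists N, forall m n, (N <= m)%N -> (N <= n)%N ->
     nsq (fun x => u m x - u n x) <= e) ->
  exists2 f, sq f & nsq (fun x => u n x - f x) @[n --> \oo] --> (0 : R).
Proof.
move=> su hu.
have e4 n : 0 < 4^-1 ^+ n :> R by rewrite exprn_gt0// invr_gt0.
pose N n := sval (cid (hu _ (e4 n))).
have NP n m p : (N n <= m)%N -> (N n <= p)%N ->
    nsq (fun x => u m x - u p x) <= 4^-1 ^+ n.
  by rewrite /N; case: cid => /= M; apply.
pose k := fix k n := if n is n'.+1 then maxn (N n) (k n').+1 else N 0%N.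
have kN n : (N n <= k n)%N by case: n => //= n; exact: leq_maxl.
have kS n : (k n < k n.+1)%N by rewrite /= leq_maxr.
have kge n : (n <= k n)%N by elim: n => // n IH; exact: leq_ltn_trans IH (kS n).
have kmono m n : (m <= n)%N -> (k m <= k n)%N.
  elim: n => [|n IH]; first by rewrite leqn0 => /eqP ->.
  rewrite leq_eqVlt => /orP[/eqP->//|]; rewrite ltnS => /IH/leq_trans; apply.
  exact: ltnW.
have aec : {ae mu, forall x, D x -> cvgn (fun n => u (k n) x)}.
  apply: (@ae_cvg_of_fast_cauchy (fun n => u (k n))) => // n.
  by apply: NP => //; exact: leq_trans (kN n) (ltnW (kS n)).
pose f x := fine (limn_einf (fun n => (u (k n) x)%:E)).
have mf : meas f.
  apply: (@measurableT_comp _ _ _ _ _ _ (@fine R)).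
    exact: fine_measurable.
  apply: measurable_limn_einf => n; apply/measurable_EFinP.
  by have [] := su (k n).
have fP : {ae mu, forall x, D x -> (fun n => u (k n) x) @ \oo --> f x}.
  apply: (@filterS _ _ (ae_filter_ringOfSetsType mu)) aec => x h Dx; have /cvg_ex[l cl] := h Dx.
  rewrite /f.
  have cl' : (fun n => (u (k n) x)%:E) @ \oo --> l%:E by apply/cvg_EFin => //; near=> n.
  by rewrite (cvg_limn_einf_sup cl').1.
have key e : 0 < e -> exists M, forall m, (M <= m)%N ->
    (\int[mu]_(x in D) ((u m x - f x) ^+ 2)%:E <= e%:E)%E.
  move=> e0; have [M MP] := hu e e0; exists M => m Mm.
  pose F n x := (((u m x - u (k n) x) ^+ 2)%:E : \bar R).
  have mF n : measurable_fun D (F n).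
    apply/measurable_EFinP; apply: measurable_funX; apply: measurable_funB.
      by have [] := su m.
    by have [] := su (k n).
  have F0 n x : D x -> (0 <= F n x)%E by move=> _; rewrite lee_fin sqr_ge0.
  apply: (@le_trans _ _ (\int[mu]_(x in D) limn_einf (F ^~ x))%E).
    apply: ae_ge0_le_integral => //.
    - by move=> x _; rewrite lee_fin sqr_ge0.
    - apply/measurable_EFinP; apply: measurable_funX; apply: measurable_funB => //.
      by have [] := su m.
    - move=> x Dx; rewrite limn_einf_lim; apply: lime_ge.
        exact: is_cvg_einfs.
      near=> n; apply: le_ereal_inf_tmp => _ [p /= _ <-]; exact: F0.
    - exact: measurable_limn_einf.
    - apply: (@filterS _ _ (ae_filter_ringOfSetsType mu)) fP => x h Dx; have {h} h := h Dx.
      have cF : F ^~ x @ \oo --> ((u m x - f x) ^+ 2)%:E.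
        apply/cvg_EFin => //; first (by near=> n); rewrite /F /=.
        have hB : (fun n => u m x - u (k n) x) @ \oo --> u m x - f x.
          by apply: cvgB => //; exact: cvg_cst.
        exact: (cvgM hB hB).
      by rewrite (cvg_limn_einf_sup cF).1.
  apply: (le_trans (fatou _ measurable_dom mF F0)).
  have FE n : (\int[mu]_(x in D) F n x = (nsq (fun x => u m x - u (k n) x))%:E)%E.
    by rewrite /F EFin_integ//; have [] := sqB (su m) (su (k n)).
  rewrite (_ : (fun n => _) = (fun n => (nsq (fun x => u m x - u (k n) x))%:E)); last first.
    by apply/funext.
  rewrite limn_einf_lim; apply: lime_le; first exact: is_cvg_einfs.
  near=> n; apply: (@le_trans _ _ (nsq (fun x => u m x - u (k n) x))%:E).
    by apply: ereal_inf_lbound; exists n => //=.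
  rewrite lee_fin MP// (leq_trans _ (kge n))//.
  by near: n; exact: nbhs_infty_ge.
have igm e m (e0 : 0 < e) : (\int[mu]_(x in D) ((u m x - f x) ^+ 2)%:E <= e%:E)%E ->
    sq (fun x => u m x - f x).
  move=> h; have mm : meas (fun x => u m x - f x).
    by apply: measurable_funB => //; have [] := su m.
  split => //; apply/integrableP; split.
    by apply/measurable_EFinP; exact: measurable_funX.
  rewrite (_ : integral _ _ _ = \int[mu]_(x in D) ((u m x - f x) ^+ 2)%:E)%E.
    by rewrite (le_lt_trans h)// ltry.
  by apply: eq_integral => x _ /=; rewrite ger0_norm// sqr_ge0.
have sf : sq f.
  have [M MP] := key 1 ltr01.
  have := sqB (su M) (igm _ _ ltr01 (MP M (leqnn M))).
  by apply: eq_sq => x _; rewrite subKr.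
exists f => //; apply/cvgrPdist_le => e e0.
have [M MP] := key e e0; near=> n.
have Mn : (M <= n)%N by near: n; exact: nbhs_infty_ge.
rewrite sub0r normrN ger0_norm ?nsq_ge0//.
rewrite -lee_fin -EFin_integ; first exact: MP.
by have [] := igm _ _ e0 (MP n Mn).
Unshelve. all: by end_near. Qed.

End Complete.

(** * Primitives *)

Section Primitive.
Context {R : realType}.
Local Notation mu := (@lebesgue_measure R).
Local Notation D := (@dom R : set (measurableTypeR R)).
Local Notation L := (len R).
Implicit Types (f g h : R -> R) (a b c x y t : R).

Lemma dom_within_continuousP (V : normedModType R) (v : R -> V) :
  {within dom (R:=R), continuous v} <->
  (forall x, dom x -> forall e, 0 < e -> exists2 d, 0 < d &
     forall y, dom y -> `|x - y| < d -> `|v x - v y| < e).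
Proof.
split=> [/subspace_continuousP cv x Dx e e0|h].
  have /cvgrPdist_lt/(_ e e0) := cv x Dx.
  rewrite near_withinE => -[d /= d0 H]; exists d => // y Dy xy.
  exact: H.
apply/subspace_continuousP => x Dx; apply/cvgrPdist_lt => e e0.
have [d d0 H] := h x Dx e e0.
by rewrite near_withinE; exists d => // y /= xy Dy; exact: H.
Qed.

(** Integrals over subintervals are written with weights over the whole of [0, L],
    so that one calculus of integrals serves for all of them. *)
Definition chi a b t : R := (a < t <= b)%R%:R.
Definition prim f x : R := integ (fun t => f t * chi 0 x t).

Lemma chiE a b : chi a b = \1_(`]a, b]).
Proof. by apply/funext => t; rewrite indicE mem_setE in_itv. Qed.

Lemma meas_chi a b : meas (chi a b).
Proof. by rewrite chiE; apply: measurable_indic. Qed.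

Lemma chi_ge0 a b t : 0 <= chi a b t.
Proof. by rewrite /chi; case: (_ < _ <= _). Qed.

Lemma chi_norm a b t : `|chi a b t| <= 1.
Proof. by rewrite /chi; case: (_ < _ <= _); rewrite ?normr1 ?normr0. Qed.

Lemma chi_sqr a b t : chi a b t ^+ 2 = chi a b t.
Proof. by rewrite /chi; case: (_ < _ <= _); rewrite ?expr1n ?expr0n. Qed.

Lemma sq_chi a b : sq (chi a b).
Proof.
by apply: (@sq_bnd _ _ 1) => [|x _]; [exact: meas_chi|exact: chi_norm].
Qed.

Lemma sq_mul_chi f a b : sq f -> sq (fun t => f t * chi a b t).
Proof. by move=> sf; apply: (sqMb sf (meas_chi a b)) => x _; exact: chi_norm. Qed.

Lemma ig_chi f a b : ig f -> ig (fun t => f t * chi a b t).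
Proof.
move=> igf; apply: (ig_le _ (ig_norm igf)).
  by apply: measurable_funM; [exact: ig_meas|exact: meas_chi].
by move=> x _; rewrite normrM ler_piMr// chi_norm.
Qed.

Lemma chi_chasles a b t : 0 <= a -> a <= b -> chi 0 b t = chi 0 a t + chi a b t.
Proof.
move=> a0 ab; rewrite /chi; have [at_|ta] := ltP a t.
  by rewrite (le_lt_trans a0 at_) andbF add0r.
have -> : t <= b by exact: le_trans ab.
by rewrite !andbT addr0.
Qed.

Lemma prim_at0 f : prim f 0 = 0.
Proof.
rewrite -[RHS]integ0; apply: eq_integ => t _.
by rewrite /chi lt_le_asym mulr0.
Qed.

Lemma prim_sub f a b : ig f -> 0 <= a -> a <= b ->
  prim f b - prim f a = integ (fun t => f t * chi a b t).
Proof.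
move=> igf a0 ab; rewrite /prim -integB; [|exact: ig_chi..].
by apply: eq_integ => t _; rewrite (chi_chasles t a0 ab); ring.
Qed.

Lemma eq_prim f g x : (forall t, dom t -> f t = g t) -> prim f x = prim g x.
Proof. by move=> fg; apply: eq_integ => t Dt; rewrite fg. Qed.

Lemma primD f g x : ig f -> ig g ->
  prim (fun t => f t + g t) x = prim f x + prim g x.
Proof.
move=> igf igg; rewrite /prim -integD; [|exact: ig_chi..].
by apply: eq_integ => t _; rewrite mulrDl.
Qed.

Lemma primB f g x : ig f -> ig g ->
  prim (fun t => f t - g t) x = prim f x - prim g x.
Proof.
move=> igf igg; rewrite /prim -integB; [|exact: ig_chi..].
by apply: eq_integ => t _; rewrite mulrBl.
Qed.

Lemma primZ a f x : ig f -> prim (fun t => a * f t) x = a * prim f x.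
Proof.
move=> igf; rewrite /prim -integZ; last exact: ig_chi.
by apply: eq_integ => t _; rewrite mulrA.
Qed.

Lemma primE f x : ig f -> dom x ->
  prim f x = \int[mu]_(t in `[0, x]) f t.
Proof.
move=> igf; rewrite domE => /andP[x0 xL].
have sub : `]0, x] `<=` D.
  move=> t /=; rewrite domE in_itv /= => /andP[/ltW -> tx].
  exact: le_trans xL.
have igf' : mu.-integrable `]0, x] (EFin \o f).
  exact: (integrableS measurable_dom _ sub).
rewrite -Rintegral_itv_obnd_cbnd// /prim.
rewrite -[in RHS](setIidl sub) Rintegral_mkcondl integE.
apply: eq_Rintegral => t _; rewrite chiE /= patchE indicE.
by case: ifPn => _; rewrite ?mulr1 ?mulr0.
Qed.

Lemma prim_len f : ig f -> prim f L = integ f.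
Proof. by move=> igf; rewrite primE ?integE//; exact: domL. Qed.

Lemma prim_cst c x : dom x -> prim (cst c) x = c * x.
Proof.
move=> Dx; rewrite (primE (ig_cst c) Dx); move: Dx; rewrite domE => /andP[x0 _].
rewrite Rintegral_cst//= lebesgue_measure_itv /= lte_fin.
case: ltP => [_|x0']; first by rewrite oppr0 addr0.
by have -> : x = 0 by apply/eqP; rewrite eq_le x0 x0'.
Qed.

Lemma integ_chi a b : 0 <= a -> a <= b -> b <= L -> integ (chi a b) = b - a.
Proof.
move=> a0 ab bL.
have -> : integ (chi a b) = integ (fun t => cst 1 t * chi a b t).
  by apply: eq_integ => t _; rewrite mul1r.
rewrite -prim_sub//; last exact: ig_cst.
by rewrite !prim_cst ?mul1r// domE ?a0 ?(le_trans ab bL) ?(le_trans a0 ab).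
Qed.

Lemma nsq_chi a b : 0 <= a -> a <= b -> b <= L -> nsq (chi a b) = b - a.
Proof.
move=> a0 ab bL; rewrite -integ_chi//.
by apply: eq_integ => t _; exact: chi_sqr.
Qed.

Lemma integ_chi_CS f a b : sq f -> 0 <= a -> a <= b -> b <= L ->
  integ (fun t => f t * chi a b t) ^+ 2 <= nsq f * (b - a).
Proof.
move=> sf a0 ab bL; rewrite -(nsq_chi a0 ab bL).
exact: (dotp_CS sf (sq_chi a b)).
Qed.

(** Cauchy-Schwarz on the interval between x and y. *)
Lemma prim_holder f x y : sq f -> dom x -> dom y ->
  (prim f x - prim f y) ^+ 2 <= nsq f * `|x - y|.
Proof.
move=> sf; wlog xy : x y / y <= x.
  move=> H Dx Dy; have [/H|/ltW xy] := leP y x; first exact.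
  by rewrite distrC -sqrrN opprB; exact: H.
rewrite !domE => /andP[x0 xL] /andP[y0 yL].
rewrite prim_sub ?(sq_ig sf)// ger0_norm ?subr_ge0//.
exact: integ_chi_CS.
Qed.

Lemma holder_continuous f (C : R) :
  (forall x y, dom x -> dom y -> (f x - f y) ^+ 2 <= C * `|x - y|) ->
  {within dom (R:=R), continuous f}.
Proof.
move=> H; apply/dom_within_continuousP => x Dx e e0.
exists (e ^+ 2 / (`|C| + 1)).
  by rewrite divr_gt0 ?exprn_gt0// ltr_wpDl.
move=> y Dy; rewrite ltr_pdivlMr ?ltr_wpDl// => xy.
rewrite -(ltr_pXn2r (n := 2)) ?nnegrE ?normr_ge0 ?(ltW e0)//.
rewrite real_normK ?num_real//; apply: le_lt_trans xy.
apply: (le_trans (H x y Dx Dy)); rewrite mulrC ler_wpM2l//.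
by rewrite (le_trans (ler_norm C))// lerDl.
Qed.

Lemma prim_continuous f : sq f -> {within dom (R:=R), continuous (prim f)}.
Proof.
by move=> sf; apply: (@holder_continuous _ (nsq f)) => x y; exact: prim_holder.
Qed.

Lemma continuous_bounded f : {within dom (R:=R), continuous f} ->
  exists2 M, 0 < M & forall x, dom x -> `|f x| <= M.
Proof.
move=> cf.
have := continuous_compact cf (@segment_compact R 0 L).
move=> /compact_bounded [M [_ HM]]; exists (`|M| + 1); first by rewrite ltr_wpDl.
move=> x Dx; apply: (HM (`|M| + 1)); first by rewrite ltr_pwDr// ler_norm.
by exists x.
Qed.

Lemma continuous_meas f : {within dom (R:=R), continuous f} -> meas f.
Proof.
by move=> cf; apply: subspace_continuous_measurable_fun => //; exact: measurable_itv.
Qed.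

Lemma continuous_sq f : {within dom (R:=R), continuous f} -> sq f.
Proof.
move=> cf; have [M _ HM] := continuous_bounded cf.
exact: (sq_bnd (continuous_meas cf) HM).
Qed.

Lemma prim_FTC F f : {within dom (R:=R), continuous f} ->
  {within dom (R:=R), continuous F} ->
  (forall x, 0 < x < L -> is_derive x 1 F (f x)) ->
  forall x, dom x -> F x = F 0 + prim f x.
Proof.
move=> cf cF dF x Dx; have igf : ig f by apply: sq_ig; exact: continuous_sq.
rewrite primE//; move: Dx; rewrite domE => /andP[x0 xL].
move: x0; rewrite le_eqVlt => /orP[/eqP <-|x0].
  by rewrite set_itv1 Rintegral_set1 addr0.
have sub : `[0, x] `<=` dom (R:=R).
  move=> t /=; rewrite domE in_itv /= => /andP[-> tx]; exact: le_trans xL.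
have := @continuous_FTC2 R f F 0 x x0 (continuous_subspaceW sub cf).
have cF' := continuous_subspaceW sub cF.
have /(continuous_within_itvP _ x0) [_ F0 Fx] := cF'.
have P : derivable_oo_LRcontinuous F 0 x.
  split => // y; rewrite in_itv /= => /andP[y0 yx].
  by have [] := dF y; rewrite ?y0 ?(lt_le_trans yx).
move=> /(_ P) H; rewrite /Rintegral H ?fineB//=; first by rewrite addrC subrK.
move=> y; rewrite in_itv /= => /andP[y0 yx].
have Fy := dF y; rewrite derive1E; apply: derive_val.
by apply: Fy; rewrite y0 (lt_le_trans yx).
Qed.

End Primitive.

(** * Weak derivatives and the du Bois-Reymond lemma *)

Section WeakDerivative.
Context {R : realType}.
Local Notation mu := (@lebesgue_measure R).
Local Notation D := (@dom R : set (measurableTypeR R)).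
Local Notation L := (len R).
Implicit Types (f g h phi : R -> R) (a b c x y t : R).

(** By Lebesgue differentiation f is, almost everywhere, the derivative of its
    primitive. *)
Lemma nsq_prim_eq0 f : sq f -> (forall x, dom x -> prim f x = 0) -> nsq f = 0.
Proof.
move=> sf f0; have igf := sq_ig sf.
pose fD : R -> R := f \_ (dom (R:=R)).
have igT : mu.-integrable setT (EFin \o fD).
  by rewrite /fD -restrict_EFin; apply/integrable_restrict => //; rewrite setTI.
have igy y : mu.-integrable [set` Interval (BLeft 0) (BRight y)] (EFin \o fD).
  apply: (integrableS _ _ _ igT) => //; exact: measurable_itv.
have := @FTC1 R fD (BLeft 0) igy.
have lfD : locally_integrable [set: R] fD.
  exact: (integrable_locally measurable_dom igf).
move=> /(_ lfD) ae1.
have ae2 : {ae mu, forall x, `]0, L[%classic x -> f x = 0}.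
  apply: (@filterS _ _ (ae_filter_ringOfSetsType mu)) ae1 => x H.
  rewrite /= in_itv /= => /andP[x0 xL].
  have Dx : dom x by rewrite domE !ltW.
  case: H => [|_]; first by rewrite /= lte_fin.
  rewrite {2}/fD patchE mem_set// => <-.
  rewrite (_ : derive1 _ x = derive1 (cst (0 : R)) x); first exact: derive1_cst.
  rewrite !derive1E; apply: near_eq_derive.
  have : x \in `]0, L[ by rewrite in_itv /= x0.
  move=> /near_in_itvoo; apply: filterS => z; rewrite in_itv /= => /andP[z0 zL].
  have Dz : dom z by rewrite domE !ltW.
  rewrite /= -[RHS](f0 z Dz) primE//; apply: eq_Rintegral => t.
  rewrite inE /= in_itv /= => /andP[t0 tz]; rewrite /fD patchE mem_set//.
  by rewrite domE t0 (le_trans tz)// ltW.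
have [_ f2] := sf.
have sub : `]0, L[ `<=` dom (R:=R).
  by move=> t /=; rewrite domE in_itv /= => /andP[/ltW -> /ltW].
have f2' : mu.-integrable `]0, L[ (EFin \o (fun x => f x ^+ 2)).
  exact: (integrableS measurable_dom _ sub).
have f2'' : mu.-integrable `[0, L[ (EFin \o (fun x => f x ^+ 2)).
  apply: (integrableS measurable_dom) f2 => // t /=.
  by rewrite domE in_itv /= => /andP[-> /ltW].
rewrite /nsq integE /dom -Rintegral_itv_bndo_bndc// -Rintegral_itv_obnd_cbnd//.
rewrite /Rintegral (ae_eq_integral (cst 0%E))//=; first by rewrite integral0.
  exact: (measurable_int mu f2').
apply: (@filterS _ _ (ae_filter_ringOfSetsType mu)) ae2 => x H Dx.
by rewrite /= H// expr0n.
Qed.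

(** The bound is on the square because the errors to which it applies come from
    Cauchy-Schwarz. *)
Lemma is_derive_of_error (F : R -> R) x e0 C r : 0 < r ->
  (forall k, `|k| < r -> (F (x + k) - F x - k * e0) ^+ 2 <= C * `|k| ^+ 3) ->
  is_derive x 1 F e0.
Proof.
move=> r0 H; suff cF : (fun k => k^-1 *: (F (k *: (1:R) + x) - F x)) @ 0^' --> e0.
  by apply: DeriveDef; [apply/cvg_ex; exists e0|exact/cvg_lim].
apply/cvgrPdist_le => e ep; near=> k.
have k0 : k != 0 by near: k; exact: nbhs_dnbhs_neq.
have kr : `|k| < r by near: k; exact: dnbhs0_lt.
have C1 : 0 < `|C| + 1 by rewrite ltr_wpDl.
have ke : `|k| <= e ^+ 2 / (`|C| + 1).
  by near: k; apply: dnbhs0_le; rewrite divr_gt0// exprn_gt0.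
rewrite /= [k *: 1]mulr1 (addrC k) distrC.
have -> : k^-1 *: (F (x + k) - F x) - e0 = k^-1 * (F (x + k) - F x - k * e0).
  by rewrite mulrBr mulKf.
rewrite normrM normfV ler_pdivrMl ?normr_gt0//.
rewrite -(ler_pXn2r (n := 2))// ?nnegrE ?mulr_ge0 ?(ltW ep)//.
rewrite [leLHS]real_normK ?num_real// (le_trans (H k kr))//.
have Ck : C * `|k| <= e ^+ 2.
  move: ke; rewrite ler_pdivlMr// => ke.
  by have := ler_norm C; have := normr_ge0 k; nra.
rewrite (_ : C * `|k| ^+ 3 = C * `|k| * `|k| ^+ 2); last by ring.
by rewrite exprMn [leRHS]mulrC ler_wpM2r ?sqr_ge0.
Unshelve. all: by end_near. Qed.

Lemma is_derive_quadratic (F : R -> R) x d C :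
  (forall k, `|F (x + k) - F x - k * d| <= C * k ^+ 2) -> is_derive x 1 F d.
Proof.
move=> H; apply: (@is_derive_of_error _ _ _ (C ^+ 2) 1) => // k k1.
have h := H k; have C0 : 0 <= C * k ^+ 2 := le_trans (normr_ge0 _) h.
rewrite -(real_normK (num_real (_ - _ - _))).
apply: (@le_trans _ _ ((C * k ^+ 2) ^+ 2)); first by rewrite lerXn2r ?nnegrE.
rewrite exprMn ler_wpM2l ?sqr_ge0// -(real_normK (num_real k)).
have := normr_ge0 k; move: k1; move: `|k| => r r1 r0.
by rewrite -exprM (_ : (2 * 2 = 3 + 1)%N)// exprD expr1 ler_piMr ?exprn_ge0// ltW.
Qed.

(** Halved squares of ramps are C^1, with the ramps as derivatives; they are the
    building blocks of explicit test functions. *)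
Definition ramp p x : R := Num.max 0 (x - p).

Lemma ramp_sqr_error p x k :
  `|ramp p (x + k) ^+ 2 - ramp p x ^+ 2 - k * (2 * ramp p x)| <= k ^+ 2.
Proof.
rewrite /ramp ler_norml; have [h1|h1] := leP 0 (x + k - p); have [h2|h2] := leP 0 (x - p).
all: apply/andP; split; nra.
Qed.

Lemma ramp_continuous p : continuous (ramp p).
Proof.
have -> : ramp p = (fun x => ((x - p) + `|x - p|) / 2).
  apply/funext => x; rewrite /ramp.
  by have [h|h] := leP 0 (x - p); [rewrite ger0_norm//; field|
     rewrite ltr0_norm// subrr mul0r].
move=> x; apply: cvgM; last exact: cvg_cst.
have h : (fun y => y - p) @ x --> x - p by apply: cvgB; [exact: cvg_id|exact: cvg_cst].
by apply: cvgD => //; exact: cvg_norm.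
Qed.

(** A list of pairs (knot, coefficient) encodes a combination of ramps. *)
Definition ramps (s : seq (R * R)) x : R := \sum_(q <- s) q.2 * ramp q.1 x.
Definition sqramps (s : seq (R * R)) x : R :=
  \sum_(q <- s) q.2 * (ramp q.1 x ^+ 2 / 2).

Lemma sqramps_derive s x : is_derive x 1 (sqramps s) (ramps s x).
Proof.
apply: (@is_derive_quadratic _ _ _ (\sum_(q <- s) `|q.2|)) => k.
rewrite /sqramps /ramps mulr_sumr -!sumrB mulr_suml.
apply: (le_trans (ler_norm_sum _ _ _)); apply: ler_sum => q _.
have -> : q.2 * (ramp q.1 (x + k) ^+ 2 / 2) - q.2 * (ramp q.1 x ^+ 2 / 2) -
    k * (q.2 * ramp q.1 x) =
  q.2 * ((ramp q.1 (x + k) ^+ 2 - ramp q.1 x ^+ 2 - k * (2 * ramp q.1 x)) / 2).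
  by field.
rewrite normrM ler_wpM2l// normrM (le_trans _ (ramp_sqr_error q.1 x k))//.
by rewrite ler_piMr// ger0_norm// invf_le1// ler1n.
Qed.

Lemma ramps_continuous s : continuous (ramps s).
Proof.
rewrite /ramps; elim: s => [|q s IH].
  under eq_fun do rewrite big_nil; exact: cst_continuous.
under eq_fun do rewrite big_cons.
move=> x; apply: cvgD; last exact: IH.
by apply: cvgM; [exact: cvg_cst|exact: ramp_continuous].
Qed.

(** Beyond the last knot the sum is a quadratic polynomial, whose coefficients are
    the moments assumed to vanish. *)
Lemma sqramps_test s a b : 0 < a -> b < L ->
  (forall q, q \in s -> a <= q.1 <= b) ->
  \sum_(q <- s) q.2 = 0 -> \sum_(q <- s) q.2 * q.1 = 0 ->
  \sum_(q <- s) q.2 * q.1 ^+ 2 = 0 ->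
  test_function (sqramps s).
Proof.
move=> a0 bL sab s0 s1 s2; split.
- by move=> x; have [] := sqramps_derive s x.
- rewrite (_ : derive1 _ = ramps s); first exact: ramps_continuous.
  apply/funext => x; rewrite derive1E; exact: (@derive_val _ _ _ _ _ _ _ (sqramps_derive s x)).
- exists a, b; split => // x; rewrite in_itv /= negb_and -!ltNge => /orP[xa|bx].
    rewrite /sqramps big_seq big1// => q /sab /andP[aq _].
    by rewrite /ramp max_l ?expr0n ?mul0r ?mulr0// subr_le0 ltW// (lt_le_trans xa).
  transitivity (\sum_(q <- s) ((x ^+ 2 / 2) * q.2 - x * (q.2 * q.1) +
      2^-1 * (q.2 * q.1 ^+ 2))).
    rewrite /sqramps big_seq [RHS]big_seq; apply: eq_bigr => q /sab /andP[_ qb].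
    rewrite /ramp max_r; first by field.
    by rewrite subr_ge0 (le_trans qb)// ltW.
  by rewrite big_split sumrB /= -!mulr_sumr s0 s1 s2; ring.
Qed.

(** The difference quotient of ramps rises from 0 to 1 across [p, p + e]; it
    differs from the step at p only there, by at most 1, and the integral of f
    beyond p is [prim f L - prim f p]. *)
Lemma ramp_step_error f p e : sq f -> 0 < e -> 0 <= p -> p + e <= L ->
  `|integ (fun x => f x * (e^-1 * ramp p x + - e^-1 * ramp (p + e) x))
    - (prim f L - prim f p)| <= Num.sqrt (nsq f * e).
Proof.
move=> sf e0 p0 pL; have pe : p <= p + e by rewrite lerDl ltW.
have pL' : p <= L by exact: le_trans pL.
pose r x := e^-1 * ramp p x + - e^-1 * ramp (p + e) x.
have cr : continuous r.
  by move=> x; apply: cvgD; apply: cvgM; try exact: cvg_cst; exact: ramp_continuous.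
have sr : sq r by apply: continuous_sq; exact: continuous_subspaceT.
pose d x := r x - chi p L x.
have sd : sq d by apply: sqB => //; exact: sq_chi.
have dE : integ (fun x => f x * r x) - (prim f L - prim f p) = dotp f d.
  rewrite prim_sub ?(sq_ig sf)// -integB; last 2 first.
  - exact: sq_mul.
  - by apply: sq_mul => //; exact: sq_chi.
  by apply: eq_integ => x _; rewrite /d mulrBr.
have d1 x : dom x -> d x ^+ 2 <= chi p (p + e) x.
  rewrite domE => /andP[x0 xL]; rewrite /d /r /ramp /chi xL andbT.
  have [xp|xp] := leP x p.
    rewrite !max_l ?subr_le0//; last exact: le_trans pe.
    by rewrite !mulr0 addr0 subrr expr0n.
  rewrite (max_r (_ : 0 <= x - p)) ?subr_ge0 ?(ltW xp)//.
  have [xe|xe] := leP x (p + e).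
    rewrite max_l ?subr_le0// mulr0 addr0.
    have h1 : 0 <= e^-1 * (x - p) <= 1.
      rewrite mulr_ge0 ?invr_ge0 ?(ltW e0) ?subr_ge0 ?(ltW xp)//=.
      by rewrite ler_pdivrMl// mulr1 lerBlDl.
    by move: h1 => /andP[h1 h2] /=; nra.
  rewrite max_r ?subr_ge0 ?(ltW xe)//.
  have -> : e^-1 * (x - p) + - e^-1 * (x - (p + e)) = 1.
    by field; rewrite gt_eqF.
  by rewrite subrr expr0n.
have nd : nsq d <= e.
  rewrite -[leRHS](_ : p + e - p = e); last by ring.
  rewrite -integ_chi//; apply: integ_le => //; first by case: sd.
  by apply: sq_ig; exact: sq_chi.
rewrite dE -[leLHS]ger0_norm// -sqrtr_sqr.
have n0 : 0 <= nsq f * e by rewrite mulr_ge0 ?nsq_ge0 ?ltW.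
rewrite ler_sqrt// real_normK ?num_real// (le_trans (dotp_CS sf sd))//.
by rewrite ler_wpM2l// nsq_ge0.
Qed.

(** The combination of the steps at p, q1 and q2 with these coefficients is a limit
    of derivatives of test functions, because the coefficients have vanishing sum
    and first moment; the equality says that [prim f] is affine. *)
Lemma prim_affine_of_weak0 f p q1 q2 : sq f ->
  (forall phi, test_function phi -> integ (fun x => f x * derive1 phi x) = 0) ->
  0 < p < L -> 0 < q1 < L -> 0 < q2 < L ->
  (q2 - q1) * prim f p + (p - q2) * prim f q1 + (q1 - p) * prim f q2 = 0.
Proof.
move=> sf H /andP[p0 pL] /andP[q10 q1L] /andP[q20 q2L].
pose a := Num.min p (Num.min q1 q2).
pose b := Num.max p (Num.max q1 q2).
have a0 : 0 < a by rewrite /a !lt_min p0 q10 q20.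
have bL : b < L by rewrite /b !gt_max pL q1L q2L.
have ap : [/\ a <= p, a <= q1 & a <= q2] by rewrite /a !ge_min !lexx !orbT.
have bp : [/\ p <= b, q1 <= b & q2 <= b] by rewrite /b !le_max !lexx !orbT.
pose A := Num.sqrt (nsq f).
pose K := `|q2 - q1| + `|p - q2| + `|q1 - p|.
suff key e : 0 < e -> b + e < L ->
    `|(q2 - q1) * prim f p + (p - q2) * prim f q1 + (q1 - p) * prim f q2|
       <= K * (A * Num.sqrt e).
  apply/eqP; rewrite -normr_le0; apply/ler_addgt0Pl => e e0; rewrite addr0.
  pose t := Num.min ((L - b) / 2) ((e / (K * A + 1)) ^+ 2).
  have K0 : 0 <= K by rewrite /K !addr_ge0.
  have KA : 0 <= K * A by rewrite mulr_ge0// sqrtr_ge0.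
  have KA1 : 0 < K * A + 1 by rewrite ltr_wpDl.
  have t0 : 0 < t.
    by rewrite /t lt_min divr_gt0 ?subr_gt0//= exprn_gt0// divr_gt0.
  have tb : b + t < L.
    rewrite -ltrBrDl (@le_lt_trans _ _ ((L - b) / 2))//.
      by rewrite /t ge_min lexx.
    by rewrite ltr_pdivrMr// ltr_pMr ?subr_gt0// ltr1n.
  apply: (le_trans (key t t0 tb)); rewrite mulrA.
  have : Num.sqrt t <= e / (K * A + 1).
    rewrite -[leRHS]ger0_norm ?divr_ge0 ?(ltW e0) ?(ltW KA1)// -sqrtr_sqr.
    by rewrite ler_sqrt ?sqr_ge0// /t ge_min lexx orbT.
  move=> /(ler_wpM2l KA)/le_trans; apply.
  by rewrite mulrA ler_pdivrMr// mulrC ler_pM2l// lerDl.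
move=> e0 be.
have [p1 p2 p3] := ap; have [b1 b2 b3] := bp.
have pe x : x <= b -> x + e <= L by move=> xb; rewrite ltW// (le_lt_trans _ be)// lerD2r.
(* each step is replaced by a ramp of width e, as a difference of two ramps *)
pose s := [:: (p, (q2 - q1) / e); (p + e, - ((q2 - q1) / e));
              (q1, (p - q2) / e); (q1 + e, - ((p - q2) / e));
              (q2, (q1 - p) / e); (q2 + e, - ((q1 - p) / e))].
have ts : test_function (sqramps s).
  apply: (@sqramps_test s a (b + e)) => //.
  - move=> q; rewrite !inE.
    have bb : b <= b + e by rewrite lerDl ltW.
    have ee x : x <= b -> x + e <= b + e by rewrite lerD2r.
    have xe x : a <= x -> a <= x + e by move=> h; rewrite (le_trans h)// lerDl ltW.
    by move=> /or4P[/eqP->|/eqP->|/eqP->|/or3P[/eqP->|/eqP->|/eqP->]] /=;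
       apply/andP; split; auto; apply: le_trans bb; auto.
  - by rewrite /s !big_cons big_nil /=; ring.
  - by rewrite /s !big_cons big_nil /=; field; rewrite gt_eqF.
  - by rewrite /s !big_cons big_nil /=; field; rewrite gt_eqF.
have := H _ ts.
have -> : derive1 (sqramps s) = ramps s.
  apply/funext => x; rewrite derive1E.
  exact: (@derive_val _ _ _ _ _ _ _ (sqramps_derive s x)).
pose I x := integ (fun t => f t * (e^-1 * ramp x t + - e^-1 * ramp (x + e) t)).
have ig1 x : ig (fun t => f t * (e^-1 * ramp x t + - e^-1 * ramp (x + e) t)).
  apply: sq_mul => //; apply: continuous_sq; apply: continuous_subspaceT => y.
  by apply: cvgD; apply: cvgM; try exact: cvg_cst; exact: ramp_continuous.
have -> : integ (fun x => f x * ramps s x) =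
    (q2 - q1) * I p + (p - q2) * I q1 + (q1 - p) * I q2.
  rewrite /I -!integZ// -integD; [|exact: igZ..].
  rewrite -integD; [|by apply: igD; exact: igZ|exact: igZ].
  apply: eq_integ => x _; rewrite /ramps /s !big_cons big_nil /=; ring.
move=> I0; pose T := prim f L.
have E x : x \in [:: p; q1; q2] -> `|I x - (T - prim f x)| <= A * Num.sqrt e.
  have sq0 x0 : 0 <= x0 -> x0 <= b -> `|I x0 - (T - prim f x0)| <= A * Num.sqrt e.
    by move=> x00 xb; rewrite /A -sqrtrM ?nsq_ge0//; apply: ramp_step_error => //; exact: pe.
  by rewrite !inE => /or3P[/eqP->|/eqP->|/eqP->]; apply: sq0 => //; rewrite ltW.
have -> : (q2 - q1) * prim f p + (p - q2) * prim f q1 + (q1 - p) * prim f q2 =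
   (q2 - q1) * (I p - (T - prim f p)) + (p - q2) * (I q1 - (T - prim f q1))
   + (q1 - p) * (I q2 - (T - prim f q2)).
  apply/eqP; rewrite -subr_eq0 -oppr_eq0; apply/eqP; rewrite -[RHS]I0; ring.
rewrite /K [leRHS]mulrDl; apply: (le_trans (ler_normD _ _)); apply: lerD; last first.
  by rewrite normrM ler_wpM2l// E// !inE eqxx !orbT.
rewrite [leRHS]mulrDl; apply: (le_trans (ler_normD _ _)); apply: lerD.
  by rewrite normrM ler_wpM2l// E// !inE eqxx ?orbT.
by rewrite normrM ler_wpM2l// E// !inE eqxx ?orbT.
Qed.

(** An affine function that vanishes at 0 is linear; the end points are reached by
    continuity. *)
Lemma prim_linear_of_weak0 f : sq f ->
  (forall phi, test_function phi -> integ (fun x => f x * derive1 phi x) = 0) ->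
  exists c, forall x, dom x -> prim f x = c * x.
Proof.
move=> sf H; have Lg := @len_gt0 R.
pose q1 := L / 3; pose q2 := L * 2 / 3.
have q1L : 0 < q1 < L by rewrite /q1; apply/andP; split; lra.
have q2L : 0 < q2 < L by rewrite /q2; apply/andP; split; lra.
pose B := (prim f q2 - prim f q1) / q1.
pose A := 2 * prim f q1 - prim f q2.
have aff x : 0 < x < L -> prim f x = A + B * x.
  move=> x0L; have := prim_affine_of_weak0 sf H x0L q1L q2L.
  rewrite (_ : q2 - q1 = q1); last by rewrite /q2 /q1; field.
  have q1n : q1 != 0 by move: q1L => /andP[/gt_eqF ->].
  rewrite (_ : q2 = 2 * q1); last by rewrite /q2 /q1; field.
  move=> h; apply: (mulfI q1n); rewrite /B /A; apply/eqP; rewrite -subr_eq0.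
  by apply/eqP; rewrite -[RHS]h (_ : q2 = 2 * q1); [field|rewrite /q2 /q1; field].
have lip : {within dom (R:=R), continuous (fun x => prim f x - (A + B * x))}.
  move=> x; apply: cvgB; first exact: prim_continuous.
  apply: (@continuous_subspaceT _ _ _ (fun x : R => A + B * x)) => y.
  apply: cvgD; first exact: cvg_cst.
  by apply: cvgM; [exact: cvg_cst|exact: cvg_id].
have ext x : dom x -> prim f x = A + B * x.
  move=> Dx; apply/eqP; rewrite -subr_eq0 -normr_le0; apply/ler_addgt0Pl => e e0.
  rewrite addr0.
  have /dom_within_continuousP/(_ x Dx e e0)[d d0 hd] := lip.
  have [y [yL xy]] : exists y, 0 < y < L /\ `|x - y| < d.
    have [xh|xh] := leP x q1.
      pose t := Num.min (d / 2) q1; have t0 : 0 < t.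
        by rewrite /t lt_min divr_gt0//=; move: q1L => /andP[].
      have td : t < d.
        rewrite (@le_lt_trans _ _ (d / 2))//; first by rewrite /t ge_min lexx.
        lra.
      exists (x + t); split; last by rewrite opprD addNKr normrN gtr0_norm.
      have tq : t <= q1 by rewrite /t ge_min lexx orbT.
      move: Dx xh tq; rewrite domE /q1 => /andP[x0 _] ? ?.
      by apply/andP; split; lra.
    pose t := Num.min (d / 2) (q1 / 2); have t0 : 0 < t.
      by rewrite /t lt_min !divr_gt0//=; move: q1L => /andP[].
    have td : t < d.
      rewrite (@le_lt_trans _ _ (d / 2))//; first by rewrite /t ge_min lexx.
      lra.
    exists (x - t); split; last by rewrite opprB addrC subrK gtr0_norm.
    have tq : t <= q1 / 2 by rewrite /t ge_min lexx orbT.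
    move: Dx xh tq; rewrite domE => /andP[x0 xL]; move: q1L => /andP[q10 _] ? ?.
    by apply/andP; split; lra.
  have Dy : dom y by move: yL => /andP[y0 y1]; rewrite domE !ltW.
  by have := hd y Dy xy; rewrite (aff y yL) subrr subr0 => /ltW.
have A0 : A = 0 by have := ext 0 (@dom0 R); rewrite prim_at0 mulr0 addr0.
by exists B => x Dx; rewrite ext// A0 add0r.
Qed.

(** The du Bois-Reymond lemma: f has a linear primitive. *)
Lemma weak0_constant f : sq f ->
  (forall phi, test_function phi -> integ (fun x => f x * derive1 phi x) = 0) ->
  exists c, nsq (fun x => f x - c) = 0.
Proof.
move=> sf H; have [c cP] := prim_linear_of_weak0 sf H; exists c.
have sc := sq_cst c.
apply: nsq_prim_eq0; first exact: (sqB sf sc).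
move=> x Dx; rewrite (primB x (sq_ig sf) (sq_ig sc)).
by rewrite -[prim (fun=> c) x]/(prim (cst c) x) prim_cst// cP// subrr.
Qed.

Lemma test_function_FTC phi : test_function phi ->
  [/\ {within dom (R:=R), continuous (derive1 phi)},
      {within dom (R:=R), continuous phi}, phi 0 = 0, phi L = 0 &
      forall x, dom x -> phi x = prim (derive1 phi) x].
Proof.
move=> [dphi cdphi [a [b [a0 bL out]]]].
have c1 : {within dom (R:=R), continuous (derive1 phi)} by exact: continuous_subspaceT.
have c0 : {within dom (R:=R), continuous phi}.
  apply: continuous_subspaceT => x; apply: differentiable_continuous.
  exact/derivable1_diffP.
have p0 : phi 0 = 0 by rewrite out// in_itv /= negb_and -ltNge a0.
have pL : phi L = 0 by rewrite out// in_itv /= negb_and orbC -ltNge bL.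
split => // x Dx; rewrite -[LHS]subr0 -p0; apply/eqP; rewrite subr_eq addrC.
apply/eqP; apply: prim_FTC => // y _; rewrite derive1E; exact: DeriveDef.
Qed.

Lemma prim_is_derive g x : {within dom (R:=R), continuous g} -> 0 < x < L ->
  is_derive x 1 (prim g) (g x).
Proof.
move=> cg /andP[x0 xL]; have igg : ig g by apply: sq_ig; exact: continuous_sq.
have /(continuous_within_itvP _ len_gt0) [cgi _ _] := cg.
have cgx : {for x, continuous g} by apply: cgi; rewrite in_itv /= x0.
have igL : mu.-integrable `[0, L] (EFin \o g) by [].
have := continuous_FTC1_closed xL igL x0 cgx.
set F := (fun _ => _) => -[dF F'].
have near_eq : {near x, F =1 prim g}.
  have : x \in `]0, L[ by rewrite in_itv /= x0.
  move=> /near_in_itvoo; apply: filterS => y; rewrite in_itv /= => /andP[y0 yL].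
  by rewrite primE// domE !ltW.
apply: (near_eq_is_derive near_eq).
by rewrite -F' derive1E; exact: DeriveDef.
Qed.

(** For continuous g both factors are differentiable and the classical formula
    applies. *)
Lemma prim_by_parts_continuous g phi : continuous g -> test_function phi ->
  integ (fun x => prim g x * derive1 phi x) = - integ (fun x => g x * phi x).
Proof.
move=> cg tphi; have [c1 c0 p0 pL _] := test_function_FTC tphi.
have [dphi _ _] := tphi.
have sg : sq g by apply: continuous_sq; exact: continuous_subspaceT.
have igg := sq_ig sg.
have cgD : {within dom (R:=R), continuous g} by exact: continuous_subspaceT.
have cp := prim_continuous sg.
have /(continuous_within_itvP _ len_gt0) [_ pr0 prL] := cp.
have /(continuous_within_itvP _ len_gt0) [_ ph0 phL] := c0.
have dprim x : 0 < x < L -> is_derive x 1 (prim g) (g x) by exact: prim_is_derive.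
have oo1 : derivable_oo_LRcontinuous (prim g) 0 L.
  by split=> // x; rewrite in_itv /= => /dprim[].
have d1 : {in `]0, L[, derive1 (prim g) =1 g}.
  by move=> x; rewrite in_itv /= => /dprim xd; rewrite derive1E; exact: derive_val.
have oo2 : derivable_oo_LRcontinuous phi 0 L by split.
have d2 : {in `]0, L[, derive1 phi =1 derive1 phi} by [].
rewrite !integE; have := Rintegration_by_parts (@len_gt0 R) cgD oo1 d1 c1 oo2 d2.
by rewrite p0 pL !mulr0 subrr sub0r.
Qed.

Lemma prim_le_integ_norm f x : ig f -> `|prim f x| <= integ (fun t => `|f t|).
Proof.
move=> igf; apply: (le_trans (integ_norm (ig_chi 0 x igf))).
apply: integ_le; [by apply: ig_norm; exact: ig_chi|exact: ig_norm|].
by move=> t _; rewrite normrM ler_piMr// chi_norm.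
Qed.

(** Continuous functions are dense in L^1, and both sides of the formula for
    continuous g are continuous for the L^1 norm. *)
Lemma prim_weak_derivative g : sq g -> weak_derivative1 (prim g) g.
Proof.
move=> sg phi tphi; rewrite -!integE.
have [c1 c0 p0 pL _] := test_function_FTC tphi.
have igg := sq_ig sg.
have muD : (mu (dom (R:=R)) < +oo)%E.
  by apply: (@le_lt_trans _ _ L%:E); [rewrite -mu_dom|rewrite ltry].
have [g_ [cg_ igg_ cvg_g]] := approximation_continuous_integrable measurable_dom muD igg.
have [M1 M1pos H1] := continuous_bounded c1.
have [M0 M0pos H0] := continuous_bounded c0.
have sphi := continuous_sq c0; have sphi1 := continuous_sq c1.
have spg := continuous_sq (prim_continuous sg).
apply/eqP; rewrite -subr_eq0 -normr_le0; apply/ler_addgt0Pl => e e0; rewrite addr0.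
pose C := L * M1 + M0.
have Cpos : 0 < C by exact: (addr_gt0 (mulr_gt0 (@len_gt0 R) M1pos) M0pos).
have [n Hn] : exists n, integ (fun x => `|g x - g_ n x|) <= e / C.
  have eC : 0 < e / C by rewrite divr_gt0.
  have /fine_cvgP[_ /cvgrPdist_le/(_ _ eC)[n _ Hn]] := cvg_g; exists n.
  have := Hn n (leqnn n); rewrite sub0r normrN /= => H.
  by apply: le_trans H; rewrite integE; exact: ler_norm.
have sg_ : sq (g_ n) by apply: continuous_sq; exact: continuous_subspaceT.
have spg_ := continuous_sq (prim_continuous sg_).
have ibp := prim_by_parts_continuous (cg_ n) tphi.
pose d x := g x - g_ n x.
have sd : sq d by exact: sqB.
have sndx : sq (fun x => `|d x|).
  split; first by apply: measurableT_comp => //; case: sd.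
  by have [_] := sd; apply: eq_ig => x _; rewrite real_normK// num_real.
have -> : integ (fun x => prim g x * derive1 phi x) - - integ (fun x => g x * phi x) =
   integ (fun x => prim d x * derive1 phi x) + integ (fun x => d x * phi x).
  rewrite opprK; have -> : integ (fun x => prim d x * derive1 phi x) =
      integ (fun x => prim g x * derive1 phi x) - integ (fun x => prim (g_ n) x * derive1 phi x).
    rewrite -integB; [|exact: sq_mul..].
    apply: eq_integ => x _; rewrite primB//; first by rewrite mulrBl.
    exact: sq_ig.
  have -> : integ (fun x => d x * phi x) =
      integ (fun x => g x * phi x) - integ (fun x => g_ n x * phi x).
    rewrite -integB; [|exact: sq_mul..].
    by apply: eq_integ => x _; rewrite mulrBl.
  by rewrite ibp; ring.
pose N := integ (fun t => `|d t|).
have igd := sq_ig sd.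
have i1 : `|integ (fun x => prim d x * derive1 phi x)| <= N * (L * M1).
  have spd := continuous_sq (prim_continuous sd).
  apply: (le_trans (integ_norm (sq_mul spd sphi1))).
  rewrite mulrCA mulrC -integ_cst; apply: integ_le.
  - by apply: ig_norm; exact: sq_mul.
  - exact: ig_cst.
  - move=> x Dx; rewrite normrM; apply: ler_pM => //; last exact: H1.
    exact: prim_le_integ_norm.
have i2 : `|integ (fun x => d x * phi x)| <= N * M0.
  apply: (le_trans (integ_norm (sq_mul sd sphi))).
  rewrite /N mulrC -integZ; last exact: ig_norm.
  apply: integ_le; [by apply: ig_norm; exact: sq_mul|exact/igZ/ig_norm|].
  by move=> x Dx; rewrite normrM mulrC ler_wpM2r// H0.
apply: (le_trans (ler_normD _ _)); apply: (le_trans (lerD i1 i2)).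
by rewrite -mulrDr -ler_pdivlMr.
Qed.

End WeakDerivative.

(** * Functions in H^1 are primitives *)

Section Sobolev1.
Context {R : realType}.
Local Notation D := (@dom R).
Local Notation L := (len R).
Implicit Types (f g h phi : R -> R) (a b c x y t : R).

(** That l does not depend on f is the point: along a sequence, a fixed violation
    near x0 costs a fixed amount. *)
Lemma integ_ge_bump x0 d : D x0 -> 0 < d -> exists2 l, 0 < l &
  forall f m, ig f -> 0 <= m -> (forall x, D x -> 0 <= f x) ->
    (forall x, D x -> `|x0 - x| < d -> m <= f x) -> m * l <= integ f.
Proof.
move=> Dx0 d0; have Lg := @len_gt0 R.
pose a := Num.max 0 (x0 - d / 2); pose b := Num.min L (x0 + d / 2).
move: Dx0; rewrite domE => /andP[x00 x0L].
have d2 : 0 < d / 2 by rewrite divr_gt0.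
have ab : a < b.
  by rewrite /a /b lt_min !gt_max Lg /=; do ?(apply/andP; split); lra.
have a0 : 0 <= a by rewrite /a le_max lexx.
have bL : b <= L by rewrite /b ge_min lexx.
exists (b - a); first by rewrite subr_gt0.
move=> f m igf m0 f0 fm.
rewrite -integ_chi ?(ltW ab)// -integZ; last by apply: sq_ig; exact: sq_chi.
apply: integ_le => //; first by apply: igZ; apply: sq_ig; exact: sq_chi.
move=> x Dx; rewrite /chi; have [/andP[ax xb]|_] := boolP (a < x <= b)%R.
  rewrite mulr1 fm//; move: ax xb; rewrite /a /b gt_max le_min.
  move=> /andP[_ h1] /andP[_ h2].
  by rewrite ltr_norml; apply/andP; split; lra.
by rewrite mulr0 f0.
Qed.

(** Used to turn equalities almost everywhere between continuous representatives
    into equalities at every point of [0, L]. *)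
Lemma continuous_nsq_eq0 f : {within D, continuous f} -> nsq f = 0 ->
  forall x, D x -> f x = 0.
Proof.
move=> cf f0 x Dx; apply/eqP; rewrite -normr_le0 leNgt; apply/negP => fx.
have fx2 : 0 < `|f x| / 2 by rewrite divr_gt0.
have /dom_within_continuousP/(_ x Dx _ fx2)[d d0 hd] := cf.
have [l l0 /(_ (fun t => f t ^+ 2) ((`|f x| / 2) ^+ 2)) H] := integ_ge_bump Dx d0.
have : (`|f x| / 2) ^+ 2 * l <= 0.
  rewrite -f0; apply: H.
  - by have [] := continuous_sq cf.
  - exact: sqr_ge0.
  - by move=> t _; exact: sqr_ge0.
  - move=> t Dt xt; have := hd t Dt xt => h.
    rewrite -[leRHS]real_normK ?num_real// lerXn2r ?nnegrE ?(ltW fx2)//.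
    have : `|f x| <= `|f x - f t| + `|f t|.
      by rewrite -[X in `|X| <= _](subrK (f t)) ler_normD.
    lra.
by rewrite leNgt mulr_gt0// exprn_gt0.
Qed.

(** The primitive of f has weak derivative 0, so it is constant. *)
Lemma weak0_nsq_eq0 f : sq f ->
  (forall phi, test_function phi -> integ (fun x => f x * phi x) = 0) ->
  nsq f = 0.
Proof.
move=> sf H; have cp := prim_continuous sf.
have [phi tphi|c c0] := @weak0_constant _ (prim f) (continuous_sq cp).
  have := prim_weak_derivative sf tphi; rewrite -!integE => ->.
  by rewrite H// oppr0.
have cc : {within D, continuous (fun x => prim f x - c)}.
  by move=> x; apply: cvgB; [exact: cp|exact: cvg_cst].
have pc x : D x -> prim f x = c.
  by move=> Dx; apply/eqP; rewrite -subr_eq0; apply/eqP; exact: continuous_nsq_eq0 c0 x Dx.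
apply: nsq_prim_eq0 => // x Dx.
by rewrite pc// -(pc 0 (@dom0 R)) prim_at0.
Qed.

Lemma weak_derivative1P f g : weak_derivative1 f g <->
  forall phi, test_function phi ->
    integ (fun x => f x * derive1 phi x) = - integ (fun x => g x * phi x).
Proof. by split=> h phi /h; rewrite !integE. Qed.

(** The functions of H^1, by their continuous representatives, with their
    derivatives: see [H1pair_weak] and [weak_derivative_H1pair]. *)
Definition H1pair f g := sq g /\ forall x, D x -> f x = f 0 + prim g x.

Lemma H1pair_continuous f g : H1pair f g -> {within D, continuous f}.
Proof.
move=> [sg fE]; apply: (@holder_continuous _ _ (nsq g)) => x y Dx Dy.
rewrite (fE x)// (fE y)// opprD addrACA subrr add0r.
exact: prim_holder.
Qed.

Lemma H1pair_sq f g : H1pair f g -> sq f.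
Proof. by move=> /H1pair_continuous/continuous_sq. Qed.

Lemma H1pair_holder f g x y : H1pair f g -> D x -> D y ->
  (f x - f y) ^+ 2 <= nsq g * `|x - y|.
Proof.
move=> [sg fE] Dx Dy; rewrite (fE x)// (fE y)// opprD addrACA subrr add0r.
exact: prim_holder.
Qed.

Lemma H1pair_weak f g : H1pair f g -> weak_derivative1 f g.
Proof.
move=> fg; apply/weak_derivative1P => phi tphi; have sf := H1pair_sq fg.
have [sg fE] := fg; have [c1 c0 p0 pL pE] := test_function_FTC tphi.
have s1 := continuous_sq c1.
rewrite -((weak_derivative1P _ _).1 (prim_weak_derivative sg) phi tphi).
rewrite (@eq_integ _ _ (fun x => f 0 * derive1 phi x + prim g x * derive1 phi x)).
  rewrite integD; last 2 first.
  - by apply: igZ; exact: sq_ig.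
  - by apply: sq_mul => //; apply: continuous_sq; exact: prim_continuous.
  rewrite integZ; last exact: sq_ig.
  rewrite -prim_len; last exact: sq_ig.
  by rewrite -pE ?pL ?mulr0 ?add0r//; exact: domL.
by move=> x Dx; rewrite fE// mulrDl.
Qed.

(** The difference f - [prim g] has weak derivative 0. *)
Lemma weak_derivative_nsq f g : sq f -> sq g -> weak_derivative1 f g ->
  exists c, nsq (fun x => f x - (c + prim g x)) = 0.
Proof.
move=> sf sg fg; have sp := continuous_sq (prim_continuous sg).
have [phi tphi|c c0] := @weak0_constant _ (fun x => f x - prim g x) (sqB sf sp).
  have [c1 _ _ _ _] := test_function_FTC tphi; have s1 := continuous_sq c1.
  rewrite (@eq_integ _ _ (fun x => f x * derive1 phi x - prim g x * derive1 phi x)).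
    rewrite integB; [|exact: sq_mul..].
    have := fg phi tphi; have := prim_weak_derivative sg tphi.
    by rewrite -!integE => -> ->; rewrite subrr.
  by move=> x _; rewrite mulrBl.
by exists c; rewrite -c0; apply: eq_nsq => x _; ring.
Qed.

Lemma weak_derivative_H1pair f g : {within D, continuous f} -> sq g ->
  weak_derivative1 f g -> H1pair f g.
Proof.
move=> cf sg fg; have [c c0] := weak_derivative_nsq (continuous_sq cf) sg fg.
have cc : {within D, continuous (fun x => f x - (c + prim g x))}.
  move=> x; apply: cvgB; first exact: cf.
  by apply: cvgD; [exact: cvg_cst|exact: prim_continuous].
have fE x : D x -> f x = c + prim g x.
  by move=> Dx; apply/eqP; rewrite -subr_eq0; apply/eqP; exact: continuous_nsq_eq0 c0 x Dx.
split=> // x Dx; rewrite (fE 0 (@dom0 R)) prim_at0 addr0; exact: fE.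
Qed.

Lemma weak_derivative_unique f g h : sq g -> sq h ->
  weak_derivative1 f g -> weak_derivative1 f h -> nsq (fun x => g x - h x) = 0.
Proof.
move=> sg sh fg fh; apply: weak0_nsq_eq0 => [|phi tphi]; first exact: sqB.
have [_ c0 _ _ _] := test_function_FTC tphi; have s0 := continuous_sq c0.
rewrite (@eq_integ _ _ (fun x => g x * phi x - h x * phi x)).
  rewrite integB; [|exact: sq_mul..].
  have := fg phi tphi; have := fh phi tphi.
  by rewrite -!integE => -> /oppr_inj ->; rewrite subrr.
by move=> x _; rewrite mulrBl.
Qed.

Lemma integ_mul_nsq0 f g h : sq f -> sq g -> sq h ->
  nsq (fun x => f x - g x) = 0 ->
  integ (fun x => f x * h x) = integ (fun x => g x * h x).
Proof.
move=> sf sg sh fg; apply/eqP; rewrite -subr_eq0; apply/eqP.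
by rewrite -[LHS](dotpBl sf sg sh); apply: dotp_eq0 => //; exact: sqB.
Qed.

Lemma nsq_nsq0 f g : sq f -> sq g -> nsq (fun x => f x - g x) = 0 ->
  nsq f = nsq g.
Proof.
move=> sf sg fg; rewrite !nsqE /dotp (integ_mul_nsq0 sf sg sf fg).
by rewrite -[LHS]/(dotp g f) dotpC /dotp (integ_mul_nsq0 sf sg sg fg).
Qed.

Lemma H1pair_comb a b f g f' g' : H1pair f g -> H1pair f' g' ->
  H1pair (fun x => a * f x + b * f' x) (fun x => a * g x + b * g' x).
Proof.
move=> [sg fE] [sg' fE']; split; first by apply: sqD => //; exact: sqZ.
move=> x Dx; rewrite primD; [|by apply: igZ; exact: sq_ig..].
by rewrite !primZ; [rewrite fE// fE'//; ring|exact: sq_ig..].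
Qed.

Lemma eq_H1pair f g f' g' : (forall x, D x -> f x = f' x) ->
  (forall x, D x -> g x = g' x) -> H1pair f g -> H1pair f' g'.
Proof.
move=> ff gg [sg fE]; split; first exact: eq_sq gg sg.
by move=> x Dx; rewrite -!ff//; [rewrite fE// (eq_prim x gg)|exact: dom0].
Qed.

Lemma H1pair_poincare f g : H1pair f g ->
  nsq f <= 2 * L * f 0 ^+ 2 + 2 * L ^+ 2 * nsq g.
Proof.
move=> fg; have [sg fE] := fg; have [_ f2] := H1pair_sq fg.
have -> : 2 * L * f 0 ^+ 2 + 2 * L ^+ 2 * nsq g =
   integ (cst (2 * f 0 ^+ 2 + 2 * L * nsq g)).
  by rewrite integ_cst; ring.
apply: integ_le => //; first exact: ig_cst.
move=> x Dx /=; have := H1pair_holder fg Dx (@dom0 R).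
move: (Dx); rewrite domE subr0 => /andP[x0 xL]; rewrite ger0_norm// => h.
have h2 : nsq g * x <= nsq g * L by rewrite ler_wpM2l// nsq_ge0.
by have := sqr_ge0 (f x - 2 * f 0); nra.
Qed.

(** Compare f x with f t by the Holder bound and average over t. *)
Lemma H1pair_sobolev f g x : H1pair f g -> D x ->
  f x ^+ 2 <= 2 / L * nsq f + 2 * L * nsq g.
Proof.
move=> fg Dx; have [sg fE] := fg; have [_ f2] := H1pair_sq fg.
have Lg := @len_gt0 R.
rewrite -(ler_pM2r Lg) -(integ_cst (f x ^+ 2)).
have -> : (2 / L * nsq f + 2 * L * nsq g) * L =
   integ (fun t => 2 * f t ^+ 2 + cst (2 * L * nsq g) t).
  rewrite integD; [|exact: igZ|exact: ig_cst].
  by rewrite integZ// integ_cst /nsq; field; rewrite gt_eqF.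
apply: integ_le; [exact: ig_cst|by apply: igD; [exact: igZ|exact: ig_cst]|].
move=> t Dt /=; have := H1pair_holder fg Dx Dt.
have xt : `|x - t| <= L.
  move: Dx Dt; rewrite !domE => /andP[? ?] /andP[? ?].
  by rewrite ler_norml; apply/andP; split; lra.
have h2 : nsq g * `|x - t| <= nsq g * L by rewrite ler_wpM2l// nsq_ge0.
by have := sqr_ge0 (f x - 2 * f t); nra.
Qed.

End Sobolev1.

(** * Functions in H^2 are twofold primitives *)

Section Sobolev2.
Context {R : realType}.
Local Notation D := (@dom R).
Local Notation L := (len R).
Local Notation V := (R -> 'rV[R]_3).
Implicit Types (u v w : V) (a b c x y t : R).

Definition entry v (i : 'I_3) : R -> R := fun x => v x 0 i.

Lemma entry_lin a u v i x : entry (a *: u + v) i x = a * entry u i x + entry v i x.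
Proof. by rewrite /entry !fctE !mxE. Qed.

Lemma row_eqP (p q : 'rV[R]_3) : (forall i, p 0 i = q 0 i) -> p = q.
Proof. by move=> h; apply/rowP. Qed.

Lemma entry_norm_le (p : 'rV[R]_3) i : `|p 0 i| <= `|p|.
Proof.
rewrite -[leRHS]/(mx_norm p) mx_normrE.
exact: (@le_bigmax _ _ _ 0 (fun ij : 'I_1 * 'I_3 => `|p ij.1 ij.2|) (0, i)).
Qed.

Lemma row_norm_lt (p : 'rV[R]_3) e : 0 < e -> (forall i, `|p 0 i| < e) -> `|p| < e.
Proof.
move=> e0 h; rewrite -[ltLHS]/(mx_norm p) mx_normrE; apply: bigmax_lt => // -[j i] _ /=.
by rewrite ord1.
Qed.

Lemma within_entryP v : {within D, continuous v} <->
  forall i, {within D, continuous (entry v i)}.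
Proof.
split=> [/dom_within_continuousP H i|H]; apply/dom_within_continuousP => x Dx e e0.
  have [d d0 hd] := H x Dx e e0; exists d => // y Dy xy.
  apply: le_lt_trans (hd y Dy xy).
  by have := entry_norm_le (v x - v y) i; rewrite !mxE.
have P i : exists2 d, 0 < d & forall y, D y -> `|x - y| < d -> `|entry v i x - entry v i y| < e.
  by have /dom_within_continuousP/(_ x Dx e e0) := H i.
pose d i := s2val (cid2 (P i)).
have d0 i : 0 < d i by rewrite /d; case: cid2.
have dP i y : D y -> `|x - y| < d i -> `|entry v i x - entry v i y| < e.
  by rewrite /d; case: cid2 => /= r _; apply.
exists (\big[Num.min/1]_(i < 3) d i); first by apply: lt_bigmin.
move=> y Dy xy; apply: row_norm_lt => // i; rewrite !mxE; apply: dP => //.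
by apply: lt_le_trans xy _; apply: bigmin_le_cond.
Qed.

Lemma L2normsqE v : (forall i, sq (entry v i)) ->
  L2normsq v = \sum_(i < 3) nsq (entry v i).
Proof.
move=> sv; rewrite /L2normsq -integE -integ_sum//.
by move=> i; have [] := sv i.
Qed.

(** The exact classes of [D1 v] and [D2 v] are fixed by choice only; [rep] allows a
    function to be described by whichever derivatives are at hand. *)
Definition rep v v1 v2 := forall i,
  H1pair (entry v i) (entry v1 i) /\ H1pair (entry v1 i) (entry v2 i).

Lemma weak_derivativeP v g : weak_derivative v g <->
  forall i, [/\ sq (entry v i), sq (entry g i) &
                weak_derivative1 (entry v i) (entry g i)].
Proof.
by split=> h i; have [h1 h2 h3] := h i; split => //; apply/L2P.
Qed.

Lemma H1pairs_weak v g : (forall i, H1pair (entry v i) (entry g i)) ->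
  weak_derivative v g.
Proof.
move=> h; apply/weak_derivativeP => i; have hi := h i; split.
- exact: H1pair_sq hi.
- by case: hi.
- exact: H1pair_weak.
Qed.

Lemma rep_H2 v v1 v2 : rep v v1 v2 -> Hsp 2 v.
Proof.
move=> r; split; first by apply/within_entryP => i; apply: H1pair_continuous; exact: (r i).1.
exists v1; split; first by apply: H1pairs_weak => i; exact: (r i).1.
exists v2; split; first by apply: H1pairs_weak => i; exact: (r i).2.
by move=> i; apply/L2P; have [_ [? _]] := r i.
Qed.

Lemma continuous_weak_unique v g h : {within D, continuous g} ->
  {within D, continuous h} -> weak_derivative v g -> weak_derivative v h ->
  forall x, D x -> g x = h x.
Proof.
move=> cg ch /weak_derivativeP vg /weak_derivativeP vh x Dx; apply: row_eqP => i.
have [_ sg wg] := vg i; have [_ sh wh] := vh i.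
have := weak_derivative_unique sg sh wg wh.
move=> /continuous_nsq_eq0 -/(_ _ x Dx) E; apply/eqP; rewrite -subr_eq0; apply/eqP; apply: E.
by move=> y; apply: cvgB; [exact: ((within_entryP _).1 cg i y)|exact: ((within_entryP _).1 ch i y)].
Qed.

(** Both choices have to be met by an explicit witness: the continuous
    representative of v' is a constant plus the primitive of v''. *)
Lemma H2_rep v : Hsp 2 v -> rep v (D1 v) (D2 v).
Proof.
move=> [cv [g [wg [g2 [wg2 _]]]]].
have /weak_derivativeP hg := wg; have /weak_derivativeP hg2 := wg2.
have cP i : exists c, nsq (fun x => entry g i x - (c + prim (entry g2 i) x)) = 0.
  by have [sg sg2 w] := hg2 i; exact: weak_derivative_nsq.
pose c i := sval (cid (cP i)).
have c0 i : nsq (fun x => entry g i x - (c i + prim (entry g2 i) x)) = 0.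
  by rewrite /c; case: cid.
pose g' : V := fun x => \row_i (c i + prim (entry g2 i) x).
have g'E i : entry g' i = fun x => c i + prim (entry g2 i) x.
  by apply/funext => x; rewrite /entry mxE.
have cg' i : {within D, continuous (entry g' i)}.
  rewrite g'E => x; apply: cvgD; first exact: cvg_cst.
  by apply: prim_continuous; have [] := hg2 i.
have exD1 : {within D, continuous g'} /\ weak_derivative v g'.
  split; first exact/within_entryP.
  apply/weak_derivativeP => i; have [sv sg w] := hg i.
  have sg' := continuous_sq (cg' i); split => // phi tphi.
  have [_ cphi _ _ _] := test_function_FTC tphi; have sphi := continuous_sq cphi.
  rewrite (w phi tphi); congr (- _); rewrite -!integE.
  by apply: integ_mul_nsq0 => //; rewrite g'E.
have [cD1 wD1] : {within D, continuous (D1 v)} /\ weak_derivative v (D1 v).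
  exact: (@xgetPex _ (fun=> 0) [set g | {within D, continuous g} /\ weak_derivative v g] (ex_intro _ g' exD1)).
have /weak_derivativeP hD1 := wD1.
have exD2 : weak_derivative (D1 v) g2.
  apply/weak_derivativeP => i; have [_ sg2 w2] := hg2 i.
  have [_ sD1 w1] := hD1 i; have [_ sg w] := hg i.
  split => // phi tphi; have [cphi _ _ _ _] := test_function_FTC tphi.
  rewrite -(w2 phi tphi) -!integE; apply: integ_mul_nsq0 => //.
    exact: continuous_sq.
  exact: weak_derivative_unique w1 w.
have wD2 : weak_derivative (D1 v) (D2 v).
  exact: (@xgetPex _ (fun=> 0) [set g | weak_derivative (D1 v) g] (ex_intro _ g2 exD2)).
have /weak_derivativeP hD2 := wD2.
move=> i; have [_ _ w1] := hD1 i; have [sD1 sD2 w2] := hD2 i.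
split; apply: weak_derivative_H1pair => //; first exact: ((within_entryP v).1 cv i).
exact: ((within_entryP _).1 cD1 i).
Qed.

Lemma rep_D1 v v1 v2 x : rep v v1 v2 -> D x -> D1 v x = v1 x.
Proof.
move=> r Dx; have r' := H2_rep (rep_H2 r).
apply: (@continuous_weak_unique v) => //.
- by apply/within_entryP => i; apply: H1pair_continuous; exact: (r' i).2.
- by apply/within_entryP => i; apply: H1pair_continuous; exact: (r i).2.
- by apply: H1pairs_weak => i; exact: (r' i).1.
- by apply: H1pairs_weak => i; exact: (r i).1.
Qed.

Lemma rep_D2 v v1 v2 i : rep v v1 v2 ->
  nsq (fun x => entry (D2 v) i x - entry v2 i x) = 0.
Proof.
move=> r; have r' := H2_rep (rep_H2 r).
have [_ h'] := r' i; have [_ h] := r i.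
have h2 : H1pair (entry (D1 v) i) (entry v2 i).
  by apply: eq_H1pair h => // x Dx; rewrite /entry (rep_D1 r).
have [s' _] := h'; have [s _] := h.
by apply: (weak_derivative_unique s' s (f := entry (D1 v) i)); exact: H1pair_weak.
Qed.

Lemma rep_lin a u u1 u2 v v1 v2 : rep u u1 u2 -> rep v v1 v2 ->
  rep (a *: u + v) (a *: u1 + v1) (a *: u2 + v2).
Proof.
move=> ru rv i; have [a1 a2] := ru i; have [b1 b2] := rv i.
by split; [apply: eq_H1pair (H1pair_comb a 1 a1 b1)|
           apply: eq_H1pair (H1pair_comb a 1 a2 b2)] => x Dx;
  rewrite entry_lin mul1r.
Qed.

Lemma H2_lin a u v : Hsp 2 u -> Hsp 2 v -> Hsp 2 (a *: u + v).
Proof. by move=> /H2_rep ru /H2_rep rv; exact: rep_H2 (rep_lin a ru rv). Qed.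

Lemma D1_lin a u v x i : Hsp 2 u -> Hsp 2 v -> D x ->
  entry (D1 (a *: u + v)) i x = a * entry (D1 u) i x + entry (D1 v) i x.
Proof.
move=> /H2_rep ru /H2_rep rv Dx.
by rewrite -entry_lin /entry (rep_D1 (rep_lin a ru rv) Dx).
Qed.

Lemma D2_lin a u v i : Hsp 2 u -> Hsp 2 v ->
  nsq (fun x => entry (D2 (a *: u + v)) i x -
                (a * entry (D2 u) i x + entry (D2 v) i x)) = 0.
Proof.
move=> /H2_rep ru /H2_rep rv; rewrite -[RHS](rep_D2 i (rep_lin a ru rv)).
by apply: eq_nsq => x _; rewrite entry_lin.
Qed.

Lemma H2_sq v i : Hsp 2 v ->
  [/\ sq (entry v i), sq (entry (D1 v) i) & sq (entry (D2 v) i)].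
Proof.
move=> /H2_rep/(_ i)[h1 h2]; split; [exact: H1pair_sq h1|exact: H1pair_sq h2|].
by case: h2.
Qed.

Lemma L2normsq_D2_rep v v1 v2 : rep v v1 v2 ->
  L2normsq (D2 v) = \sum_(i < 3) nsq (entry v2 i).
Proof.
move=> r; have H := rep_H2 r; rewrite L2normsqE; last by move=> i; have [] := H2_sq i H.
apply: eq_bigr => i _; apply: nsq_nsq0; last exact: rep_D2 r.
  by have [] := H2_sq i H.
by have [_ []] := r i.
Qed.

Lemma L2normsq_ge0 v : 0 <= L2normsq v.
Proof.
rewrite /L2normsq -integE; apply: integ_ge0 => x _.
by apply: sumr_ge0 => i _; exact: sqr_ge0.
Qed.

Lemma H2norm_ge0 v : 0 <= H2norm v.
Proof. exact: sqrtr_ge0. Qed.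

Lemma H2norm_sqr v : H2norm v ^+ 2 = L2normsq v + L2normsq (D1 v) + L2normsq (D2 v).
Proof. by rewrite sqr_sqrtr// !addr_ge0 ?L2normsq_ge0. Qed.

Lemma nsq_le_L2normsq v i : (forall i, sq (entry v i)) ->
  nsq (entry v i) <= L2normsq v.
Proof.
move=> sv; rewrite L2normsqE// (bigD1 i)//= lerDl; apply: sumr_ge0 => j _.
exact: nsq_ge0.
Qed.

Definition sobolevC : R := Num.sqrt (2 / L + 2 * L).

Lemma sobolevC_sqr : sobolevC ^+ 2 = 2 / L + 2 * L.
Proof. have L0 := ltW (@len_gt0 R).
by rewrite sqr_sqrtr//; apply: addr_ge0; [exact: divr_ge0|exact: mulr_ge0]. Qed.

Lemma H1pair_value_le f g M x : 0 <= M -> H1pair f g -> D x -> nsq f + nsq g <= M ^+ 2 ->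
  `|f x| <= sobolevC * M.
Proof.
move=> M0 fg Dx h; rewrite -(ler_pXn2r (n := 2))// ?nnegrE ?mulr_ge0 ?sqrtr_ge0//.
rewrite real_normK ?num_real// exprMn sobolevC_sqr.
apply: (le_trans (H1pair_sobolev fg Dx)).
have Lg := @len_gt0 R; have n1 := nsq_ge0 f; have n2 := nsq_ge0 g.
have i0 : 0 <= 2 / L by rewrite divr_ge0// ltW.
have L0 : 0 <= 2 * L by lra.
nra.
Qed.

Lemma sobolev_value v x i : Hsp 2 v -> D x -> `|v x 0 i| <= sobolevC * H2norm v.
Proof.
move=> Hv Dx; have r := H2_rep Hv.
apply: (H1pair_value_le (H2norm_ge0 v) (r i).1 Dx).
rewrite H2norm_sqr -addrA lerD//.
  by apply: nsq_le_L2normsq => j; have [] := H2_sq j Hv.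
rewrite (le_trans (y := L2normsq (D1 v)))//.
  by apply: nsq_le_L2normsq => j; have [] := H2_sq j Hv.
by rewrite lerDl L2normsq_ge0.
Qed.

Lemma sobolev_slope v x i : Hsp 2 v -> D x -> `|D1 v x 0 i| <= sobolevC * H2norm v.
Proof.
move=> Hv Dx; have r := H2_rep Hv.
apply: (H1pair_value_le (H2norm_ge0 v) (r i).2 Dx).
rewrite H2norm_sqr -addrA ler_wpDl ?L2normsq_ge0// lerD//.
  by apply: nsq_le_L2normsq => j; have [] := H2_sq j Hv.
by apply: nsq_le_L2normsq => j; have [] := H2_sq j Hv.
Qed.

End Sobolev2.

(** * Weak sequential compactness from the parallelogram law *)

Section WeakCompactness.
Context {R : realType} {V : lmodType R}.
Variables (K : set V) (Q : V -> R) (M : R) (f : nat -> V).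
Implicit Types (S T : set nat) (u v w : V) (e r : R).

Definition mid u v : V := 2^-1 *: (u + v).

(* K plays the role of H^2, and Q of the square of a Hilbert norm on it *)
Hypothesis K0 : K 0.
Hypothesis KL : forall a u v, K u -> K v -> K (a *: u + v).
Hypothesis Q_ge0 : forall v, 0 <= Q v.
Hypothesis parallelogram : forall u v, K u -> K v ->
  Q (u - v) = 2 * Q u + 2 * Q v - 4 * Q (mid u v).
Hypothesis Qcomplete : forall u_ : nat -> V, (forall n, K (u_ n)) ->
  (forall e, 0 < e -> exists N, forall m n, (N <= m)%N -> (N <= n)%N ->
     Q (u_ m - u_ n) <= e) ->
  exists2 g, K g & forall e, 0 < e -> exists N, forall n, (N <= n)%N ->
     Q (u_ n - g) <= e.
Hypothesis Kf : forall n, K (f n).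
Hypothesis fM : forall n, Q (f n) <= M.

(** Closing under midpoints instead of all convex combinations suffices, as the
    parallelogram law only involves midpoints. *)
Inductive hull (A : set V) : V -> Prop :=
| hull_base v : A v -> hull A v
| hull_mid u v : hull A u -> hull A v -> hull A (mid u v).

Definition tail S n : set V := [set v | exists m, [/\ S m, (n <= m)%N & v = f m]].

Definition infin S := forall n, exists2 m, (n <= m)%N & S m.

Definition low S r := exists n, forall v, hull (tail S n) v -> r <= Q v.

(** The limit of the least values of [Q] on the convex hulls of the tails of the
    sequence indexed by [S]. *)
Definition height S : R := sup [set r | low S r].

Lemma hull_sub (A B : set V) v : A `<=` B -> hull A v -> hull B v.
Proof.
move=> AB; elim=> [w Aw|u w _ Hu _ Hw]; first by apply: hull_base; exact: AB.
exact: hull_mid.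
Qed.

Lemma K_mid u v : K u -> K v -> K (mid u v).
Proof.
move=> Ku Kv; rewrite /mid -[X in K X]addr0; apply: KL => //.
by rewrite -[u]scale1r; apply: KL.
Qed.

Lemma hull_K S n v : hull (tail S n) v -> K v.
Proof.
by elim=> [w [m [_ _ ->]]|u w _ Ku _ Kw]; [exact: Kf|exact: K_mid].
Qed.

Lemma tail_sub S T n m : (n <= m)%N -> (forall k, (m <= k)%N -> T k -> S k) ->
  tail T m `<=` tail S n.
Proof.
move=> nm TS v [k [Tk mk ->]]; exists k; split => //; first exact: TS.
exact: leq_trans mk.
Qed.

Lemma low_has_sup S : infin S -> has_sup [set r | low S r].
Proof.
move=> iS; split; first by exists 0, 0%N => v _; exact: Q_ge0.
exists M => r [n H]; have [m nm Sm] := iS n.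
by rewrite (le_trans _ (fM m))//; apply: H; apply: hull_base; exists m.
Qed.

Lemma low_lt_height S r : infin S -> r < height S -> low S r.
Proof.
move=> iS rS; have := @sup_adherent _ _ (height S - r).
rewrite subr_gt0 => /(_ [set r | low S r] rS (low_has_sup iS)).
rewrite -/(height S) subKr => -[r' [n H] rr']; exists n => v hv.
by rewrite (le_trans (ltW rr'))// H.
Qed.

Lemma height_lt S r n : infin S -> height S < r ->
  exists2 v, hull (tail S n) v & Q v < r.
Proof.
move=> iS rS; apply: contrapT => H.
suff : r <= height S by rewrite leNgt rS.
apply: ub_le_sup; first by have [] := low_has_sup iS.
exists n => v hv; rewrite leNgt; apply/negP => Qv; apply: H; by exists v.
Qed.

Lemma le_height S T n : infin S -> infin T ->
  (forall k, (n <= k)%N -> T k -> S k) -> height S <= height T.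
Proof.
move=> iS iT TS; apply: ge_sup; first by have [] := low_has_sup iS.
move=> r [m H]; apply: ub_le_sup; first by have [] := low_has_sup iT.
exists (maxn n m) => v hv; apply: H; apply: hull_sub hv; apply: tail_sub.
  exact: leq_maxr.
by move=> k; rewrite geq_max => /andP[nk _]; exact: TS.
Qed.

Lemma height_le_bound S : infin S -> height S <= M.
Proof.
move=> iS; apply: ge_sup; first by have [] := low_has_sup iS.
move=> r [n H]; have [m nm Sm] := iS n.
by rewrite (le_trans _ (fM m))//; apply: H; apply: hull_base; exists m.
Qed.

(** The height is bounded by M, so its supremum over the subsequences of S is
    approached. *)
Lemma nearly_extremal S e : infin S -> 0 < e ->
  exists T, [/\ infin T, T `<=` S &
    forall T', infin T' -> T' `<=` S -> height T' <= height T + e].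
Proof.
move=> iS e0.
pose H := [set r | exists T, [/\ infin T, T `<=` S & r = height T]].
have hs : has_sup H.
  split; first by exists (height S); exists S; split.
  by exists M => _ [T [iT _ ->]]; exact: height_le_bound.
have [_ [T [iT TS ->]] hT] := sup_adherent e0 hs.
exists T; split => // T' iT' T'S.
rewrite -lerBlDr (le_trans _ (ltW hT))// lerD2r; apply: ub_le_sup; first by case: hs.
by exists T'.
Qed.

(** Nested nearly extremal subsequences, of defect 1 / (k + 1), are diagonalized;
    finitely many terms do not affect the height. *)
Lemma extremal_subsequence : exists2 S, infin S &
  forall T, infin T -> T `<=` S -> height T <= height S.
Proof.
pose IS := {S : set nat | infin S}.
have step (k : nat) (X : IS) : {Y : IS | sval Y `<=` sval X /\
    forall T', infin T' -> T' `<=` sval X -> height T' <= height (sval Y) + k.+1%:R^-1}.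
  apply: cid; have k0 : 0 < k.+1%:R^-1 :> R by rewrite invr_gt0.
  have [T [iT TS HT]] := nearly_extremal (svalP X) k0.
  by exists (exist _ T iT).
have iT0 : infin setT by move=> n; exists n.
pose S_ := fix S_ n : IS := if n is n'.+1 then sval (step n' (S_ n')) else exist _ _ iT0.
have SS n : sval (S_ n.+1) `<=` sval (S_ n) by exact: (svalP (step n (S_ n))).1.
have SE n T' : infin T' -> T' `<=` sval (S_ n) ->
    height T' <= height (sval (S_ n.+1)) + n.+1%:R^-1.
  by move=> iT' T'S; exact: (svalP (step n (S_ n))).2.
have Smono m n : (m <= n)%N -> sval (S_ n) `<=` sval (S_ m).
  elim: n => [|n IH]; first by rewrite leqn0 => /eqP ->.
  rewrite leq_eqVlt => /orP[/eqP->//|]; rewrite ltnS => /IH h.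
  exact: subset_trans (SS n) h.
have pick k (n : nat) : {m : nat | (n <= m)%N /\ sval (S_ k) m}.
  by apply: cid; have [m nm Sm] := svalP (S_ k) n; exists m.
pose m_ := fix m_ k : nat := if k is k'.+1 then sval (pick k (m_ k').+1) else sval (pick 0%N 0%N).
have mS k : sval (S_ k) (m_ k).
  by case: k => [|k]; [exact: (svalP (pick 0%N 0%N)).2|exact: (svalP (pick k.+1 (m_ k).+1)).2].
have mlt k : (m_ k < m_ k.+1)%N by exact: (svalP (pick k.+1 (m_ k).+1)).1.
have mge k : (k <= m_ k)%N by elim: k => // k IH; exact: leq_ltn_trans IH (mlt k).
have mmono i j : (i <= j)%N -> (m_ i <= m_ j)%N.
  elim: j => [|j IH]; first by rewrite leqn0 => /eqP ->.
  rewrite leq_eqVlt => /orP[/eqP->//|]; rewrite ltnS => /IH h.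
  exact: leq_trans h (ltnW (mlt j)).
pose S := [set m_ k | k in setT].
have iS : infin S by move=> n; exists (m_ n) => //; exists n.
have Salm k n : (m_ k <= n)%N -> S n -> sval (S_ k) n.
  move=> kn [j _ jn]; rewrite -jn in kn *.
  have [kj|jk] := leqP k j; first by apply: (Smono k j kj); exact: mS.
  have : (m_ j < m_ k)%N by exact: leq_trans (mlt j) (mmono _ _ jk).
  by rewrite ltnNge kn.
exists S => // T iT TS; apply/ler_addgt0Pl => e e0.
pose k := Num.truncn e^-1.
have ke : k.+1%:R^-1 <= e.
  rewrite -[leRHS]invrK lef_pV2 ?posrE ?invr_gt0//; apply: ltW.
  exact: truncnS_gt.
pose T' := T `&` sval (S_ k).
have iT' : infin T'.
  move=> n; have [m nm Tm] := iT (maxn n (m_ k)); exists m.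
    exact: leq_trans (leq_maxl _ _) nm.
  by split => //; apply: Salm; [exact: leq_trans (leq_maxr _ _) nm|exact: TS].
have h1 : height T <= height T' by apply: (@le_height _ _ 0%N) => // j _ [].
have h2 := SE k T' iT' (fun x h => h.2).
have h3 : height (sval (S_ k.+1)) <= height S.
  by apply: (@le_height _ _ (m_ k.+1)) => //; [exact: svalP|exact: Salm].
by rewrite addrC (le_trans h1)// (le_trans h2)// lerD.
Qed.

Definition linear_on (F : V -> R) :=
  forall a u v, K u -> K v -> F (a *: u + v) = a * F u + F v.
Definition bounded_on (F : V -> R) := exists C, forall v, K v -> F v ^+ 2 <= C * Q v.

Lemma linear_on_mid F u v : linear_on F -> K u -> K v ->
  F (mid u v) = (F u + F v) / 2.
Proof.
move=> lF Ku Kv; have F0 : F 0 = 0.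
  by have := lF (-1) 0 0 K0 K0; rewrite scaler0 addr0 mulN1r addNr.
rewrite /mid -[2^-1 *: _]addr0 lF//; last by rewrite -[u]scale1r; exact: KL.
by rewrite F0 -[u]scale1r lF// scale1r; field.
Qed.

Lemma linear_on_sub F u v : linear_on F -> K u -> K v -> F (u - v) = F u - F v.
Proof.
by move=> lF Ku Kv; rewrite addrC -scaleN1r lF// mulN1r addrC.
Qed.

Lemma small_of_bounded F (h : nat -> V) e : bounded_on F -> (forall n, K (h n)) -> 0 < e ->
  (forall r, 0 < r -> exists N, forall n, (N <= n)%N -> Q (h n) <= r) ->
  exists N, forall n, (N <= n)%N -> `|F (h n)| < e.
Proof.
move=> [C HC] Kh e0 hQ.
have C1 : 0 < `|C| + 1 by rewrite ltr_wpDl.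
have [|N HN] := hQ ((e / 2) ^+ 2 / (`|C| + 1)); first by rewrite divr_gt0// exprn_gt0// divr_gt0.
exists N => n /HN hn; apply: (@le_lt_trans _ _ (e / 2)); last by lra.
rewrite -(ler_pXn2r (n := 2))// ?nnegrE ?divr_ge0 ?(ltW e0)//.
rewrite real_normK ?num_real// (le_trans (HC _ (Kh n)))//.
have : (`|C| + 1) * Q (h n) <= (e / 2) ^+ 2 by rewrite mulrC -ler_pdivlMr.
by have := Q_ge0 (h n); have := ler_norm C; nra.
Qed.

(** The extremality of S makes the nearly minimal elements of the hulls of any of
    its subsequences converge to the same g. *)
Lemma weak_sequential_compactness : exists g (k : nat -> nat),
  [/\ K g, {homo k : m n / (m < n)%N} &
      forall F, linear_on F -> bounded_on F -> F (f (k n)) @[n --> \oo] --> F g].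
Proof.
have [S iS extS] := extremal_subsequence.
have gP n : {v | hull (tail S n) v /\ Q v < height S + n.+1%:R^-1}.
  apply: cid; have [|v hv Qv] := @height_lt S (height S + n.+1%:R^-1) n iS.
    by rewrite ltrDl invr_gt0.
  by exists v.
pose g n := sval (gP n).
have gh n : hull (tail S n) (g n) by exact: (svalP (gP n)).1.
have gQ n : Q (g n) < height S + n.+1%:R^-1 by exact: (svalP (gP n)).2.
have Kg n : K (g n) by apply: hull_K (gh n).
(* two nearly minimal elements of the same hull are close to each other *)
have close e : 0 < e -> exists N, forall m n v, (N <= m)%N -> (N <= n)%N ->
    hull (tail S n) v -> Q v < height S + n.+1%:R^-1 -> Q (g m - v) <= e.
  move=> e0; have e8 : 0 < e / 8 by rewrite divr_gt0.
  have [N1 HN1] : low S (height S - e / 8) by apply: low_lt_height => //; lra.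
  pose N2 := Num.truncn (e / 8)^-1.
  have N2e k : (N2 <= k)%N -> k.+1%:R^-1 <= e / 8.
    move=> Nk; rewrite -[leRHS]invrK lef_pV2 ?posrE ?invr_gt0//.
    by rewrite (le_trans (ltW (truncnS_gt _)))// ler_nat ltnS.
  exists (maxn N1 N2) => m n v; rewrite !geq_max => /andP[m1 m2] /andP[n1 n2] hv Qv.
  rewrite parallelogram//; last exact: hull_K hv.
  have h : height S - e / 8 <= Q (mid (g m) v).
    apply: HN1; apply: hull_mid; first by apply: hull_sub (gh m); exact: tail_sub.
    by apply: hull_sub hv; exact: tail_sub.
  move: Qv (gQ m) (N2e m m2) (N2e n n2) h.
  move: (n.+1%:R^-1) (m.+1%:R^-1) => a b; lra.
have [g0 Kg0 cg] : exists2 g0, K g0 & forall e, 0 < e -> exists N, forall n, (N <= n)%N ->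
     Q (g n - g0) <= e.
  apply: Qcomplete => // e e0; have [N HN] := close e e0; exists N => m n Nm Nn.
  exact: (HN m n (g n) Nm Nn (gh n) (gQ n)).
(* the terms where F exceeds F g0 + e would form a subsequence whose hulls also
   contain nearly minimal elements *)
have one_sided F e : linear_on F -> bounded_on F -> 0 < e ->
    exists N, forall m, (N <= m)%N -> S m -> F (f m) < F g0 + e.
  move=> lF bF e0; apply: contrapT => H.
  pose T := [set m | S m /\ F g0 + e <= F (f m)].
  have iT : infin T.
    move=> n; apply: contrapT => H'; apply: H; exists n => m nm Sm.
    by rewrite ltNge; apply/negP => h; apply: H'; exists m.
  have TS : T `<=` S by move=> m [].
  have hT : height T <= height S by exact: extS.
  have tl n v : hull (tail T n) v -> F g0 + e <= F v.
    elim=> [w [m [[_ Tm] _ ->]]//|u w hu Hu hw Hw].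
    rewrite linear_on_mid//; [lra|exact: hull_K hu|exact: hull_K hw].
  have hP n : {v | hull (tail T n) v /\ Q v < height S + n.+1%:R^-1}.
    apply: cid; have [|v hv Qv] := @height_lt T (height S + n.+1%:R^-1) n iT.
      by rewrite (le_lt_trans hT)// ltrDl invr_gt0.
    by exists v.
  pose h n := sval (hP n).
  have hh n : hull (tail T n) (h n) by exact: (svalP (hP n)).1.
  have hQ n : Q (h n) < height S + n.+1%:R^-1 by exact: (svalP (hP n)).2.
  have Kh n : K (h n) by apply: hull_K (hh n).
  have Ksub u v : K u -> K v -> K (u - v).
    by move=> Ku Kv; rewrite addrC -scaleN1r; exact: KL.
  have e2 : 0 < e / 2 by rewrite divr_gt0.
  have [|r r0|N1 HN1] := @small_of_bounded F (fun n => g n - h n) (e / 2) bF _ e2.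
  - by move=> n; exact: Ksub.
  - have [N HN] := close r r0; exists N => n Nn; apply: (HN n n (h n) Nn Nn _ (hQ n)).
    by apply: hull_sub (hh n); apply: tail_sub => // k _; exact: TS.
  have [|N2 HN2] := @small_of_bounded F (fun n => g n - g0) (e / 2) bF _ e2 cg.
    by move=> n; exact: Ksub.
  have := HN1 (maxn N1 N2) (leq_maxl _ _); have := HN2 (maxn N1 N2) (leq_maxr _ _).
  rewrite !linear_on_sub// => /ltr_normlP[a1 a2] /ltr_normlP[b1 b2].
  have := tl _ _ (hh (maxn N1 N2)); lra.
have two_sided F e : linear_on F -> bounded_on F -> 0 < e ->
    exists N, forall m, (N <= m)%N -> S m -> `|F g0 - F (f m)| <= e.
  move=> lF bF e0; have [N1 H1] := one_sided F e lF bF e0.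
  have lF' : linear_on (fun v => - F v).
    by move=> a u v Ku Kv; rewrite lF// opprD mulrN.
  have bF' : bounded_on (fun v => - F v).
    by have [C HC] := bF; exists C => v Kv; rewrite sqrrN; exact: HC.
  have [N2 H2] := one_sided _ e lF' bF' e0.
  exists (maxn N1 N2) => m; rewrite geq_max => /andP[m1 m2] Sm.
  have := H1 m m1 Sm; have := H2 m m2 Sm => ? ?.
  by rewrite ler_norml; apply/andP; split; lra.
have pick (n : nat) : {m : nat | (n <= m)%N /\ S m}.
  by apply: cid; have [m nm Sm] := iS n; exists m.
pose k := fix k n : nat := if n is n'.+1 then sval (pick (k n').+1) else sval (pick 0%N).
have kS n : S (k n) by case: n => [|n]; [exact: (svalP (pick 0%N)).2|exact: (svalP (pick (k n).+1)).2].
have klt n : (k n < k n.+1)%N by exact: (svalP (pick (k n).+1)).1.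
have kge n : (n <= k n)%N by elim: n => // n IH; exact: leq_ltn_trans IH (klt n).
exists g0, k; split => //; first by apply: homo_ltn => //; exact: ltn_trans.
move=> F lF bF; apply/cvgrPdist_le => e e0; have [N HN] := two_sided F e lF bF e0.
near=> n; apply: HN => //; apply: leq_trans (kge n).
by near: n; exact: nbhs_infty_ge.
Unshelve. all: by end_near. Qed.

End WeakCompactness.

(** * H^2 as a Hilbert space *)

(** Locked for the same reason as [integ]. *)
HB.lock Definition bend {R : realType} (v : R -> 'rV[R]_3) : R := L2normsq (D2 v).

Section HilbertH2.
Context {R : realType}.
Local Notation D := (@dom R).
Local Notation L := (len R).
Local Notation V := (R -> 'rV[R]_3).
Local Notation H2 := (@Hsp R 2).
Implicit Types (u v w : V) (a b c x y t : R) (i : 'I_3).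

(** The square of a Hilbert norm on H^2 that reads off the three data from which a
    function is rebuilt by integrating twice. *)
Definition Qnorm v : R := dotsq (v 0) + dotsq (D1 v 0) + bend v.

Lemma bendE v : bend v = L2normsq (D2 v).
Proof. by rewrite bend.unlock. Qed.

Lemma bend_ge0 v : 0 <= bend v.
Proof. by rewrite bendE L2normsq_ge0. Qed.

Lemma bend_rep v v1 v2 : rep v v1 v2 -> bend v = \sum_(i < 3) nsq (entry v2 i).
Proof. by rewrite bendE; exact: L2normsq_D2_rep. Qed.

Lemma bend_sum v : H2 v -> bend v = \sum_(i < 3) nsq (entry (D2 v) i).
Proof. by move=> /H2_rep/bend_rep. Qed.

Lemma Qnorm_ge0 v : 0 <= Qnorm v.
Proof.
by rewrite /Qnorm !addr_ge0 ?bend_ge0//; apply: sumr_ge0 => i _; exact: sqr_ge0.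
Qed.

Lemma Qnorm_rep v v1 v2 : rep v v1 v2 -> Qnorm v =
  \sum_(i < 3) (entry v i 0 ^+ 2 + entry v1 i 0 ^+ 2 + nsq (entry v2 i)).
Proof.
move=> r; rewrite /Qnorm (rep_D1 r (@dom0 R)) (bend_rep r).
by rewrite !big_split.
Qed.

Lemma entry_sub u v i x : entry (u - v) i x = entry u i x - entry v i x.
Proof. by rewrite /entry !fctE !mxE. Qed.

Lemma entry_mid u v i x : entry (mid u v) i x = 2^-1 * entry u i x + 2^-1 * entry v i x.
Proof. by rewrite /mid /entry !fctE !mxE mulrDr. Qed.

Lemma rep_sub u u1 u2 v v1 v2 : rep u u1 u2 -> rep v v1 v2 ->
  rep (u - v) (u1 - v1) (u2 - v2).
Proof.
move=> ru rv i; have [a1 a2] := ru i; have [b1 b2] := rv i.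
by split; [apply: eq_H1pair (H1pair_comb 1 (-1) a1 b1)|
           apply: eq_H1pair (H1pair_comb 1 (-1) a2 b2)] => x Dx;
  rewrite entry_sub mul1r mulN1r.
Qed.

Lemma rep_mid u u1 u2 v v1 v2 : rep u u1 u2 -> rep v v1 v2 ->
  rep (mid u v) (mid u1 v1) (mid u2 v2).
Proof.
move=> ru rv i; have [a1 a2] := ru i; have [b1 b2] := rv i.
by split; [apply: eq_H1pair (H1pair_comb 2^-1 2^-1 a1 b1)|
           apply: eq_H1pair (H1pair_comb 2^-1 2^-1 a2 b2)] => x Dx;
  rewrite entry_mid.
Qed.

Lemma nsq_parallelogram (f g : R -> R) : sq f -> sq g ->
  nsq (fun x => f x - g x) = 2 * nsq f + 2 * nsq g - 4 * nsq (fun x => 2^-1 * f x + 2^-1 * g x).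
Proof.
move=> sf sg.
have -> : nsq (fun x => 2^-1 * f x + 2^-1 * g x) = 4^-1 * nsq (fun x => f x + g x).
  rewrite (_ : 4^-1 = 2^-1 ^+ 2) -?nsqZ; [|exact: sqD|by rewrite expr2 -invfM -natrM].
  by apply: eq_nsq => x _; rewrite mulrDr.
by rewrite nsqB// nsqD//; field.
Qed.

Lemma parallelogram_term (f g : R -> R) a b c d : sq f -> sq g ->
  (a - b) ^+ 2 + (c - d) ^+ 2 + nsq (fun x => f x - g x) =
  2 * (a ^+ 2 + c ^+ 2 + nsq f) + 2 * (b ^+ 2 + d ^+ 2 + nsq g) -
  4 * ((2^-1 * a + 2^-1 * b) ^+ 2 + (2^-1 * c + 2^-1 * d) ^+ 2 +
       nsq (fun x => 2^-1 * f x + 2^-1 * g x)).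
Proof. by move=> sf sg; rewrite nsq_parallelogram//; field. Qed.

Lemma sum_comb (A B C E : 'I_3 -> R) :
  (forall i, E i = 2 * A i + 2 * B i - 4 * C i) ->
  \sum_(i < 3) E i = 2 * \sum_(i < 3) A i + 2 * \sum_(i < 3) B i - 4 * \sum_(i < 3) C i.
Proof.
move=> EE; rewrite !mulr_sumr -big_split -sumrB /=.
by apply: eq_bigr => i _; exact: EE.
Qed.

Lemma Qnorm_parallelogram u v : H2 u -> H2 v ->
  Qnorm (u - v) = 2 * Qnorm u + 2 * Qnorm v - 4 * Qnorm (mid u v).
Proof.
move=> /H2_rep ru /H2_rep rv.
rewrite (Qnorm_rep (rep_sub ru rv)) (Qnorm_rep (rep_mid ru rv)) (Qnorm_rep ru) (Qnorm_rep rv).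
apply: sum_comb => i.
have su : sq (entry (D2 u) i) by have [_ []] := ru i.
have sv : sq (entry (D2 v) i) by have [_ []] := rv i.
rewrite (@eq_nsq _ _ (fun x => entry (D2 u) i x - entry (D2 v) i x)); last first.
  by move=> x _; rewrite entry_sub.
rewrite (@eq_nsq _ (entry (mid _ _) i) (fun x => 2^-1 * entry (D2 u) i x + 2^-1 * entry (D2 v) i x)); last first.
  by move=> x _; rewrite entry_mid.
rewrite (entry_sub u v) (entry_sub (D1 u) (D1 v)) (entry_mid u v) (entry_mid (D1 u) (D1 v)).
exact: parallelogram_term.
Qed.

Lemma real_complete (a_ : nat -> R) :
  (forall e, 0 < e -> exists N, forall m n, (N <= m)%N -> (N <= n)%N ->
     (a_ m - a_ n) ^+ 2 <= e) ->
  exists l, (fun n => (a_ n - l) ^+ 2) @ \oo --> (0 : R).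
Proof.
move=> H.
have /cvg_ex[l al] : cvgn a_.
  apply/cauchy_cvgP; apply: cauchy_exP => e e0.
  have [|N HN] := H ((e / 2) ^+ 2); first by rewrite exprn_gt0// divr_gt0.
  exists (a_ N); exists N => // n /= Nn; rewrite /ball /=.
  apply: (@le_lt_trans _ _ (e / 2)); last by lra.
  rewrite -(ler_pXn2r (n := 2))// ?nnegrE ?divr_ge0 ?(ltW e0)//.
  by rewrite real_normK ?num_real// HN.
exists l; have h : (fun n => a_ n - l) @ \oo --> (0 : R).
  by rewrite -(subrr l); apply: cvgB => //; exact: cvg_cst.
have hh := cvgM h h; rewrite mulr0 in hh; exact: hh.
Qed.

(** The limits of the initial values, initial slopes and second derivatives are
    integrated back to a function. *)
Lemma Qnorm_complete (u_ : nat -> V) : (forall n, H2 (u_ n)) ->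
  (forall e, 0 < e -> exists N, forall m n, (N <= m)%N -> (N <= n)%N ->
     Qnorm (u_ m - u_ n) <= e) ->
  exists2 g, H2 g & forall e, 0 < e -> exists N, forall n, (N <= n)%N ->
     Qnorm (u_ n - g) <= e.
Proof.
move=> Hu hu; have ru n := H2_rep (Hu n).
pose q m n i := entry (u_ m - u_ n) i 0 ^+ 2 + entry (D1 (u_ m) - D1 (u_ n)) i 0 ^+ 2
  + nsq (entry (D2 (u_ m) - D2 (u_ n)) i).
have qE m n : Qnorm (u_ m - u_ n) = \sum_(i < 3) q m n i.
  exact: Qnorm_rep (rep_sub (ru m) (ru n)).
have q0 m n i : 0 <= q m n i by rewrite /q !addr_ge0 ?sqr_ge0 ?nsq_ge0.
have qle i e : 0 < e -> exists N, forall m n, (N <= m)%N -> (N <= n)%N -> q m n i <= e.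
  move=> e0; have [N HN] := hu e e0; exists N => m n Nm Nn.
  rewrite (le_trans _ (HN m n Nm Nn))// qE (bigD1 i)//= lerDl.
  exact: sumr_ge0.
have aP i : exists l, (fun n => (entry (u_ n) i 0 - l) ^+ 2) @ \oo --> (0 : R).
  apply: real_complete => e /(qle i)[N HN]; exists N => m n Nm Nn.
  rewrite (le_trans _ (HN m n Nm Nn))// /q entry_sub -addrA lerDl.
  by rewrite addr_ge0 ?sqr_ge0 ?nsq_ge0.
have bP i : exists l, (fun n => (entry (D1 (u_ n)) i 0 - l) ^+ 2) @ \oo --> (0 : R).
  apply: real_complete => e /(qle i)[N HN]; exists N => m n Nm Nn.
  rewrite (le_trans _ (HN m n Nm Nn))// /q [entry (D1 _ - _) _ _]entry_sub addrAC lerDr.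
  by rewrite addr_ge0 ?sqr_ge0 ?nsq_ge0.
have s2 n i : sq (entry (D2 (u_ n)) i) by have [_ []] := ru n i.
have gP i : exists f, sq f /\ nsq (fun x => entry (D2 (u_ n)) i x - f x) @[n --> \oo] --> (0 : R).
  have [|f sf cf] := @sq_complete _ (fun n => entry (D2 (u_ n)) i) (fun n => s2 n i).
    move=> e /(qle i)[N HN]; exists N => m n Nm Nn.
    rewrite (le_trans _ (HN m n Nm Nn))// /q.
    rewrite -(@eq_nsq _ (fun x => entry (D2 (u_ m)) i x - entry (D2 (u_ n)) i x)).
      by rewrite lerDr addr_ge0 ?sqr_ge0.
    by move=> x _; rewrite entry_sub.
  by exists f.
pose a i := sval (cid (aP i)); pose b i := sval (cid (bP i)).
pose g i := sval (cid (gP i)).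
have Ha i := svalP (cid (aP i)); have Hb i := svalP (cid (bP i)).
have Hg i := svalP (cid (gP i)).
pose w2 : V := fun x => \row_i g i x.
pose w1 : V := fun x => \row_i (b i + prim (g i) x).
pose w : V := fun x => \row_i (a i + prim (fun t => b i + prim (g i) t) x).
have w2E i : entry w2 i = g i by apply/funext => x; rewrite /entry mxE.
have w1E i : entry w1 i = fun x => b i + prim (g i) x.
  by apply/funext => x; rewrite /entry mxE.
have wE i : entry w i = fun x => a i + prim (entry w1 i) x.
  by apply/funext => x; rewrite w1E /entry mxE.
have rw : rep w w1 w2.
  move=> i; have p2 : H1pair (entry w1 i) (entry w2 i).
    split; first by rewrite w2E; exact: (Hg i).1.
    by move=> x Dx; rewrite w1E w2E prim_at0 addr0.
  split => //; split; first exact: H1pair_sq p2.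
  by move=> x Dx; rewrite !wE prim_at0 addr0.
exists w; first exact: rep_H2 rw.
have cv : Qnorm (u_ n - w) @[n --> \oo] --> (0 : R).
  have -> : (fun n => Qnorm (u_ n - w)) = (fun n => \sum_(i < 3)
     ((entry (u_ n) i 0 - a i) ^+ 2 + (entry (D1 (u_ n)) i 0 - b i) ^+ 2 +
      nsq (fun x => entry (D2 (u_ n)) i x - g i x))).
    apply/funext => n; rewrite (Qnorm_rep (rep_sub (ru n) rw)).
    apply: eq_bigr => i _; rewrite !entry_sub w1E wE !prim_at0 !addr0; congr (_ + _).
    by apply: eq_nsq => x _; rewrite entry_sub w2E.
  have z : (0 : R) = \sum_(i < 3) (0 + 0 + 0) by rewrite big1// => i _; rewrite !addr0.
  rewrite [X in _ --> X]z; apply: cvg_big => [|i _]; first exact: add_continuous.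
  by apply: cvgD; [apply: cvgD; [exact: Ha|exact: Hb]|exact: (Hg i).2].
move=> e e0; have /cvgrPdist_le/(_ e e0)[N _ HN] := cv; exists N => n Nn.
by have := HN n Nn; rewrite sub0r normrN ger0_norm// Qnorm_ge0.
Qed.

Definition Kq : R := 2 * L + (2 * L ^+ 2 + 1) * (2 * L + 2 * L ^+ 2) + 1.

(** Two applications of the Poincare inequality. *)
Lemma H2norm_le_Qnorm v : H2 v -> H2norm v ^+ 2 <= Kq * Qnorm v.
Proof.
move=> Hv; have r := H2_rep Hv; rewrite H2norm_sqr (Qnorm_rep r).
rewrite !L2normsqE; try by move=> i; have [] := H2_sq i Hv.
rewrite -!big_split mulr_sumr /=; apply: ler_sum => i _.
have [r1 r2] := r i; have p1 := H1pair_poincare r1; have p2 := H1pair_poincare r2.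
have L0 := @len_gt0 R; have n2 := nsq_ge0 (entry (D2 v) i).
set f0 := entry v i 0 ^+ 2 in p1 *; set f1 := entry (D1 v) i 0 ^+ 2 in p2 *.
have f00 : 0 <= f0 by exact: sqr_ge0.
have f10 : 0 <= f1 by exact: sqr_ge0.
move: p1 p2 n2; set N0 := nsq _; set N1 := nsq _; set N2 := nsq _ => p1 p2 n2.
have h : N0 + N1 <= 2 * L * f0 + (2 * L ^+ 2 + 1) * (2 * L * f1 + 2 * L ^+ 2 * N2).
  have L2 : 0 <= 2 * L ^+ 2 + 1 by nra.
  by have := ler_wpM2l L2 p2; lra.
have A0 : 0 <= 2 * L by lra.
have B0 : 0 <= 2 * L ^+ 2 by nra.
pose B := 2 * L ^+ 2.
have -> : Kq * (f0 + f1 + N2) = 2 * L * f0 + (B + 1) * (2 * L * f1 + B * N2) + N2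
  + (2 * L * f1 + (B + 1) * (B * f1) + f1 + ((B + 1) * (2 * L + B) + 1) * f0
     + 2 * L * N2 + (B + 1) * (2 * L * N2)).
  by rewrite /Kq /B; ring.
have B1 : 0 <= B + 1 by rewrite addr_ge0.
rewrite -[leLHS]addr0; apply: lerD; first by rewrite /B; lra.
have t1 := mulr_ge0 A0 f10; have t2 := mulr_ge0 B1 (mulr_ge0 B0 f10).
have t3 := mulr_ge0 (addr_ge0 (mulr_ge0 B1 (addr_ge0 A0 B0)) ler01) f00.
have t4 := mulr_ge0 A0 n2; have t5 := mulr_ge0 B1 (mulr_ge0 A0 n2).
exact: addr_ge0 (addr_ge0 (addr_ge0 (addr_ge0 (addr_ge0 t1 t2) f10) t3) t4) t5.
Qed.

(** A functional bounded for [H2norm] is bounded for [Qnorm], by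
    [H2norm_le_Qnorm]. *)
Lemma weak_compactness_H2 (f : nat -> V) M : (forall n, H2 (f n)) ->
  (forall n, Qnorm (f n) <= M) ->
  exists u (k : nat -> nat), {homo k : m n / (m < n)%N} /\
     weak_cvg_H2 (fun n => f (k n)) u.
Proof.
move=> Hf fM.
have H20 : H2 0.
  have -> : (0 : V) = f 0%N - f 0%N by rewrite subrr.
  exact: rep_H2 (rep_sub (H2_rep (Hf 0%N)) (H2_rep (Hf 0%N))).
have [u [k [Hu hk cF]]] := weak_sequential_compactness H20 (@H2_lin R) Qnorm_ge0
  Qnorm_parallelogram Qnorm_complete Hf fM.
exists u, k; split => //; split => // F [lF [C HC]]; apply: cF => //.
exists (C ^+ 2 * Kq) => v Hv; rewrite -mulrA.
have h := HC v Hv; have n0 := H2norm_ge0 v.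
rewrite -(real_normK (num_real (F v))).
apply: (@le_trans _ _ ((C * H2norm v) ^+ 2)).
  by rewrite lerXn2r ?nnegrE// (le_trans _ h).
by rewrite exprMn ler_wpM2l ?sqr_ge0// H2norm_le_Qnorm.
Qed.

Lemma value_bounded x i : D x ->
  bounded_linear_H2 (fun y : R^o => `|y : R|) (fun v => (v x 0 i : R^o)).
Proof.
move=> Dx; split; first by move=> a u v _ _; exact: entry_lin.
by exists (sobolevC (R:=R)) => v Hv; exact: sobolev_value.
Qed.

Lemma slope_bounded x i : D x ->
  bounded_linear_H2 (fun y : R^o => `|y : R|) (fun v => (D1 v x 0 i : R^o)).
Proof.
move=> Dx; split; first by move=> a u v Hu Hv; exact: D1_lin.
by exists (sobolevC (R:=R)) => v Hv; exact: sobolev_slope.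
Qed.

Lemma dotp_lin a (f g h : R -> R) : sq f -> sq g -> sq h ->
  integ (fun x => (a * f x + g x) * h x) = a * dotp f h + dotp g h.
Proof.
by move=> sf sg sh; rewrite -[LHS]/(dotp _ _) dotpDl ?dotpZl//; exact: sqZ.
Qed.

Lemma dot_D2_bounded w i : sq (entry w i) ->
  bounded_linear_H2 (fun y : R^o => `|y : R|)
    (fun v => (dotp (entry (D2 v) i) (entry w i) : R^o)).
Proof.
move=> sw; split=> [a u v Hu Hv|].
  have [_ _ su] := H2_sq i Hu; have [_ _ sv] := H2_sq i Hv.
  have [_ _ suv] := H2_sq i (H2_lin a Hu Hv).
  have sl : sq (fun x => a * entry (D2 u) i x + entry (D2 v) i x).
    by apply: sqD => //; exact: sqZ.
  exact: etrans (integ_mul_nsq0 suv sl sw (D2_lin a i Hu Hv)) (dotp_lin a su sv sw).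
exists (Num.sqrt (nsq (entry w i))) => v Hv; have [_ _ sv] := H2_sq i Hv.
rewrite -(ler_pXn2r (n := 2))// ?nnegrE ?mulr_ge0 ?sqrtr_ge0//.
rewrite real_normK ?num_real// exprMn sqr_sqrtr ?nsq_ge0// mulrC.
apply: (le_trans (dotp_CS sv sw)); rewrite ler_wpM2r ?nsq_ge0// H2norm_sqr.
apply: (le_trans (y := L2normsq (D2 v))); last by rewrite lerDr addr_ge0 ?L2normsq_ge0.
by apply: nsq_le_L2normsq => j; have [] := H2_sq j Hv.
Qed.

Lemma dotp_le_mean (f g : R -> R) : sq f -> sq g ->
  dotp f g <= (nsq f + nsq g) / 2.
Proof.
by move=> sf sg; have := nsq_ge0 (fun x => f x - g x); rewrite nsqB//; lra.
Qed.

(** Weak lower semicontinuity: test the weak convergence against u'' itself. *)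
Lemma bend_lsc (v_ : nat -> V) v B : weak_cvg_H2 v_ v ->
  (\forall n \near \oo, bend (v_ n) <= B) -> bend v <= B.
Proof.
move=> [Hv_ Hv cF] hB.
have s2 u (Hu : H2 u) i : sq (entry (D2 u) i) by have [] := H2_sq i Hu.
pose F u : R := \sum_(i < 3) dotp (entry (D2 u) i) (entry (D2 v) i).
have cvF : F (v_ n) @[n --> \oo] --> F v.
  apply: cvg_big => [|i _]; first exact: add_continuous.
  apply: (cF (fun u => dotp (entry (D2 u) i) (entry (D2 v) i))).
  exact: dot_D2_bounded (s2 v Hv i).
have FvE : F v = bend v.
  by rewrite (bend_sum Hv); apply: eq_bigr => i _; rewrite nsqE.
have FN w : H2 w -> F w <= (bend v + bend w) / 2.
  move=> Hw; rewrite (bend_sum Hw) (bend_sum Hv) -big_split mulr_suml /=.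
  apply: ler_sum => i _.
  by rewrite addrC; exact: dotp_le_mean (s2 w Hw i) (s2 v Hv i).
have : F v <= (bend v + B) / 2.
  rewrite -(cvg_lim _ cvF)//; apply: limr_le; first by apply/cvg_ex; exists (F v).
  near=> n; apply: (le_trans (FN _ (Hv_ n))).
  by rewrite ler_wpM2r ?invr_ge0// lerD2l; near: n; exact: hB.
by rewrite FvE; lra.
Unshelve. all: by end_near. Qed.

End HilbertH2.

(** * Partitions *)

Section Mesh.
Context {R : realType}.
Local Notation D := (@dom R).
Local Notation L := (len R).
Implicit Types (f g h : R -> R) (a b c x y t : R) (s : seq R).

Variable s : seq R.
Hypothesis hs : itv_partition 0 L s.
Local Notation z := (node s).

Lemma node0 : z 0 = 0. Proof. by []. Qed.

Lemma node_last : z (size s) = L.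
Proof.
have [_ /eqP <-] := hs.
by rewrite /node (last_nth L).
Qed.

Lemma node_lt j : (j < size s)%N -> z j < z j.+1.
Proof. by move=> js; have [/(pathP L) p _] := hs; exact: p. Qed.

Lemma node_le i j : (i <= j)%N -> (j <= size s)%N -> z i <= z j.
Proof.
elim: j => [|j IH]; first by rewrite leqn0 => /eqP ->.
rewrite leq_eqVlt => /orP[/eqP->//|]; rewrite ltnS => ij js.
by rewrite (le_trans (IH ij (ltnW js)))// ltW// node_lt.
Qed.

Lemma node_dom j : (j <= size s)%N -> D (z j).
Proof.
by move=> js; rewrite domE -{1}node0 node_le//= -node_last node_le.
Qed.

Lemma size_partition_gt0 : (0 < size s)%N.
Proof.
rewrite lt0n; apply/eqP => s0; have := node_last.
by rewrite s0 node0 => L0; have := @len_gt0 R; rewrite -L0 ltxx.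
Qed.

Lemma locate_prefix x j : (j <= size s)%N -> 0 <= x -> x <= z j -> 0 < x ->
  exists2 k, (k < j)%N & z k < x <= z k.+1.
Proof.
elim: j => [|j IH] js x0 xj xp; first by move: xj; rewrite node0 leNgt xp.
have [xz|xz] := leP x (z j).
  by have [k kj H] := IH (ltnW js) x0 xz xp; exists k => //; exact: ltnW.
by exists j => //; rewrite xz.
Qed.

Lemma locate x : D x -> exists2 j, (j < size s)%N & z j <= x <= z j.+1.
Proof.
rewrite domE => /andP[x0 xL]; move: (x0); rewrite le_eqVlt => /orP[/eqP <-|xp].
  exists 0%N; first exact: size_partition_gt0.
  by rewrite node0 lexx (node_le (i := 0)) ?size_partition_gt0.
have [|k ks /andP[h1 h2]] := @locate_prefix x (size s) (leqnn _) x0 _ xp.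
  by rewrite node_last.
by exists k => //; rewrite (ltW h1).
Qed.

Lemma mesh_ge j : (j < size s)%N -> z j.+1 - z j <= mesh_size s.
Proof.
move=> js; rewrite -[leLHS]ger0_norm; last by rewrite subr_ge0 ltW// node_lt.
exact: (@le_bigmax _ _ _ 0 (fun j : 'I_(size s) => `|z j.+1 - z j|) (Ordinal js)).
Qed.

Lemma mesh_ge0 : 0 <= mesh_size s.
Proof. by apply: le_trans (mesh_ge size_partition_gt0); rewrite subr_ge0 ltW// node_lt// size_partition_gt0. Qed.

Lemma near_node x : D x -> exists2 j, (j <= size s)%N & `|x - z j| <= mesh_size s.
Proof.
move=> /locate[j js /andP[h1 h2]]; exists j; first exact: ltnW.
by rewrite ger0_norm ?subr_ge0//; have := mesh_ge js; lra.
Qed.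

(** Half-open elements, whose indicators add up to that of ]0, L]. *)
Definition piece (j : nat) := chi (z j) (z j.+1).

Lemma piece_eq j k t : (j < size s)%N -> (k < size s)%N -> z j < t <= z j.+1 ->
  piece k t = (k == j)%:R.
Proof.
move=> js ks /andP[h1 h2]; rewrite /piece /chi.
have [->|kj] := eqVneq k j; first by rewrite h1 h2.
case: (ltngtP k j) kj => // kj _.
  have : z k.+1 <= z j by exact: (node_le kj (ltnW js)).
  move=> h3; rewrite andbC; have -> // : (t <= z k.+1) = false.
  by apply/negbTE; rewrite -ltNge (le_lt_trans h3).
have : z j.+1 <= z k by exact: (node_le kj (ltnW ks)).
move=> h3; have -> // : (z k < t) = false.
by apply/negbTE; rewrite -leNgt (le_trans h2).
Qed.

Lemma sum_piece_chi n t : (n <= size s)%N -> \sum_(k < n) piece k t = chi 0 (z n) t.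
Proof.
elim: n => [|n IH] ns; first by rewrite big_ord0 /chi node0 lt_le_asym.
rewrite big_ord_recr /= IH; last exact: ltnW.
rewrite (@chi_chasles _ (z n) (z n.+1))//; last by rewrite node_le.
by have := node_dom (ltnW ns); rewrite domE => /andP[].
Qed.

Definition piecewise (F : nat -> R -> R) t := \sum_(k < size s) F k t * piece k t.

Lemma piecewise_eq F j t : (j < size s)%N -> z j < t <= z j.+1 -> piecewise F t = F j t.
Proof.
move=> js h; rewrite /piecewise (bigD1 (Ordinal js))//= (piece_eq js js h) eqxx mulr1.
rewrite big1 ?addr0// => k kj; rewrite (piece_eq js (ltn_ord k) h).
by rewrite -val_eqE /= in kj; rewrite (negbTE kj) mulr0.
Qed.

Lemma sq_piecewise F : (forall k, (k < size s)%N -> sq (F k)) -> sq (piecewise F).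
Proof.
by move=> sF; apply: (sq_sum (F := fun k : 'I_(size s) => fun t => F k t * piece k t)) => k;
  apply: sq_mul_chi; exact: sF.
Qed.

Lemma piecewise_chi F j x t : (j < size s)%N -> z j <= x <= z j.+1 ->
  piecewise F t * chi (z j) x t = F j t * chi (z j) x t.
Proof.
move=> js /andP[h1 h2]; rewrite /chi; have [/andP[t1 t2]|_] := boolP (z j < t <= x)%R.
  by rewrite (piecewise_eq F js)// t1 (le_trans t2).
by rewrite !mulr0.
Qed.

Lemma integ_pieces f : ig f ->
  integ f = \sum_(k < size s) integ (fun t => f t * piece k t).
Proof.
move=> igf; rewrite -integ_sum => [|k]; last exact: ig_chi.
rewrite -prim_len// /prim -{1}node_last; apply: eq_integ => t _.
by rewrite -mulr_sumr sum_piece_chi.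
Qed.

Lemma integ_piece_le f g k : (k < size s)%N -> ig f -> ig g ->
  (forall t, D t -> z k < t <= z k.+1 -> f t <= g t) ->
  integ (fun t => f t * piece k t) <= integ (fun t => g t * piece k t).
Proof.
move=> ks igf igg fg; apply: integ_le; [exact: ig_chi..|].
move=> t Dt; rewrite /piece /chi; have [h|_] := boolP (z k < t <= z k.+1)%R.
  by rewrite !mulr1 fg.
by rewrite !mulr0.
Qed.

Lemma poly_continuous (p : {poly R}) : continuous (horner p).
Proof.
move=> x; apply: differentiable_continuous; apply/derivable1_diffP.
by have [] := is_derive_poly p x.
Qed.

Lemma poly_FTC (p : {poly R}) a b : 0 <= a -> a <= b -> b <= L ->
  integ (fun t => p^`().[t] * chi a b t) = p.[b] - p.[a].
Proof.
move=> a0 ab bL; have cp := @poly_continuous p; have cp' := @poly_continuous p^`().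
have cD (q : {poly R}) : continuous (horner q) -> {within D, continuous (horner q)}.
  by move=> cq; exact: continuous_subspaceT.
have F x : D x -> p.[x] = p.[0] + prim (horner p^`()) x.
  by apply: (prim_FTC (cD _ cp') (cD _ cp)) => y _; exact: is_derive_poly.
rewrite -prim_sub//; last by apply: sq_ig; apply: continuous_sq; exact: cD.
rewrite (F b) ?(F a) ?domE ?a0 ?bL ?(le_trans ab) ?(le_trans a0)//.
by ring.
Qed.

Lemma poly_antiderivative n (p : {poly R}) : (size p <= n)%N ->
  exists2 q : {poly R}, (size q <= n.+1)%N & q^`() = p.
Proof.
move=> pn; exists (\poly_(i < n.+1) (p`_i.-1 / i%:R)); first exact: size_poly.
apply/polyP => i; rewrite coef_deriv coef_poly ltnS /=.
case: ltnP => [_|ni]; first by rewrite -(mulr_natr (_ / _)) divfK// pnatr_eq0.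
by rewrite mul0rn nth_default// (leq_trans pn).
Qed.

(** Applied twice to the affine pieces of the second derivative of the Hermite
    interpolant, it shows that the interpolant is cubic on each element. *)
Lemma primitive_poly F f a b n : 0 <= a -> a <= b -> b <= L ->
  (forall x, a <= x <= b -> F x - F a = integ (fun t => f t * chi a x t)) ->
  (exists2 p : {poly R}, (size p <= n)%N & forall t, a < t <= b -> f t = p.[t]) ->
  exists2 q : {poly R}, (size q <= n.+1)%N & forall x, a <= x <= b -> F x = q.[x].
Proof.
move=> a0 ab bL FE [p pn fp]; have [q qn qp] := poly_antiderivative pn.
exists (q + (F a - q.[a])%:P).
  rewrite (leq_trans (size_polyD _ _))// geq_max qn /=.
  by rewrite (leq_trans (size_polyC_leq1 _)).
move=> x /[dup] axb /andP[ax xb].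
have : F x - F a = q.[x] - q.[a].
  rewrite FE// -poly_FTC// ?(le_trans xb)// qp; apply: eq_integ => t _.
  rewrite /chi; have [/andP[t1 t2]|_] := boolP (a < t <= x)%R; last by rewrite !mulr0.
  by rewrite fp// t1 (le_trans t2).
rewrite hornerD hornerC; lra.
Qed.

End Mesh.

(** * Finite element functions belong to H^2 *)

Section FiniteElements.
Context {R : realType}.
Local Notation D := (@dom R).
Local Notation L := (len R).
Local Notation V := (R -> 'rV[R]_3).
Implicit Types (f g h : R -> R) (a b c x y t : R) (s : seq R) (i : 'I_3).

Lemma is_derive_entry (v : V) x (d : 'rV[R]_3) i :
  is_derive x 1 v d -> is_derive x 1 (entry v i) (d 0 i).
Proof.
move=> [dv ve]; apply: DeriveDef; first exact: (derivable_mxP _ _ _).1 dv 0 i.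
by rewrite -ve derive_mx// mxE.
Qed.

Lemma is_derive_vector (v : V) x (d : 'rV[R]_3) :
  (forall i, is_derive x 1 (entry v i) (d 0 i)) -> is_derive x 1 v d.
Proof.
move=> dv; have der : derivable v x 1.
  by apply/derivable_mxP => j i; rewrite ord1; have [] := dv i.
apply: DeriveDef => //; rewrite derive_mx//; apply/matrixP => j i.
by rewrite mxE ord1; have [_ <-] := dv i.
Qed.

Lemma near_interior x (P : R -> Prop) a b : a < x < b ->
  (forall y, a < y < b -> P y) -> \near x, P x.
Proof.
move=> axb H; have : x \in `]a, b[ by rewrite in_itv.
by move=> /near_in_itvoo; apply: filterS => y; rewrite in_itv /=; exact: H.
Qed.

(** Derivatives are unique at interior points, and both sides are continuous up to
    the end points. *)
Lemma deriv_on_element f f1 (p : {poly R}) a b : 0 <= a -> a < b -> b <= L ->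
  {within D, continuous f1} ->
  (forall x, 0 < x < L -> is_derive x 1 f (f1 x)) ->
  (forall x, a <= x <= b -> f x = p.[x]) ->
  forall x, a <= x <= b -> f1 x = p^`().[x].
Proof.
move=> a0 ab bL cf1 df fp.
have inner x : a < x < b -> f1 x = p^`().[x].
  move=> /[dup] axb /andP[ax xb].
  have d1 : is_derive x 1 f (f1 x).
    by apply: df; rewrite (le_lt_trans a0 ax) (lt_le_trans xb bL).
  have d2 : is_derive x 1 (horner p) (f1 x).
    apply: near_eq_is_derive d1; apply: (near_interior axb) => y /andP[ay yb].
    by rewrite fp// !ltW.
  have [_ <-] := d2; have [_ <-] := is_derive_poly p x; by [].
move=> x axb; apply/eqP; rewrite -subr_eq0 -normr_le0; apply/ler_addgt0Pl => e e0.
rewrite addr0.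
have cg : {within D, continuous (fun x => f1 x - p^`().[x])}.
  move=> y; apply: cvgB; first exact: cf1.
  by apply: (@continuous_subspaceT _ _ _ (horner p^`())); exact: poly_continuous.
have Dx : D x by move: axb => /andP[? ?]; rewrite domE (le_trans a0)//= (le_trans _ bL).
have /dom_within_continuousP/(_ x Dx e e0)[d d0 hd] := cg.
have [y [/[dup] yab /andP[ay yb] xy]] : exists y, a < y < b /\ `|x - y| < d.
  pose m := (a + b) / 2; move: axb => /andP[ax xb].
  pose r := Num.min (1 / 2) (d / (2 * (b - a))).
  have ba : 0 < b - a by rewrite subr_gt0.
  have r0 : 0 < r by rewrite /r lt_min !divr_gt0// mulr_gt0.
  have r1 : r <= 1 / 2 by rewrite /r ge_min lexx.
  have rd : r * (2 * (b - a)) <= d.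
    by rewrite -ler_pdivlMr ?mulr_gt0// /r ge_min lexx orbT.
  exists (x + r * (m - x)); split.
    by rewrite /m; apply/andP; split; nra.
  rewrite opprD addrA subrr add0r normrN normrM gtr0_norm//.
  have : `|m - x| <= b - a by rewrite ler_norml /m; apply/andP; split; lra.
  move=> h; have := ler_wpM2l (ltW r0) h; nra.
have Dy : D y by rewrite domE (le_trans a0 (ltW ay)) (le_trans (ltW yb) bL).
by have := hd y Dy xy; rewrite (inner y yab) subrr subr0 => /ltW.
Qed.

(** The second derivative is taken elementwise. No Dirac mass arises at the nodes
    because the first derivative is continuous there: the increments of v1 over
    the elements add up to the primitive of v2. *)
Lemma Vh_rep s v : itv_partition 0 L s -> Vh s v -> exists v1 v2, rep v v1 v2.
Proof.
move=> hs [[cv [v1 [cv1 dv]]] pv].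
have pP j i : exists p : {poly R}, (j < size s)%N ->
    forall x, node s j <= x <= node s j.+1 -> entry v i x = p.[x].
  have [js|js] := ltnP j (size s); last by exists 0.
  have [p _ H] := pv (Ordinal js) i; exists p => _ x hx; apply: H.
  by rewrite in_itv.
pose p j i := sval (cid (pP j i)); have hp j i := svalP (cid (pP j i)).
pose v2 : V := fun t => \row_i piecewise s (fun j t => (p j i)^`()^`().[t]) t.
exists v1, v2 => i.
have dvi x : 0 < x < L -> is_derive x 1 (entry v i) (entry v1 i x).
  by move=> xL; apply: is_derive_entry; apply: dv; rewrite in_itv.
have cvi : {within D, continuous (entry v i)} by exact: ((within_entryP v).1 cv i).
have cv1i : {within D, continuous (entry v1 i)} by exact: ((within_entryP v1).1 cv1 i).
split.
  by split; [exact: continuous_sq|exact: prim_FTC].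
have v2E : entry v2 i = piecewise s (fun j t => (p j i)^`()^`().[t]).
  by apply/funext => t; rewrite /entry mxE.
have spoly (q : {poly R}) : sq (horner q).
  by apply: continuous_sq; apply: continuous_subspaceT; exact: poly_continuous.
have s2 : sq (entry v2 i) by rewrite v2E; apply: sq_piecewise => k _; exact: spoly.
split => //; rewrite v2E; rewrite v2E in s2.
have elt j x : (j < size s)%N -> node s j <= x <= node s j.+1 ->
    entry v1 i x - entry v1 i (node s j) = prim (entry v2 i) x - prim (entry v2 i) (node s j).
  move=> js /[dup] jx /andP[h1 h2]; rewrite v2E.
  have /andP[z0 zL] : 0 <= node s j <= L.
    by rewrite -domE; apply: (node_dom hs); exact: ltnW.
  have /andP[z0' zL'] : 0 <= node s j.+1 <= L by rewrite -domE; apply: (node_dom hs).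
  rewrite (prim_sub (sq_ig s2) z0 h1).
  rewrite (@eq_integ _ _ (fun t => (p j i)^`()^`().[t] * chi (node s j) x t)); last first.
    by move=> t _; apply: (piecewise_chi hs).
  rewrite poly_FTC//; last exact: le_trans zL'.
  have D1E y : node s j <= y <= node s j.+1 -> entry v1 i y = (p j i)^`().[y].
    apply: (@deriv_on_element (entry v i)) => //; first exact: (node_lt hs).
    exact: hp.
  by rewrite !D1E// lexx (ltW (node_lt hs js)).
have nodes j : (j <= size s)%N -> entry v1 i (node s j) = entry v1 i 0 + prim (entry v2 i) (node s j).
  elim: j => [|j IH] js; first by rewrite node0 prim_at0 addr0.
  have := elt j (node s j.+1) js; rewrite lexx (ltW (node_lt hs js)) => /(_ isT).
  have := IH (ltnW js); lra.
move=> x Dx; have [j js jx] := locate hs Dx.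
have := elt j x js jx; have := nodes j (ltnW js); rewrite v2E; lra.
Qed.

End FiniteElements.

(** * Elementwise projection onto affine functions *)

Section AffineProjection.
Context {R : realType}.
Local Notation D := (@dom R).
Local Notation L := (len R).
Local Notation V := (R -> 'rV[R]_3).
Implicit Types (f g h : R -> R) (a b c x y t : R) (s : seq R) (i : 'I_3).

Lemma sq_mul_id f c : sq f -> sq (fun t => f t * (c - t)).
Proof.
move=> sf; apply: (@sqMb _ _ _ (`|c| + L)) => // [|x].
  apply: continuous_meas; apply: continuous_subspaceT => x.
  by apply: cvgB; [exact: cvg_cst|exact: cvg_id].
rewrite domE => /andP[x0 xL]; rewrite (le_trans (ler_normB _ _))// lerD2l.
by rewrite ger0_norm.
Qed.

(** The weight y - t is at most b - a in absolute value, on an interval of length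
    b - a. *)
Lemma second_order_remainder f a b y : sq f -> 0 <= a -> a <= b -> b <= L -> a <= y <= b ->
  integ (fun t => f t * (y - t) * chi a b t) ^+ 2 <= nsq f * (b - a) ^+ 3.
Proof.
move=> sf a0 ab bL /andP[ay yb].
have sw : sq (fun t => (y - t) * chi a b t).
  apply: sq_mul_chi; apply: continuous_sq; apply: continuous_subspaceT => x.
  by apply: cvgB; [exact: cvg_cst|exact: cvg_id].
rewrite (@eq_integ _ _ (fun t => f t * ((y - t) * chi a b t))); last first.
  by move=> t _; rewrite mulrA.
apply: (le_trans (dotp_CS sf sw)); rewrite ler_wpM2l ?nsq_ge0//.
rewrite (_ : (b - a) ^+ 3 = (b - a) ^+ 2 * (b - a)); last by ring.
rewrite -[X in _ <= _ * X](integ_chi a0 ab bL) -integZ; last by apply: sq_ig; exact: sq_chi.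
apply: integ_le; first by case: sw.
  by apply: igZ; apply: sq_ig; exact: sq_chi.
move=> t _; rewrite exprMn chi_sqr /chi.
have [/andP[at_ tb]|_] := boolP (a < t <= b)%R; last by rewrite !mulr0.
by rewrite !mulr1; nra.
Qed.

(** Cauchy's formula for repeated integration: both sides have derivative
    [prim f], with the increments estimated by [second_order_remainder], since f
    need not be continuous. *)
Lemma prim_prim f x : sq f -> D x ->
  prim (prim f) x = x * prim f x - prim (fun t => f t * t) x.
Proof.
move=> sf Dx; pose Phi y := y * prim f y - prim (fun t => f t * t) y.
have sft : sq (fun t => f t * t).
  have := sqN (sq_mul_id 0 sf); apply: eq_sq => t _; ring.
have igf := sq_ig sf; have igft := sq_ig sft.
have cp := prim_continuous sf.
have cPhi : {within D, continuous Phi}.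
  move=> y; apply: cvgB; last exact: prim_continuous.
  apply: cvgM; last exact: cp.
  by apply: (@continuous_subspaceT _ _ _ (@id R)) => u; exact: cvg_id.
have rem a b y : 0 <= a -> a <= b -> b <= L ->
    y * (prim f b - prim f a) - (prim (fun t => f t * t) b - prim (fun t => f t * t) a) =
    integ (fun t => f t * (y - t) * chi a b t).
  move=> a0 ab bL; rewrite !prim_sub// -integZ; last exact: ig_chi.
  rewrite -integB; last 2 first.
  - by apply: igZ; exact: ig_chi.
  - exact: ig_chi.
  by apply: eq_integ => t _; ring.
have dPhi y : 0 < y < L -> is_derive y 1 Phi (prim f y).
  move=> /andP[y0 yL]; pose r := Num.min y (L - y).
  apply: (is_derive_of_error (C := nsq f) (r := r)).
    by rewrite /r lt_min y0 subr_gt0.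
  move=> k; rewrite /r lt_min => /andP[ky kL].
  have ylow : 0 <= y + k by have := ler_norm (- k); rewrite normrN; lra.
  have yhigh : y + k <= L by have := ler_norm k; lra.
  have -> : Phi (y + k) - Phi y - k * prim f y =
     (y + k) * (prim f (y + k) - prim f y) -
     (prim (fun t => f t * t) (y + k) - prim (fun t => f t * t) y).
    by rewrite /Phi; ring.
  have [k0|k0] := leP 0 k.
    rewrite rem ?lerDl// ?(ltW y0)//.
    have yk : y <= y + k by rewrite lerDl.
    have := @second_order_remainder f y (y + k) (y + k) sf (ltW y0) yk yhigh.
    rewrite lexx yk => /(_ isT).
    by rewrite addrAC subrr add0r ger0_norm.
  have yk : y + k <= y by rewrite gerDl ltW.
  have := @second_order_remainder f (y + k) y (y + k) sf ylow yk (ltW yL).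
  rewrite lexx yk => /(_ isT); rewrite -rem ?(ltW yL)//.
  rewrite (_ : y - (y + k) = - k); last by ring.
  rewrite ltr0_norm// => h.
  apply: le_trans h; rewrite -sqrrN le_eqVlt; apply/orP; left; apply/eqP; congr (_ ^+ 2).
  by ring.
have := prim_FTC cp cPhi dPhi Dx.
by rewrite /Phi mul0r prim_at0 subr0 add0r => ->.
Qed.

Lemma nsq_triangle0 f g h : sq f -> sq g -> sq h -> nsq (fun x => g x - h x) = 0 ->
  nsq (fun x => f x - h x) <= 2 * nsq (fun x => f x - g x).
Proof.
move=> sf sg sh gh; have := nsqD_le (sqB sf sg) (sqB sg sh).
rewrite gh mulr0 addr0; apply: le_trans.
by rewrite le_eqVlt; apply/orP; left; apply/eqP/eq_nsq => x _; rewrite subrKA.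
Qed.

Lemma poly_sq (p : {poly R}) : sq (horner p).
Proof.
by apply: continuous_sq; apply: continuous_subspaceT; exact: poly_continuous.
Qed.

Lemma moment m n a b : 0 <= a -> a <= b -> b <= L ->
  integ (fun t => (t - m) ^+ n * chi a b t) =
  ((b - m) ^+ n.+1 - (a - m) ^+ n.+1) / n.+1%:R.
Proof.
move=> a0 ab bL; pose p : {poly R} := n.+1%:R^-1 *: ('X - m%:P) ^+ n.+1.
have pE t : p^`().[t] = (t - m) ^+ n.
  rewrite /p derivZ deriv_exp derivXsubC mul1r /= hornerZ hornerMn horner_exp hornerXsubC.
  by rewrite -(mulr_natr ((t - m) ^+ n)) mulrCA mulVf ?mulr1// pnatr_eq0.
rewrite (@eq_integ _ _ (fun t => p^`().[t] * chi a b t)); last by move=> t _; rewrite pE.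
by rewrite poly_FTC// /p !hornerZ !horner_exp !hornerXsubC; ring.
Qed.

Section Projection.
Variable s : seq R.
Hypothesis hs : itv_partition 0 L s.
Variable f : R -> R.
Hypothesis sf : sq f.
Local Notation z := (node s).

Definition elt_center k := (z k + z k.+1) / 2.
Definition elt_width k := z k.+1 - z k.

(** The L^2 projection of f onto the affine functions on the k-th element, in the
    orthogonal basis 1, t - [elt_center k], of squared norms w and w^3 / 12 with
    w = [elt_width k]. *)
Definition affine_part k t :=
  integ (fun t => f t * piece s k t) / elt_width k +
  12 / elt_width k ^+ 3 * integ (fun t => f t * (t - elt_center k) * piece s k t) * (t - elt_center k).

Definition l2proj := piecewise s affine_part.
Definition residual t := f t - l2proj t.

Lemma elt_width_gt0 k : (k < size s)%N -> 0 < elt_width k.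
Proof. by move=> ks; rewrite subr_gt0; exact: (node_lt hs). Qed.

Lemma node_bounds k : (k < size s)%N -> [/\ 0 <= z k, z k <= z k.+1 & z k.+1 <= L].
Proof.
move=> ks; split.
- by have := node_dom hs (ltnW ks); rewrite domE => /andP[].
- exact/ltW/(node_lt hs).
- by have := node_dom hs ks; rewrite domE => /andP[].
Qed.

Lemma affine_sq c0 c1 m : sq (fun t => c0 + c1 * (t - m)).
Proof.
have := poly_sq (c0%:P + c1%:P * ('X - m%:P)); apply: eq_sq => t _.
by rewrite hornerD hornerM !hornerC hornerXsubC.
Qed.

Lemma l2proj_sq : sq l2proj.
Proof. by apply: sq_piecewise => k _; exact: affine_sq. Qed.

Lemma residual_sq : sq residual.
Proof. exact: sqB sf l2proj_sq. Qed.

Lemma l2proj_piece k t : (k < size s)%N -> l2proj t * piece s k t = affine_part k t * piece s k t.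
Proof.
move=> ks; apply: (piecewise_chi hs _ _ ks); rewrite lexx andbT.
by have [_ ->] := node_bounds ks.
Qed.

Lemma residual_orthogonal k c0 c1 : (k < size s)%N ->
  integ (fun t => residual t * (c0 + c1 * (t - elt_center k)) * piece s k t) = 0.
Proof.
move=> ks; have [z0 zz zL] := node_bounds ks; have w0 := elt_width_gt0 ks.
have wn : elt_width k != 0 by rewrite gt_eqF.
pose m := elt_center k.
pose A := integ (fun t => f t * piece s k t).
pose B := integ (fun t => f t * (t - m) * piece s k t).
have sfm : sq (fun t => f t * (t - m)).
  by have := sqN (sq_mul_id m sf); apply: eq_sq => t _; ring.
have i1 := ig_chi (z k) (z k.+1) (sq_ig sf).
have i2 := ig_chi (z k) (z k.+1) (sq_ig sfm).
have ip n : ig (fun t => (t - m) ^+ n * chi (z k) (z k.+1) t).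
  apply: ig_chi; apply: sq_ig; have := poly_sq (('X - m%:P) ^+ n).
  by apply: eq_sq => t _; rewrite horner_exp hornerXsubC.
pose a0 := A / elt_width k; pose b0 := 12 / elt_width k ^+ 3 * B.
rewrite (@eq_integ _ _ (fun t => c0 * (f t * piece s k t) + c1 * (f t * (t - m) * piece s k t)
   - ((a0 * c0) * ((t - m) ^+ 0 * piece s k t)
     + (a0 * c1 + b0 * c0) * ((t - m) ^+ 1 * piece s k t)
     + b0 * c1 * ((t - m) ^+ 2 * piece s k t)))); last first.
  move=> t _; rewrite /residual !mulrBl -![l2proj t * _ * _]mulrA [_ * piece s k t]mulrC.
  rewrite [l2proj t * _]mulrA l2proj_piece// /affine_part -/m -/A -/B -/a0 -/b0.
  by ring.
rewrite integB; last 2 first.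
- by apply: igD; exact: igZ.
- by do 2?apply: igD; apply: igZ; exact: ip.
rewrite integD; [|exact: igZ..].
rewrite integD; [|by apply: igD; apply: igZ; exact: ip|by apply: igZ; exact: ip].
rewrite integD; [|by apply: igZ; exact: ip..].
rewrite !integZ//; try exact: ip; try by apply: sq_ig; exact: sq_chi.
rewrite /piece !moment// integ_chi// -/A -/B /a0 /b0 -[z k.+1 - z k]/(elt_width k).
have -> : z k.+1 - m = elt_width k / 2 by rewrite /m /elt_center /elt_width; field.
have -> : z k - m = - (elt_width k / 2) by rewrite /m /elt_center /elt_width; field.
by field.
Qed.

Lemma residual_piece0 k : (k < size s)%N -> integ (fun t => residual t * piece s k t) = 0.
Proof.
move=> ks; rewrite -[RHS](residual_orthogonal 1 0 ks); apply: eq_integ => t _; ring.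
Qed.

Lemma residual_piece1 k : (k < size s)%N -> integ (fun t => residual t * t * piece s k t) = 0.
Proof.
move=> ks; rewrite -[RHS](residual_orthogonal (elt_center k) 1 ks); apply: eq_integ => t _; ring.
Qed.

Lemma prim_node g n : ig g -> (n <= size s)%N ->
  prim g (z n) = \sum_(k < n) integ (fun t => g t * piece s k t).
Proof.
move=> igg ns; rewrite -integ_sum => [|k]; last exact: ig_chi.
by apply: eq_integ => t _; rewrite -mulr_sumr (sum_piece_chi hs).
Qed.

(** The integral of the residual over each element vanishes. *)
Lemma prim_residual_node n : (n <= size s)%N -> prim residual (z n) = 0.
Proof.
move=> ns; rewrite prim_node//; last by apply: sq_ig; exact: residual_sq.
by rewrite big1// => k _; apply: residual_piece0; exact: leq_trans (ltn_ord k) ns.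
Qed.

(** By Cauchy's formula, since the first moment of the residual on each element
    vanishes as well. *)
Lemma prim_prim_residual_node n : (n <= size s)%N -> prim (prim residual) (z n) = 0.
Proof.
move=> ns; have sr := residual_sq.
rewrite prim_prim//; last exact: (node_dom hs).
rewrite prim_residual_node// mulr0 sub0r prim_node//; last first.
  apply: sq_ig; have := sqN (sq_mul_id 0 sr); apply: eq_sq => t _; ring.
rewrite big1 ?oppr0// => k _.
by apply: residual_piece1; exact: leq_trans (ltn_ord k) ns.
Qed.

Lemma residual_pythagoras k c : (k < size s)%N ->
  integ (fun t => (f t - c) ^+ 2 * piece s k t) =
  integ (fun t => residual t ^+ 2 * piece s k t) +
  integ (fun t => (l2proj t - c) ^+ 2 * piece s k t).
Proof.
move=> ks; have sr := residual_sq; have sp := l2proj_sq.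
have spc : sq (fun t => l2proj t - c) by apply: sqB => //; exact: sq_cst.
have [_ r2] := sr; have [_ p2] := spc.
have [c0 [c1 hc]] : exists c0 c1, forall t,
    (l2proj t - c) * piece s k t = (c0 + c1 * (t - elt_center k)) * piece s k t.
  eexists; eexists => t; rewrite mulrBl l2proj_piece// /affine_part -mulrBl addrAC.
  by [].
have orth : integ (fun t => residual t * (l2proj t - c) * piece s k t) = 0.
  rewrite -[RHS](residual_orthogonal c0 c1 ks); apply: eq_integ => t _.
  by rewrite -mulrA hc mulrA.
have igrp : ig (fun t => residual t * (l2proj t - c) * piece s k t).
  by apply: ig_chi; exact: sq_mul.
rewrite -integD; [|exact: ig_chi..].
rewrite -[LHS]subr0 -[X in _ - X](mulr0 2) -[X in _ - 2 * X]orth -integZ//.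
rewrite -integB; last 2 first.
- apply: ig_chi; have [_] : sq (fun t => f t - c) by apply: sqB => //; exact: sq_cst.
  by [].
- exact: igZ.
by apply: eq_integ => t _; rewrite /residual; ring.
Qed.

Lemma nsq_pythagoras : nsq f = nsq residual + nsq l2proj.
Proof.
have sr := residual_sq; have sp := l2proj_sq.
rewrite /nsq !(integ_pieces hs); [|by case: sp|by case: sr|by case: sf].
rewrite -big_split; apply: eq_bigr => k _ /=.
have := residual_pythagoras 0 (ltn_ord k).
have sub0 g : integ (fun t => (g t - 0) ^+ 2 * piece s k t) =
    integ (fun t => g t ^+ 2 * piece s k t).
  by apply: eq_integ => t _; rewrite subr0.
by rewrite !sub0.
Qed.

(** On each element the projection is at least as close to f as the constant
    w(z_k), which differs from w by the modulus of continuity of w at the mesh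
    size. *)
Lemma residual_error (w : R -> R) M : sq w -> 0 <= M ->
  (forall x y, D x -> D y -> (w x - w y) ^+ 2 <= M * `|x - y|) ->
  nsq residual <= 2 * nsq (fun t => f t - w t) + 2 * M * mesh_size s * L.
Proof.
move=> sw M0 hw; have [_ r2] := residual_sq.
have [_ d2] := sqB sf sw.
have igE : ig (fun t => 2 * (f t - w t) ^+ 2 + cst (2 * M * mesh_size s) t).
  by apply: igD; [exact: igZ|exact: ig_cst].
have -> : 2 * nsq (fun t => f t - w t) + 2 * M * mesh_size s * L =
    integ (fun t => 2 * (f t - w t) ^+ 2 + cst (2 * M * mesh_size s) t).
  by rewrite integD; [rewrite integZ// integ_cst|exact: igZ|exact: ig_cst].
rewrite {1}/nsq !(integ_pieces hs)//; apply: ler_sum => k _.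
have ks := ltn_ord k; have [z0 zz zL] := node_bounds ks.
apply: (@le_trans _ _ (integ (fun t => (f t - w (z k)) ^+ 2 * piece s k t))).
  rewrite (residual_pythagoras (w (z k)) ks) lerDl; apply: integ_ge0 => t _.
  by rewrite mulr_ge0 ?sqr_ge0 ?chi_ge0.
apply: (integ_piece_le (s := s) ks) => //.
  by have [_] : sq (fun t => f t - w (z k)) by apply: sqB => //; exact: sq_cst.
move=> t Dt /andP[zt tz] /=.
have h := hw t (z k) Dt (node_dom hs (ltnW ks)).
have tm : `|t - z k| <= mesh_size s.
  by rewrite gtr0_norm ?subr_gt0//; have := mesh_ge hs ks; lra.
have h2 := ler_wpM2l M0 tm.
have := sqr_ge0 (f t - w t - (w t - w (z k))); nra.
Qed.

End Projection.
End AffineProjection.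

(** * Cubic Hermite interpolation *)

Section Hermite.
Context {R : realType}.
Local Notation D := (@dom R).
Local Notation L := (len R).
Local Notation V := (R -> 'rV[R]_3).
Local Notation H2 := (@Hsp R 2).
Implicit Types (f g h : R -> R) (a b c x y t : R) (s : seq R) (i : 'I_3) (u v w : V).

Definition hermite2 s u : V := fun x => \row_i l2proj s (entry (D2 u) i) x.
Definition hermite1 s u : V := fun x =>
  \row_i (entry (D1 u) i 0 + prim (entry (hermite2 s u) i) x).
(** Known as the cubic Hermite interpolant of u; this construction, from the
    projected second derivative, gives its convergence directly. *)
Definition hermite s u : V := fun x =>
  \row_i (entry u i 0 + prim (entry (hermite1 s u) i) x).

Lemma hermite2E s u i : entry (hermite2 s u) i = l2proj s (entry (D2 u) i).
Proof. by apply/funext => x; rewrite /entry mxE. Qed.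

Lemma hermite1E s u i x : entry (hermite1 s u) i x =
  entry (D1 u) i 0 + prim (entry (hermite2 s u) i) x.
Proof. by rewrite {1}/entry mxE. Qed.

Lemma hermiteE s u i x : entry (hermite s u) i x =
  entry u i 0 + prim (entry (hermite1 s u) i) x.
Proof. by rewrite {1}/entry mxE. Qed.

Section OneFunction.
Variables (s : seq R) (u : V).
Hypothesis hs : itv_partition 0 L s.
Hypothesis Hu : H2 u.
Local Notation z := (node s).
Local Notation res i := (residual s (entry (D2 u) i)).

Let su i : sq (entry (D2 u) i). Proof. by have [] := H2_sq i Hu. Qed.

Lemma hermite_rep : rep (hermite s u) (hermite1 s u) (hermite2 s u).
Proof.
move=> i; have p2 : H1pair (entry (hermite1 s u) i) (entry (hermite2 s u) i).
  split; first by rewrite hermite2E; exact: l2proj_sq.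
  by move=> x _; rewrite !hermite1E prim_at0 addr0.
split => //; split; first exact: H1pair_sq p2.
by move=> x _; rewrite !hermiteE prim_at0 addr0.
Qed.

Lemma hermite_H2 : H2 (hermite s u).
Proof. exact: rep_H2 hermite_rep. Qed.

Lemma hermite1_error i x : D x ->
  entry (D1 u) i x - entry (hermite1 s u) i x = prim (res i) x.
Proof.
move=> Dx; have [_ [_ E]] := H2_rep Hu i.
rewrite (E x Dx) hermite1E hermite2E (primB x (sq_ig (su i)) (sq_ig (l2proj_sq s (entry (D2 u) i)))).
by ring.
Qed.

Lemma hermite_error i x : D x ->
  entry u i x - entry (hermite s u) i x = prim (prim (res i)) x.
Proof.
move=> Dx; have [[s1 E] _] := H2_rep Hu i; have [[s1' _] _] := hermite_rep i.
rewrite (E x Dx) hermiteE opprD addrACA subrr add0r -(primB x (sq_ig s1) (sq_ig s1')).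
by apply: eq_prim => t Dt; exact: hermite1_error.
Qed.

Lemma hermite_node j : (j <= size s)%N -> hermite s u (z j) = u (z j).
Proof.
move=> js; apply: row_eqP => i; have Dz := node_dom hs js.
apply/eqP; rewrite eq_sym -subr_eq0 -/(entry u i (z j)) -/(entry (hermite s u) i (z j)).
by rewrite hermite_error// (prim_prim_residual_node hs (su i) js).
Qed.

Lemma hermite_slope_node j : (j <= size s)%N -> D1 (hermite s u) (z j) = D1 u (z j).
Proof.
move=> js; have Dz := node_dom hs js; rewrite (rep_D1 hermite_rep Dz).
apply: row_eqP => i; apply/eqP.
rewrite eq_sym -subr_eq0 -/(entry (D1 u) i (z j)) -/(entry (hermite1 s u) i (z j)).
by rewrite hermite1_error// (prim_residual_node hs (su i) js).
Qed.

(** Equal initial values and slopes leave only the second derivatives in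
    [Qnorm]. *)
Lemma hermite_distance : Qnorm (hermite s u - u) = \sum_(i < 3) nsq (res i).
Proof.
rewrite (Qnorm_rep (rep_sub hermite_rep (H2_rep Hu))); apply: eq_bigr => i _.
rewrite !entry_sub hermiteE hermite1E !prim_at0 !addr0 !subrr expr0n !add0r.
rewrite /residual nsqBC; apply: eq_nsq => x _; by rewrite entry_sub hermite2E.
Qed.

Lemma bend_hermite : bend u = bend (hermite s u) + \sum_(i < 3) nsq (res i).
Proof.
rewrite (bend_sum Hu) (bend_rep hermite_rep) -big_split; apply: eq_bigr => i _ /=.
by rewrite hermite2E (nsq_pythagoras hs (su i)) addrC.
Qed.

Lemma hermite_C1 : C1 (hermite s u).
Proof.
have r := hermite_rep; split; first by have [] := hermite_H2.
have c1 i : {within D, continuous (entry (hermite1 s u) i)}.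
  exact: H1pair_continuous (r i).2.
exists (hermite1 s u); split; first exact/within_entryP.
move=> x; rewrite in_itv /= => x0L; apply: is_derive_vector => i.
have -> : entry (hermite s u) i = (fun y => cst (entry u i 0) y + prim (entry (hermite1 s u) i) y).
  by apply/funext => y; rewrite hermiteE.
have d := prim_is_derive (c1 i) x0L.
have := is_deriveD (is_derive_cst (entry u i 0) x 1) d.
by rewrite add0r.
Qed.

Lemma hermite_Vh : Vh s (hermite s u).
Proof.
split; first exact: hermite_C1.
move=> j i; have js := ltn_ord j; have [z0 zz zL] := node_bounds hs js.
have r := hermite_rep; have [[s1 E1] [s2 E2]] := r i.
have Dn x : z j <= x <= z j.+1 -> D x.
  by move=> /andP[h1 h2]; rewrite domE (le_trans z0 h1) (le_trans h2 zL).
have zj : z j <= z j <= z j.+1 by rewrite lexx.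
have affine : exists2 p : {poly R}, (size p <= 2)%N &
    forall t, z j < t <= z j.+1 -> entry (hermite2 s u) i t = p.[t].
  exists ((integ (fun t => entry (D2 u) i t * piece s j t) / elt_width s j)%:P +
    (12 / elt_width s j ^+ 3 * integ (fun t => entry (D2 u) i t * (t - elt_center s j) * piece s j t)) *:
       ('X - (elt_center s j)%:P)).
    rewrite (leq_trans (size_polyD _ _))// geq_max (leq_trans (size_polyC_leq1 _))//=.
    by rewrite (leq_trans (size_scale_leq _ _))// size_XsubC.
  move=> t ht; rewrite hermite2E /l2proj (piecewise_eq hs _ js ht).
  by rewrite hornerD hornerC hornerZ hornerXsubC.
have quad := primitive_poly z0 zz zL _ affine.
have {quad} quad : exists2 q : {poly R}, (size q <= 3)%N &
    forall x, z j <= x <= z j.+1 -> entry (hermite1 s u) i x = q.[x].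
  apply: quad => x /[dup] xj /andP[h1 h2].
  rewrite (E2 x (Dn x xj)) (E2 _ (Dn _ zj)) -(prim_sub (sq_ig s2) z0 h1); ring.
have quad' : exists2 q : {poly R}, (size q <= 3)%N &
    forall x, z j < x <= z j.+1 -> entry (hermite1 s u) i x = q.[x].
  have [q q3 H] := quad; exists q => // x /andP[h1 h2].
  by apply: H; rewrite (ltW h1).
have cubic := primitive_poly (F := entry (hermite s u) i) z0 zz zL _ quad'.
have {cubic} [p p4 H] : exists2 q : {poly R}, (size q <= 4)%N &
    forall x, z j <= x <= z j.+1 -> entry (hermite s u) i x = q.[x].
  apply: cubic => x /[dup] xj /andP[h1 h2].
  rewrite (E1 x (Dn x xj)) (E1 _ (Dn _ zj)) -(prim_sub (sq_ig s1) z0 h1); ring.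
by exists p => // x; rewrite in_itv /= => xj; exact: H.
Qed.

End OneFunction.

(** The second derivative is a primitive of the third; the square of the modulus
    of continuity is linear, as in [prim_holder]. *)
Lemma H3_D2_holder w : Hsp 3 w -> H2 w /\
  exists (om : 'I_3 -> R -> R) (M : R), [/\ 0 <= M, forall i, sq (om i),
    forall i x y, D x -> D y -> (om i x - om i y) ^+ 2 <= M * `|x - y| &
    forall i, nsq (fun x => entry (D2 w) i x - om i x) = 0].
Proof.
move=> [cw [g [wg [g2 [wg2 [g3 [wg3 L2g3]]]]]]].
have Hw : H2 w.
  split => //; exists g; split => //; exists g2; split => //.
  by move=> i; have [] := wg3 i.
split => //; have rw := H2_rep Hw.
have /weak_derivativeP h1 := wg; have /weak_derivativeP h2 := wg2.
have /weak_derivativeP h3 := wg3.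
have cP i : exists c, nsq (fun x => entry g2 i x - (c + prim (entry g3 i) x)) = 0.
  by have [sg2 sg3 wd] := h3 i; exact: weak_derivative_nsq.
pose c i := sval (cid (cP i)); have hc i := svalP (cid (cP i)).
have s3 i : sq (entry g3 i) by have [] := h3 i.
have sp i : sq (prim (entry g3 i)) by apply: continuous_sq; exact: prim_continuous.
have som i : sq (fun x => c i + prim (entry g3 i) x).
  by apply: (sqD (sq_cst (c i))).
exists (fun i x => c i + prim (entry g3 i) x), (\sum_(i < 3) nsq (entry g3 i)).
split => //.
- by apply: sumr_ge0 => i _; exact: nsq_ge0.
- move=> i x y Dx Dy; rewrite opprD addrACA subrr add0r.
  apply: (le_trans (prim_holder (s3 i) Dx Dy)); rewrite ler_wpM2r//.
  by rewrite (bigD1 i)//= lerDl; apply: sumr_ge0 => k _; exact: nsq_ge0.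
- move=> i; have [_ sD1 w1] : [/\ sq (entry w i), sq (entry (D1 w) i) & weak_derivative1 (entry w i) (entry (D1 w) i)].
    by have [a _] := rw i; split; [exact: H1pair_sq a|case: a|exact: H1pair_weak].
  have [_ a2] := rw i; have [sD2 _] := a2; have w2 := H1pair_weak a2.
  have [_ sg wdg] := h1 i; have [_ sg2 wdg2] := h2 i.
  have e1 : nsq (fun x => entry (D1 w) i x - entry g i x) = 0 by exact: weak_derivative_unique w1 wdg.
  have w2' : weak_derivative1 (entry (D1 w) i) (entry g2 i).
    apply/weak_derivative1P => phi tphi; have [cphi _ _ _ _] := test_function_FTC tphi.
    rewrite -((weak_derivative1P _ _).1 wdg2 phi tphi); apply: integ_mul_nsq0 => //.
    exact: continuous_sq.
  have e2 : nsq (fun x => entry (D2 w) i x - entry g2 i x) = 0 by exact: weak_derivative_unique w2 w2'.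
  apply/eqP; rewrite eq_le nsq_ge0 andbT.
  by have := nsq_triangle0 sD2 sg2 (som i) (hc i); rewrite e2 mulr0.
Qed.

Lemma nsq_D2_le_H2norm u w i : H2 u -> H2 w ->
  nsq (fun x => entry (D2 u) i x - entry (D2 w) i x) <= H2norm (w - u) ^+ 2.
Proof.
move=> Hu Hw; have r := rep_sub (H2_rep Hw) (H2_rep Hu).
rewrite nsqBC (le_trans (y := bend (w - u)))//.
  rewrite (bend_rep r) (bigD1 i)//=.
  rewrite (@eq_nsq _ (entry (D2 w - D2 u) i) (fun x => entry (D2 w) i x - entry (D2 u) i x)).
    by rewrite lerDl; apply: sumr_ge0 => k _; exact: nsq_ge0.
  by move=> x _; rewrite entry_sub.
by rewrite bendE H2norm_sqr lerDr addr_ge0 ?L2normsq_ge0.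
Qed.

(** Here the density of H^3 enters: the projections of a Holder continuous
    function converge, uniformly over the meshes of a given size. *)
Lemma residual_small u e : H2 u -> 0 < e ->
  (forall r, 0 < r -> exists2 w, Hsp 3 w & H2norm (w - u) < r) ->
  exists2 r, 0 < r & forall s, itv_partition 0 L s -> mesh_size s <= r ->
    forall i, nsq (residual s (entry (D2 u) i)) <= e.
Proof.
move=> Hu e0 dens.
have e8 : 0 < e / 8 by rewrite divr_gt0.
have [|w H3w wu] := dens (Num.sqrt (e / 8)); first by rewrite sqrtr_gt0.
have [Hw [om [M [M0 som hom om0]]]] := H3_D2_holder H3w.
have L0 := @len_gt0 R.
have ML : 0 <= 2 * M * L by apply: mulr_ge0; [exact: mulr_ge0|exact: ltW].
exists (e / 2 / (2 * M * L + 1)).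
  by rewrite !divr_gt0// ltr_wpDl.
move=> s hs; rewrite ler_pdivlMr ?ltr_wpDl// => hmesh i.
have [_ _ su] := H2_sq i Hu; have [_ _ sw] := H2_sq i Hw.
have h1 := residual_error hs su (som i) M0 (hom i).
have h2 : nsq (fun x => entry (D2 u) i x - om i x) <= e / 4.
  have h := nsq_triangle0 su sw (som i) (om0 i); apply: (le_trans h).
  have : nsq (fun x => entry (D2 u) i x - entry (D2 w) i x) <= e / 8.
    apply: (le_trans (nsq_D2_le_H2norm i Hu Hw)).
    rewrite -(sqr_sqrtr (ltW e8)) lerXn2r ?nnegrE ?H2norm_ge0 ?sqrtr_ge0//.
    exact: ltW.
  lra.
have m0 := mesh_ge0 hs.
apply: (le_trans h1); nra.
Qed.

End Hermite.

(** * Piecewise linear interpolation and the penalty *)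

Section Interpolation.
Context {R : realType}.
Local Notation D := (@dom R).
Local Notation L := (len R).
Implicit Types (f g h : R -> R) (a b c x y t : R) (s : seq R).

Variable s : seq R.
Hypothesis hs : itv_partition 0 L s.
Local Notation z := (node s).

Lemma interp_affine f j x : (j < size s)%N -> z j <= x <= z j.+1 ->
  interp s f x = f (z j) + (f (z j.+1) - f (z j)) * ((x - z j) / (z j.+1 - z j)).
Proof.
move=> js /andP[h1 h2].
pose r k := Num.max 0 (Num.min 1 ((x - z k) / (z k.+1 - z k))).
have gap k : (k < size s)%N -> 0 < z k.+1 - z k.
  by move=> ks; rewrite subr_gt0; exact: node_lt.
have rl k : (0 <= k < j)%N -> (f (z k.+1) - f (z k)) * r k = f (z k.+1) - f (z k).
  move=> /= kj; have ks := ltn_trans kj js; have gk := gap k ks.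
  have zz : z k.+1 <= z j := node_le hs kj (ltnW js).
  rewrite /r min_l ?max_r ?mulr1// ler_pdivlMr// mul1r lerD2r; exact: le_trans zz h1.
have rg k : (j.+1 <= k < size s)%N -> (f (z k.+1) - f (z k)) * r k = 0.
  move=> /andP[jk ks]; have gk := gap k ks.
  have zz : z j.+1 <= z k := node_le hs jk (ltnW ks).
  rewrite /r max_l ?mulr0// ge_min ler_pdivrMr// mul0r subr_le0 (le_trans h2 zz).
  by rewrite orbT.
have rj : r j = (x - z j) / (z j.+1 - z j).
  have gj := gap j js.
  have d0 : 0 <= (x - z j) / (z j.+1 - z j) by rewrite ler_pdivlMr// mul0r subr_ge0.
  have d1 : (x - z j) / (z j.+1 - z j) <= 1 by rewrite ler_pdivrMr// mul1r lerD2r.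
  by rewrite /r min_r// max_r.
rewrite /interp -(big_mkord xpredT (fun k => (f (z k.+1) - f (z k)) * r k)).
rewrite (big_cat_nat (n := j))//= ?(ltnW js)// (big_ltn js).
rewrite (eq_big_nat _ _ rl) (eq_big_nat _ _ rg) big1_eq (telescope_sumr (fun k => f (z k)))// rj.
by rewrite addr0 addrA [_ + (_ - _)]addrC subrK.
Qed.

(** On an element the interpolant lies between its values at the two end points,
    which are within the mesh size of x. *)
Lemma interp_ge f m x : D x ->
  (forall j, (j <= size s)%N -> `|x - z j| <= mesh_size s -> m <= f (z j)) ->
  m <= interp s f x.
Proof.
move=> /(locate hs)[j js xj] hm; have := xj => /andP[h1 h2].
have gj : 0 < z j.+1 - z j by rewrite subr_gt0; exact: node_lt.
have mj := mesh_ge hs js.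
have m1 : m <= f (z j) by apply: (hm _ (ltnW js)); rewrite ger0_norm ?subr_ge0//; lra.
have m2 : m <= f (z j.+1) by apply: (hm _ js); rewrite ler0_norm ?subr_le0//; lra.
rewrite (interp_affine _ js xj).
have : 0 <= (x - z j) / (z j.+1 - z j) <= 1.
  by rewrite ler_pdivlMr// ler_pdivrMr// mul0r mul1r subr_ge0 lerD2r h1 h2.
move: (_ / _) => t /andP[t0 t1]; nra.
Qed.

Lemma interp_ge0 f x : (forall y, 0 <= f y) -> D x -> 0 <= interp s f x.
Proof. by move=> f0 Dx; apply: interp_ge. Qed.

Lemma interp_eq0 f x : (forall j, (j <= size s)%N -> f (z j) = 0) -> D x ->
  interp s f x = 0.
Proof.
move=> f0 /(locate hs)[j js xj]; rewrite (interp_affine _ js xj).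
by rewrite !f0 ?(ltnW js)// subrr mul0r addr0.
Qed.

Lemma interp_ig f : ig (interp s f).
Proof.
have cf : continuous (interp s f).
  move=> x; apply: cvgD; first exact: cvg_cst.
  apply: cvg_big => [|j _]; first exact: add_continuous.
  apply: cvgM; first exact: cvg_cst.
  apply: (@continuous_max R R (fun=> 0) (fun x => Num.min 1 ((x - z j) / (z j.+1 - z j)))).
    exact: cvg_cst.
  apply: (@continuous_min R R (fun=> 1) (fun x => (x - z j) / (z j.+1 - z j))).
    exact: cvg_cst.
  by apply: cvgMl; apply: cvgB; [exact: cvg_id|exact: cvg_cst].
by apply/sq_ig/continuous_sq/continuous_subspaceT.
Qed.

End Interpolation.

Section Penalty.
Context {R : realType}.
Local Notation D := (@dom R).
Local Notation L := (len R).
Local Notation V := (R -> 'rV[R]_3).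
Local Notation H2 := (@Hsp R 2).
Implicit Types (a b c x y t delta eps : R) (s : seq R) (i : 'I_3) (u v w : V).

(** The integrand of the penalty, of which [energy_h] only sees the nodal
    values. *)
Definition violation delta u y : R := (Num.min (third (u y) - delta) 0) ^+ 2.

Lemma violation_ge0 delta u y : 0 <= violation delta u y.
Proof. exact: sqr_ge0. Qed.

Lemma violation_eq0 delta u y : delta <= third (u y) -> violation delta u y = 0.
Proof. by move=> h; rewrite /violation min_r ?expr0n// subr_ge0. Qed.

Lemma violation_ge delta u y m : 0 <= m -> third (u y) + m <= delta ->
  m ^+ 2 <= violation delta u y.
Proof.
move=> m0 h; rewrite /violation min_l; last lra.
by rewrite -[leRHS]sqrrN lerXn2r ?nnegrE//; lra.
Qed.

Lemma energyE u : energy u = 2^-1 * bend u - pi.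
Proof. by rewrite bendE. Qed.

Lemma energy_hE delta s eps u : energy_h delta s eps u =
  2^-1 * bend u + (2 * eps)^-1 * integ (interp s (violation delta u)) - pi.
Proof. by rewrite bendE integE. Qed.

Section Mesh.
Variable s : seq R.
Hypothesis hs : itv_partition 0 L s.

Lemma penalty_ge0 delta u : 0 <= integ (interp s (violation delta u)).
Proof.
by apply: integ_ge0 => x Dx; apply: interp_ge0 => // y; exact: violation_ge0.
Qed.

Lemma bend_le_energy_h delta eps u : 0 < eps ->
  2^-1 * bend u - pi <= energy_h delta s eps u.
Proof.
move=> e0; rewrite energy_hE lerD2r lerDl; apply: mulr_ge0 (penalty_ge0 _ _).
by rewrite invr_ge0 mulr_ge0// ltW.
Qed.

Lemma energy_h_ge delta eps u : 0 < eps -> - pi <= energy_h delta s eps u.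
Proof.
move=> e0; apply: le_trans (bend_le_energy_h delta u e0).
by rewrite lerDr mulr_ge0 ?bend_ge0.
Qed.

Lemma penalty_le delta eps u : 0 < eps ->
  integ (interp s (violation delta u)) <= 2 * eps * (energy_h delta s eps u + pi).
Proof.
move=> e0; have b := bend_ge0 u; have e2 : 0 < 2 * eps by rewrite mulr_gt0.
rewrite energy_hE subrK mulrDr mulVKf ?gt_eqF// lerDr.
by rewrite !mulr_ge0// ltW.
Qed.

End Mesh.
End Penalty.

(** * Recovery sequences and limits of discrete functions *)

Section GammaConvergence.
Context {R : realType}.
Local Notation D := (@dom R).
Local Notation L := (len R).
Local Notation V := (R -> 'rV[R]_3).
Local Notation H2 := (@Hsp R 2).
Implicit Types (c x y t : R) (i : 'I_3) (u v w : V).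

Section Admissible.
Variables (l : nat) (Lbc : V -> 'rV[R]_l) (lbc : 'rV[R]_l) (delta : R).
Hypothesis hLbc : boundary_operator Lbc.

Lemma sqr_entry_le_dotsq n (p : 'rV[R]_n) (i : 'I_n) : p 0 i ^+ 2 <= dotsq p.
Proof. by rewrite /dotsq (bigD1 i)//= lerDl; apply: sumr_ge0 => j _; exact: sqr_ge0. Qed.

Lemma entry_le_enorm n (p : 'rV[R]_n) (i : 'I_n) : `|p 0 i| <= enorm p.
Proof. by rewrite /enorm -sqrtr_sqr ler_wsqrtr// sqr_entry_le_dotsq. Qed.

Lemma cvg0_of_sqr (a b : nat -> R) K : (forall n, a n ^+ 2 <= K * b n) ->
  b @ \oo --> (0 : R) -> a @ \oo --> (0 : R).
Proof.
move=> ab b0; apply/norm_cvg0P.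
apply: (@squeeze_cvgr _ _ _ _ (fun=> 0) (fun n => Num.sqrt (K * b n))).
- by apply: nearW => n; rewrite normr_ge0 /= -sqrtr_sqr ler_wsqrtr.
- exact: cvg_cst.
- rewrite -sqrtr0 -(mulr0 K); apply: continuous_cvg; first exact: sqrt_continuous.
  by apply: cvgM => //; exact: cvg_cst.
Qed.

Lemma cst_cvg_eq (a b : R) : (fun=> a) @ (\oo : set_system nat) --> b -> b = a.
Proof. by move=> h; exact: cvg_unique h (cvg_cst _). Qed.

Section Recovery.
Variables (s : seq R) (u : V).
Hypothesis hs : itv_partition 0 L s.
Hypothesis hu : Adm_delta Lbc lbc delta u.

(** The boundary operator only sees values and slopes at the nodes 0 and L. *)
Lemma hermite_Adm_h : Adm_h Lbc lbc s (hermite s u).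
Proof.
have [[Hu u1 du1 bu] _] := hu; have Hh := hermite_H2 s u.
have node_in (j : 'I_(size s).+1) : (j <= size s)%N by rewrite -ltnS.
split; first exact: hermite_Vh.
- move=> j; rewrite hermite_slope_node// du1//; exact: node_dom.
- move=> j; rewrite hermite_node// u1//; exact: node_dom.
- rewrite -bu; apply: hLbc.2 => //.
  + exact: (hermite_node hs Hu (leq0n (size s))).
  + by rewrite -(node_last hs) hermite_node.
  + exact: (hermite_slope_node hs Hu (leq0n (size s))).
  + by rewrite -(node_last hs) hermite_slope_node.
Qed.

(** The nodal values are those of u, so the penalty is zero, and Pythagoras gives
    the bending energy. *)
Lemma energy_h_hermite eps : energy_h delta s eps (hermite s u) =
  energy u - 2^-1 * \sum_(i < 3) nsq (residual s (entry (D2 u) i)).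
Proof.
have [[Hu _ _ _] ud] := hu.
rewrite energy_hE energyE (bend_hermite hs Hu).
have -> : integ (interp s (violation delta (hermite s u))) = 0.
  rewrite (@eq_integ _ _ (cst 0)) ?integ_cst ?mul0r// => x Dx.
  apply: interp_eq0 => // j js; apply: violation_eq0.
  by rewrite hermite_node//; exact/ud/node_dom.
by rewrite mulr0 addr0 mulrDr; ring.
Qed.

End Recovery.

Section Bounds.
Variables (s : seq R) (eps c : R) (v : V).
Hypothesis hs : itv_partition 0 L s.
Hypothesis e0 : 0 < eps.
Hypothesis hv : Adm_h Lbc lbc s v.
Hypothesis vc : energy_h delta s eps v <= c.

Lemma Adm_h_H2 : H2 v.
Proof. by have [/(Vh_rep hs)[v1 [v2 r]] _ _ _] := hv; exact: rep_H2 r. Qed.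

Lemma bend_bound : bend v <= 2 * (c + pi).
Proof. have := le_trans (bend_le_energy_h hs delta v e0) vc; lra. Qed.

(** The nodal constraints at 0 supply the lower order part of the norm. *)
Lemma Qnorm_bound : Qnorm v <= 2 + 2 * (c + pi).
Proof.
have [_ d1 d0 _] := hv; have := d1 ord0; have := d0 ord0; have := bend_bound.
by rewrite -[node s ord0]/(0 : R) /Qnorm => hb -> ->; rewrite -[2 in leRHS]/(1 + 1 : R) lerD2l.
Qed.

Definition slope_const : R := 2 * L + 2 * L ^+ 2 * (2 * (c + pi)).

Lemma nsq_D2_bound i : nsq (entry (D2 v) i) <= 2 * (c + pi).
Proof.
apply: le_trans bend_bound; rewrite (bend_sum Adm_h_H2) (bigD1 i)//= lerDl.
by apply: sumr_ge0 => j _; exact: nsq_ge0.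
Qed.

Lemma nsq_D1_bound i : nsq (entry (D1 v) i) <= slope_const.
Proof.
have [_ r] := H2_rep Adm_h_H2 i; have [_ /(_ ord0) d1 _ _] := hv.
have L0 := @len_gt0 R.
apply: (le_trans (H1pair_poincare r)); rewrite lerD//.
  rewrite -[leRHS]mulr1 ler_wpM2l//; first by rewrite mulr_ge0// ltW.
  rewrite -[leRHS]d1; exact: sqr_entry_le_dotsq.
apply: ler_wpM2l (nsq_D2_bound i); apply: mulr_ge0 => //; exact: sqr_ge0.
Qed.

Lemma value_holder x y i : D x -> D y ->
  (entry v i x - entry v i y) ^+ 2 <= slope_const * `|x - y|.
Proof.
move=> Dx Dy; have [r _] := H2_rep Adm_h_H2 i.
by apply: (le_trans (H1pair_holder r Dx Dy)); rewrite ler_wpM2r// nsq_D1_bound.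
Qed.

Lemma slope_holder x y i : D x -> D y ->
  (entry (D1 v) i x - entry (D1 v) i y) ^+ 2 <= 2 * (c + pi) * `|x - y|.
Proof.
move=> Dx Dy; have [_ r] := H2_rep Adm_h_H2 i.
by apply: (le_trans (H1pair_holder r Dx Dy)); rewrite ler_wpM2r// nsq_D2_bound.
Qed.

End Bounds.

Section Sequences.
Variables (s : nat -> seq R) (eps : nat -> R).
Hypothesis hs : forall n, itv_partition 0 L (s n).
Hypothesis heps : forall n, 0 < eps n.
Hypothesis hmesh0 : mesh_size (s n) @[n --> \oo] --> (0 : R).
Hypothesis heps0 : eps n @[n --> \oo] --> (0 : R).

Section RecoverySequence.
Variable u : V.
Hypothesis hdensity : density Lbc lbc delta.
Hypothesis hu : Adm_delta Lbc lbc delta u.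

Lemma residuals_cvg0 :
  \sum_(i < 3) nsq (residual (s n) (entry (D2 u) i)) @[n --> \oo] --> (0 : R).
Proof.
apply/cvgrPdist_le => e e0; have e3 : 0 < e / 3 by rewrite divr_gt0.
have [[Hu _ _ _] _] := hu.
have [r r0|r r0 hr] := residual_small Hu e3.
  by have [w [_ ?] ?] := hdensity hu r0; exists w.
have /cvgrPdist_le/(_ r r0) := hmesh0; apply: filterS => n.
rewrite sub0r normrN (ger0_norm (mesh_ge0 (hs n))) => mr.
rewrite sub0r normrN ger0_norm; last by apply: sumr_ge0 => i _; exact: nsq_ge0.
rewrite (le_trans (ler_sum _ (fun i _ => hr _ (hs n) mr i)))//.
by rewrite sumr_const card_ord -[_ *+ 3]mulr_natr divfK.
Qed.

Lemma recovery_strong_cvg : strong_cvg_H2 (fun n => hermite (s n) u) u.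
Proof.
have [[Hu _ _ _] _] := hu; have Hh n := hermite_H2 (s n) u.
split => //.
have dist n : H2norm (hermite (s n) u - u) ^+ 2 <=
    Kq * \sum_(i < 3) nsq (residual (s n) (entry (D2 u) i)).
  rewrite -(hermite_distance (s n) Hu); apply: H2norm_le_Qnorm.
  exact: rep_H2 (rep_sub (hermite_rep (s n) u) (H2_rep Hu)).
exact: cvg0_of_sqr dist residuals_cvg0.
Qed.

Lemma recovery_energy_cvg :
  energy_h delta (s n) (eps n) (hermite (s n) u) @[n --> \oo] --> energy u.
Proof.
rewrite (_ : (fun n => energy_h _ _ _ _) = (fun n => energy u -
    2^-1 * \sum_(i < 3) nsq (residual (s n) (entry (D2 u) i)))); last first.
  by apply/funext => n; rewrite energy_h_hermite.
have -> : energy u = energy u - 2^-1 * 0 by rewrite mulr0 subr0.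
apply: cvgB; first by rewrite mulr0 subr0; exact: cvg_cst.
by apply: cvgM; [exact: cvg_cst|exact: residuals_cvg0].
Qed.

End RecoverySequence.

Section Closure.
Variables (u_ : nat -> V) (u : V) (c : R).
Hypothesis hu_ : forall n, Adm_h Lbc lbc (s n) (u_ n).
Hypothesis hc : forall n, energy_h delta (s n) (eps n) (u_ n) <= c.
Hypothesis hw : weak_cvg_H2 u_ u.

Let cpi : 0 <= c + pi.
Proof. by have := le_trans (energy_h_ge (hs 0) delta (u_ 0) (heps 0)) (hc 0%N); lra. Qed.

(** Stated for f_ so as to apply to the functions and to their derivatives: near x
    there is a node where the constraint holds exactly, and the Holder bound
    carries it to x in the limit. *)
Lemma unit_limit (f_ : nat -> V) (f : V) x M : D x -> 0 <= M ->
  (forall n y i, D y -> (entry (f_ n) i x - entry (f_ n) i y) ^+ 2 <= M * `|x - y|) ->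
  (forall n (j : 'I_(size (s n)).+1), dotsq (f_ n (node (s n) j)) = 1) ->
  (forall i, entry (f_ n) i x @[n --> \oo] --> entry f i x) ->
  dotsq (f x) = 1.
Proof.
move=> Dx M0 hM h1 hf.
have nearP n : exists j : 'I_(size (s n)).+1, `|x - node (s n) j| <= mesh_size (s n).
  by have [j js h] := near_node (hs n) Dx; rewrite -ltnS in js; exists (Ordinal js).
pose j n := sval (cid (nearP n)); have hj n := svalP (cid (nearP n)).
have Dj n : D (node (s n) (j n)) by apply: node_dom => //; rewrite -ltnS.
pose q n i := entry (f_ n) i (node (s n) (j n)).
have cq i : q n i @[n --> \oo] --> entry f i x.
  have d0 : (entry (f_ n) i x - q n i) @[n --> \oo] --> (0 : R).
    apply: (cvg0_of_sqr (K := M)) hmesh0 => n.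
    by apply: (le_trans (hM n _ i (Dj n))); rewrite ler_wpM2l.
  rewrite -[in X in _ --> X](subr0 (entry f i x)).
  rewrite (_ : (q^~ i) = (fun n => entry (f_ n) i x - (entry (f_ n) i x - q n i))).
    exact: cvgB (hf i) d0.
  by apply/funext => n; rewrite subKr.
apply: cst_cvg_eq.
rewrite (_ : (fun=> 1) = (fun n => \sum_(i < 3) q n i ^+ 2)).
  apply: cvg_big => [|i _]; first exact: add_continuous.
  by apply: cvgM; exact: cq.
by apply/funext => n /=; rewrite -[LHS](h1 n (j n)).
Qed.

Lemma weak_cvg_value x i : D x -> entry (u_ n) i x @[n --> \oo] --> entry u i x.
Proof. by move=> Dx; have [_ _ h] := hw; exact: h _ (value_bounded i Dx). Qed.

Lemma weak_cvg_slope x i : D x -> entry (D1 (u_ n)) i x @[n --> \oo] --> entry (D1 u) i x.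
Proof. by move=> Dx; have [_ _ h] := hw; exact: h _ (slope_bounded i Dx). Qed.

Lemma slope_const_ge0 : 0 <= slope_const c.
Proof.
have L0 := ltW (@len_gt0 R).
apply: addr_ge0; first exact: mulr_ge0.
by apply: mulr_ge0; [apply: mulr_ge0 => //; exact: sqr_ge0|exact: mulr_ge0].
Qed.

(** The components of the boundary operator are bounded functionals, hence weakly
    continuous. *)
Lemma limit_boundary : Lbc u = lbc.
Proof.
have [Hu_ Hu h] := hw; have [[lin [C hC]] _] := hLbc.
apply/rowP => i.
have bF : bounded_linear_H2 (fun y : R^o => `|y : R|) (fun v => (Lbc v 0 i : R^o)).
  split=> [a v w Hv Hw|]; first by rewrite lin// !mxE.
  by exists C => v Hv; apply: le_trans (hC v Hv); exact: entry_le_enorm.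
have := h _ bF.
have -> : (fun n => Lbc (u_ n) 0 i : R) = cst (lbc 0 i).
  by apply/funext => n; have [_ _ _ ->] := hu_ n.
by move=> /cst_cvg_eq ->.
Qed.

(** If u_3 < delta at x, set 3 m = delta - u_3(x). One m is lost to pointwise
    convergence at x, one to the Holder bound between x and the nodes at distance
    at most 2 d, and the last one is a violation at all these nodes. *)
Lemma limit_obstacle x : D x -> delta <= third (u x).
Proof.
move=> Dx; rewrite leNgt; apply/negP => ux.
pose m := (delta - third (u x)) / 3.
have m0 : 0 < m by rewrite divr_gt0// subr_gt0.
have K0 := slope_const_ge0.
pose d := m ^+ 2 / (2 * slope_const c + 1).
have K1 : 0 < 2 * slope_const c + 1 by rewrite ltr_wpDl// mulr_ge0.
have d0 : 0 < d by rewrite divr_gt0// exprn_gt0.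
have dK : slope_const c * (2 * d) <= m ^+ 2.
  have : (2 * slope_const c + 1) * d = m ^+ 2 by rewrite mulrC divfK// gt_eqF.
  lra.
have [lm lm0 hlm] := integ_ge_bump Dx d0.
have : \forall n \near \oo, m ^+ 2 * lm <= 2 * eps n * (c + pi).
  have /cvgrPdist_le/(_ m m0) h1 := weak_cvg_value (i := ord_max) Dx.
  have /cvgrPdist_le/(_ d d0) h2 := hmesh0.
  apply: filterS2 h1 h2 => n h1 h2.
  have h2' : mesh_size (s n) <= d.
    by move: h2; rewrite sub0r normrN ger0_norm// (mesh_ge0 (hs n)).
  apply: (@le_trans _ _ (integ (interp (s n) (violation delta (u_ n))))); last first.
    apply: (le_trans (penalty_le _ _ _ (heps n))).
    rewrite ler_wpM2l// ?lerD2r//; rewrite mulr_ge0// ltW//; exact: heps.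
  apply: hlm.
  - exact: interp_ig.
  - exact: sqr_ge0.
  - by move=> y Dy; apply: interp_ge0 => // t; exact: violation_ge0.
  - move=> y Dy xy; apply: (interp_ge (hs n) Dy) => j js yj.
    apply: violation_ge; first exact: ltW.
    have Dj := node_dom (hs n) js.
    have hh := value_holder (hs n) (heps n) (hu_ n) (hc n) ord_max Dj Dx.
    have hx : `|node (s n) j - x| <= 2 * d.
      rewrite distrC (le_trans (ler_distD y _ _))//; move: xy yj h2'; lra.
    have : (entry (u_ n) ord_max (node (s n) j) - entry (u_ n) ord_max x) ^+ 2 <= m ^+ 2.
      by apply: (le_trans hh); apply: le_trans dK; rewrite ler_wpM2l.
    rewrite -[X in X <= _]real_normK ?num_real// ler_pXn2r ?nnegrE ?(ltW m0)//.
    move: h1; rewrite /third -/(entry (u_ n) ord_max (node (s n) j)) => h1 h3.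
    have := ux; rewrite /third -/(entry u ord_max x) => ux'.
    have mE : 3 * m = delta - entry u ord_max x by rewrite mulrC divfK.
    move: h1 h3; rewrite !ler_norml => /andP[a1 a2] /andP[a3 a4]; lra.
move=> hn.
have ce : 2 * eps n * (c + pi) @[n --> \oo] --> (0 : R).
  rewrite -(mul0r (c + pi)) -(mulr0 2).
  by apply: cvgM; [apply: cvgM => //; exact: cvg_cst|exact: cvg_cst].
have mlm : 0 < m ^+ 2 * lm by rewrite mulr_gt0// exprn_gt0.
have lm_le0 : m ^+ 2 * lm <= 0 by exact: cvgr_to_ge ce hn.
by move: lm_le0; rewrite leNgt mlm.
Qed.

Lemma limit_admissible : Adm_delta Lbc lbc delta u.
Proof.
have [_ Hu _] := hw.
split; last by move=> x; exact: limit_obstacle.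
split => //; last exact: limit_boundary.
- move=> x Dx; apply: (@unit_limit u_ u x _ Dx slope_const_ge0) => [n y i Dy|n|i].
  + exact: (value_holder (hs n) (heps n) (hu_ n) (hc n)).
  + by have [_ _ h _] := hu_ n.
  + exact: weak_cvg_value.
- have M0 : 0 <= 2 * (c + pi) by rewrite mulr_ge0.
  move=> x Dx.
  apply: (@unit_limit (fun n => D1 (u_ n)) (D1 u) x _ Dx M0) => [n y i Dy|n|i].
  + exact: (slope_holder (hs n) (heps n) (hu_ n) (hc n)).
  + by have [_ h _ _] := hu_ n.
  + exact: weak_cvg_slope.
Qed.

(** The penalty is nonnegative, so only the bending energy has to be lower
    semicontinuous. *)
Lemma energy_lsc B : (\forall n \near \oo, energy_h delta (s n) (eps n) (u_ n) <= B) ->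
  energy u <= B.
Proof.
move=> hB; rewrite energyE.
suff : bend u <= 2 * (B + pi) by lra.
apply: (bend_lsc hw); apply: filterS hB => n.
move=> h; have := le_trans (bend_le_energy_h (hs n) delta (u_ n) (heps n)) h; lra.
Qed.

End Closure.
End Sequences.
End Admissible.
End GammaConvergence.

(** * Subsequences approaching the lower limit *)

Section Subsequences.
Context {R : realType}.
Implicit Types (e : nat -> R) (a c B : R) (k : nat -> nat).

Lemma homo_cvg_infty k : {homo k : m n / (m < n)%N} -> k n @[n --> \oo] --> \oo.
Proof.
move=> hk; have le_k n : (n <= k n)%N.
  by elim: n => // n IH; apply: leq_ltn_trans IH (hk _ _ _).
apply/cvgnyPge => A; exists A => // n /= An; exact: leq_trans An (le_k n).
Qed.

(** Extracted before any weak limit is taken: along further subsequences the bound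
    by the lower limit of the whole sequence persists. *)
Lemma liminf_subsequence e a c : (forall n, a <= e n <= c) ->
  exists k lam, [/\ {homo k : m n / (m < n)%N},
    limn_einf (fun n => (e n)%:E) = lam%:E &
    forall r, 0 < r -> \forall n \near \oo, e (k n) <= lam + r].
Proof.
move=> eac; set u := fun n => (e n)%:E.
have limE : limn_einf u = ereal_sup (range (einfs u)).
  by rewrite limn_einf_lim; apply/cvg_lim => //; exact: cvg_einfs_sup.
have inf_le n : (einfs u n <= limn_einf u)%E.
  by rewrite limE; apply: ereal_sup_ubound; exists n.
have fin : limn_einf u \is a fin_num.
  rewrite fin_numElt; apply/andP; split.
    apply: lt_le_trans (inf_le 0%N); apply: (@lt_le_trans _ _ a%:E); first exact: ltNyr.
    by apply/ereal_infP => _ [n _ <-]; rewrite lee_fin; have /andP[] := eac n.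
  apply: (@le_lt_trans _ _ c%:E); last exact: ltry.
  rewrite limE; apply: ge_ereal_sup => _ [n _ <-].
  apply: (@le_trans _ _ (u n)); last by rewrite lee_fin; have /andP[] := eac n.
  by apply: ereal_inf_lbound; exists n => //=.
pose lam := fine (limn_einf u); have lamE : limn_einf u = lam%:E by rewrite fineK.
have pick n N : exists m, (N <= m)%N /\ e m < lam + n.+1%:R^-1.
  have : (einfs u N < (lam + n.+1%:R^-1)%:E)%E.
    by apply: le_lt_trans (inf_le N) _; rewrite lamE lte_fin ltrDl invr_gt0 ltr0n.
  by move=> /ereal_inf_lt[_ [m /= Nm <-]]; rewrite lte_fin; exists m.
pose next n N := sval (cid (pick n N)); have nextP n N := svalP (cid (pick n N)).
pose k := fix k n := if n is n'.+1 then next n (k n').+1 else next 0%N 0%N.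
exists k, lam; split => //.
  by apply: homo_ltn => [|n]; [exact: ltn_trans|have [] := nextP n.+1 (k n).+1].
have kP n : e (k n) < lam + n.+1%:R^-1.
  by case: n => [|n]; [have [] := nextP 0%N 0%N|have [] := nextP n.+1 (k n).+1].
move=> r r0; near=> n; apply/ltW/(lt_trans (kP n)); rewrite ltrD2l.
by near: n; exact: near_infty_natSinv_lt (PosNum r0).
Unshelve. all: by end_near. Qed.

End Subsequences.

(** * Gamma-convergence *)

Theorem corollary2p8 (R : realType) (l : nat)
    (Lbc : (R -> 'rV[R]_3) -> 'rV[R]_l) (lbc : 'rV[R]_l) (delta : R)
    (hLbc : boundary_operator Lbc)
    (hdelta : 0 <= delta)
    (hnonempty : Adm_delta Lbc lbc delta !=set0)
    (hdefiniteness : definiteness Lbc)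
    (hdensity : density Lbc lbc delta)
    (* meshes and penalty parameters with (h, eps) --> (0, 0) *)
    (s : nat -> seq R) (eps : nat -> R)
    (hs : forall n, itv_partition 0 (len R) (s n))
    (heps : forall n, 0 < eps n)
    (hmesh0 : mesh_size (s n) @[n --> \oo] --> (0 : R))
    (heps0 : eps n @[n --> \oo] --> (0 : R)) :
  [/\ (* (i) *)
      (forall (u_ : nat -> R -> 'rV[R]_3) (c : R),
         (forall n, Adm_h Lbc lbc (s n) (u_ n)) ->
         (forall n, energy_h delta (s n) (eps n) (u_ n) <= c) ->
         exists (u : R -> 'rV[R]_3) (k : nat -> nat),
           [/\ Adm_delta Lbc lbc delta u,
               {homo k : m n / (m < n)%N},
               weak_cvg_H2 (fun n => u_ (k n)) u &
               ((energy u)%:E <=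
                limn_einf (fun n =>
                  (energy_h delta (s n) (eps n) (u_ n))%:E))%E]),
      (* (ii) *)
      (forall u : R -> 'rV[R]_3, Adm_delta Lbc lbc delta u ->
         exists u_ : nat -> R -> 'rV[R]_3,
           [/\ forall n, Adm_h Lbc lbc (s n) (u_ n),
               strong_cvg_H2 u_ u &
               energy_h delta (s n) (eps n) (u_ n) @[n --> \oo] --> energy u])
    & (* (iii) *)
      (forall (eta : nat -> R) (u_ : nat -> R -> 'rV[R]_3)
              (u : R -> 'rV[R]_3) (k : nat -> nat),
         (forall n, 0 <= eta n) ->
         eta n @[n --> \oo] --> (0 : R) ->
         (forall n, quasiminimizer (Adm_h Lbc lbc (s n))
                      (energy_h delta (s n) (eps n)) (eta n) (u_ n)) ->
         {homo k : m n / (m < n)%N} ->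
         weak_cvg_H2 (fun n => u_ (k n)) u ->
         is_minimizer (Adm_delta Lbc lbc delta) (@energy R) u)].
Proof.
have sub_cvg (f : nat -> R) (a : R) k : {homo k : m n / (m < n)%N} ->
    f n @[n --> \oo] --> a -> f (k n) @[n --> \oo] --> a.
  by move=> /homo_cvg_infty hk hf; exact: cvg_comp hk hf.
have recovery_Adm_h n v : Adm_delta Lbc lbc delta v ->
    Adm_h Lbc lbc (s n) (hermite (s n) v).
  by move=> hv; refine (hermite_Adm_h hLbc (hs n) hv).
split=> [u_ c hu hc|u hu|eta u_ u k eta_ge0 eta0 hq hk hw].
- pose E n := energy_h delta (s n) (eps n) (u_ n).
  have E_bnd n : - pi <= E n <= c by rewrite hc energy_h_ge.
  have [j [lam [hj lamE jB]]] := liminf_subsequence E_bnd.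
  have [||u [k [hk hw]]] := @weak_compactness_H2 _ (fun n => u_ (j n)) (2 + 2 * (c + pi)).
  + by move=> n; exact: Adm_h_H2 (hs (j n)) (hu (j n)).
  + by move=> n; exact: Qnorm_bound (hs (j n)) (heps (j n)) (hu (j n)) (hc (j n)).
  have hjk : {homo (fun n => j (k n)) : m n / (m < n)%N} by move=> m n /hk/hj.
  have hs' n := hs (j (k n)); have he' n := heps (j (k n)).
  exists u, (fun n => j (k n)); split => //.
  + exact: (limit_admissible hLbc hs' he' (sub_cvg _ _ _ hjk hmesh0)
      (sub_cvg _ _ _ hjk heps0) (fun n => hu (j (k n))) (fun n => hc (j (k n))) hw).
  + rewrite lamE lee_fin; apply/ler_addgt0Pr => r r0.
    apply: (energy_lsc hs' he' hw (delta := delta)).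
    exact: (homo_cvg_infty hk (jB r r0)).
- exists (fun n => hermite (s n) u); split.
  + by move=> n; apply: recovery_Adm_h.
  + exact (recovery_strong_cvg hs hmesh0 hdensity hu).
  + exact (recovery_energy_cvg eps hs hmesh0 hdensity hu).
- (* up to eta, a quasiminimizer has at most the energy of the interpolant of v *)
  have ub v n : Adm_delta Lbc lbc delta v ->
      energy_h delta (s n) (eps n) (u_ n) <= energy v + eta n.
    move=> hv; have [_ h] := hq n; apply: (le_trans h); rewrite lerD2r.
    apply: (@le_trans _ _ (energy_h delta (s n) (eps n) (hermite (s n) v))).
      apply: ge_inf; last by exists (hermite (s n) v) => //; exact: recovery_Adm_h.
      by exists (- pi) => _ [w _ <-]; exact: energy_h_ge.
    rewrite (energy_h_hermite (hs n) hv) gerBl mulr_ge0//.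
    by apply: sumr_ge0 => i _; exact: nsq_ge0.
  have [v0 hv0] := hnonempty.
  have [C hC] : exists C, forall n, eta n <= C.
    have /cvgP/cvg_seq_bounded/bounded_fun_has_ubound[C hC] := eta0.
    by exists C => n; apply: hC; exists n.
  have hA n : Adm_h Lbc lbc (s (k n)) (u_ (k n)) by have [] := hq (k n).
  have hs' n := hs (k n); have he' n := heps (k n).
  split.
    apply: (limit_admissible hLbc hs' he' (sub_cvg _ _ _ hk hmesh0)
      (sub_cvg _ _ _ hk heps0) hA _ hw (c := energy v0 + C)).
    by move=> n; apply: (le_trans (ub v0 _ hv0)); rewrite lerD2l.
  move=> v hv; apply/ler_addgt0Pr => r r0.
  apply: (energy_lsc hs' he' hw (delta := delta)).
  have /cvgrPdist_le/(_ r r0) := sub_cvg _ _ _ hk eta0; apply: filterS => n.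
  rewrite sub0r normrN ger0_norm// => er.
  by apply: (le_trans (ub v _ hv)); rewrite lerD2l.
Qed.
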